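(* Let $R$ be a complete Cohen--Macaulay local ring. Then $R$ is of finite Cohen--Macaulay representation type if and only if $\mathrm{KGdim}\ \underline{\mathrm{mod}}(\mathcal{C}(R)) = 0$.
   Context: $R$ is a commutative Noetherian local ring. $\mathcal{C}(R)$ is the full subcategory of the category of finitely generated $R$-modules consisting of all maximal Cohen--Macaulay (MCM) $R$-modules. $R$ is of finite Cohen--Macaulay representation type if there are only finitely many isomorphism classes of indecomposable MCM $R$-modules. $\mathrm{mod}(\mathcal{C}(R))$ is the category of finitely presented contravariant additive functors $F$ from $\mathcal{C}(R)$ to abelian groups (that is, there is an exact sequence $\mathrm{Hom}_R(-,Y)\to \mathrm{Hom}_R(-,X)\to F\to 0$ with $X,Y\in\mathcal{C}(R)$), with natural transformations as morphisms. $\underline{\mathrm{mod}}(\mathcal{C}(R))$ is its full subcategory of functors $F$ with $F(R)=0$; it is an abelian category. For an abelian category $\mathcal{A}$ put $\mathcal{A}_{-1}=0$ and, for $n\ge 0$, let $\mathcal{A}_n$ be the full subcategory of all objects of $\mathcal{A}$ that have finite length in the Serre quotient category $\mathcal{A}/\mathcal{A}_{n-1}$. The Krull--Gabriel dimension is $\mathrm{KGdim}\ \mathcal{A}=\min\{n\ge 0 \mid \mathcal{A}=\mathcal{A}_n\}$ if such a minimum exists, and $\infty$ otherwise. *)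

(* Defs.v *)
From HB Require Import structures.
From mathcomp Require Import all_boot all_algebra.
From mathcomp Require Import boolp.

Set Implicit Arguments.
Unset Strict Implicit.
Unset Printing Implicit Defensive.

Import GRing.Theory.
Local Open Scope ring_scope.

Section CommutativeAlgebra.
Variable R : comNzRingType.

Definition in_span (M : lmodType R) (s : seq M) (x : M) : Prop :=
  exists c : 'I_(size s) -> R, x = \sum_(i < size s) c i *: s`_i.

Definition fin_gen (M : lmodType R) : Prop :=
  exists s : seq M, forall x, in_span s x.

(* An arbitrary ideal is a submodule of R^o; the library's [idealr_closed]
   describes proper ideals only. *)
Definition noetherian_ring : Prop :=
  forall I : {pred R^o}, submod_closed I ->
    exists s : seq R^o, forall x, x \in I <-> in_span s x.

Definition maximal_ideal (I : {pred R}) : Prop :=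
  idealr_closed I /\
  forall J : {pred R}, idealr_closed J -> {subset I <= J} -> J =i I.

Definition local_ring (m : {pred R}) : Prop :=
  maximal_ideal m /\ forall m' : {pred R}, maximal_ideal m' -> m' =i m.

(* The coefficients [c] make the zeroth power the unit ideal. *)
Definition in_ideal_power (I : {pred R}) (n : nat) (x : R) : Prop :=
  exists (k : nat) (c : 'I_k -> R) (a : 'I_k -> 'I_n -> R),
    (forall i j, a i j \in I) /\ x = \sum_(i < k) c i * \prod_(j < n) a i j.

(* R -> lim R/I^n is injective and surjective; an element of the limit is
   represented by a sequence of lifts. *)
Definition adically_complete (I : {pred R}) : Prop :=
  (forall x, (forall n, in_ideal_power I n x) -> x = 0) /\
  (forall u : nat -> R, (forall n, in_ideal_power I n (u n.+1 - u n)) ->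
     exists l : R, forall n, in_ideal_power I n (l - u n)).

Definition is_max (P : nat -> Prop) (n : nat) : Prop :=
  P n /\ forall k, P k -> (k <= n)%N.

Definition prime_ideal (P : {pred R}) : Prop :=
  idealr_closed P /\ prime_idealr_closed P.

Definition prime_chain (n : nat) (p : nat -> {pred R}) : Prop :=
  (forall i, (i <= n)%N -> prime_ideal (p i)) /\
  (forall i, (i < n)%N -> {subset p i <= p i.+1} /\ ~ {subset p i.+1 <= p i}).

Definition krull_dim (d : nat) : Prop :=
  is_max (fun n => exists p, prime_chain n p) d.

(* z belongs to (s_0, s_1, ...)M *)
Definition in_ideal_mul (M : lmodType R) (s : seq R) (z : M) : Prop :=
  exists w : 'I_(size s) -> M, z = \sum_(i < size s) s`_i *: w i.

Definition regular_seq (M : lmodType R) (s : seq R) : Prop :=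
  (forall i, (i < size s)%N -> forall z : M,
     in_ideal_mul (take i s) (s`_i *: z) -> in_ideal_mul (take i s) z) /\
  (exists z : M, ~ in_ideal_mul s z).

Definition depth (m : {pred R}) (M : lmodType R) (d : nat) : Prop :=
  is_max (fun n => exists s : seq R,
    [/\ size s = n, {subset s <= m} & regular_seq M s]) d.

Definition cohen_macaulay (m : {pred R}) : Prop :=
  exists d, krull_dim d /\ depth m R^o d.

(* The zero module counts as maximal Cohen-Macaulay (its depth is +oo), so that
   the maximal Cohen-Macaulay modules form an additive category. *)
Definition is_mcm (m : {pred R}) (M : lmodType R) : Prop :=
  fin_gen M /\
  ((forall x : M, x = 0) \/ exists d, krull_dim d /\ depth m M d).

Record mcm (m : {pred R}) := Mcm {
  mcm_mod :> lmodType R;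
  mcm_is_mcm : is_mcm m mcm_mod
}.

Definition indecomposable (M : lmodType R) : Prop :=
  (exists x : M, x <> 0) /\
  forall N L : {pred M}, submod_closed N -> submod_closed L ->
    (forall x, exists y z, [/\ y \in N, z \in L & x = y + z]) ->
    (forall x, x \in N -> x \in L -> x = 0) ->
    (forall x, x \in N -> x = 0) \/ (forall x, x \in L -> x = 0).

Definition mod_iso (M N : lmodType R) : Prop :=
  exists f : {linear M -> N}, bijective f.

Definition finite_cm_type (m : {pred R}) : Prop :=
  exists (n : nat) (X : 'I_n -> mcm m),
    forall M : mcm m, indecomposable M -> exists i, mod_iso M (X i).

Lemma regular_module_mcm (m : {pred R}) : cohen_macaulay m -> is_mcm m R^o.
Proof.
move=> hCM; split; last by right.
exists [:: (1 : R^o)] => x; exists (fun=> x).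
by rewrite big_ord1 /= /GRing.scale /= mulr1.
Qed.

Definition regular_mcm (m : {pred R}) (hCM : cohen_macaulay m) : mcm m :=
  Mcm (regular_module_mcm hCM).

End CommutativeAlgebra.

Definition HomR (R : comNzRingType) (M N : lmodType R) := {linear M -> N}.

Section HomR.
Variables (R : comNzRingType) (M N : lmodType R).

Lemma HomR_ext (f g : HomR M N) : f =1 g -> f = g.
Proof.
move=> /funext; case: f g => [f cf] [g cg] /= fg.
rewrite /GRing.Linear.sort /= in fg.
case: _ / fg cg => cg; congr GRing.Linear.Pack.
case: cf cg => [[a1] [b1]] [[a2] [b2]].
by rewrite (Prop_irrelevance a1 a2) (Prop_irrelevance b1 b2).
Qed.

HB.instance Definition _ := gen_eqMixin (HomR M N).
HB.instance Definition _ := gen_choiceMixin (HomR M N).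

Definition HomR_zero : HomR M N := \0.
Definition HomR_opp (f : HomR M N) : HomR M N := \- f.
Definition HomR_add (f g : HomR M N) : HomR M N := f \+ g.

Lemma HomR_addA : associative HomR_add.
Proof. by move=> f g h; apply: HomR_ext => x /=; rewrite addrA. Qed.
Lemma HomR_addC : commutative HomR_add.
Proof. by move=> f g; apply: HomR_ext => x /=; rewrite addrC. Qed.
Lemma HomR_add0 : left_id HomR_zero HomR_add.
Proof. by move=> f; apply: HomR_ext => x /=; rewrite add0r. Qed.
Lemma HomR_addN : left_inverse HomR_zero HomR_opp HomR_add.
Proof. by move=> f; apply: HomR_ext => x /=; rewrite addNr. Qed.

HB.instance Definition _ :=
  GRing.isZmodule.Build (HomR M N) HomR_addA HomR_addC HomR_add0 HomR_addN.

End HomR.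

Definition HomR_id (R : comNzRingType) (M : lmodType R) : HomR M M := idfun.
Definition HomR_comp (R : comNzRingType) (M N P : lmodType R)
  (g : HomR N P) (f : HomR M N) : HomR M P := g \o f.

Declare Scope cat_scope.
Delimit Scope cat_scope with cat.

(* Hom-sets are setoids: [heq] plays the role of equality of morphisms. *)
Record category := Category {
  obj :> Type;
  hom : obj -> obj -> Type;
  heq : forall X Y, hom X Y -> hom X Y -> Prop;
  idm : forall X, hom X X;
  compm : forall X Y Z, hom Y Z -> hom X Y -> hom X Z;
  heq_refl : forall X Y (f : hom X Y), heq f f;
  heq_sym : forall X Y (f g : hom X Y), heq f g -> heq g f;
  heq_trans : forall X Y (f g h : hom X Y), heq f g -> heq g h -> heq f h;
  comp_heq : forall X Y Z (g g' : hom Y Z) (f f' : hom X Y),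
    heq g g' -> heq f f' -> heq (compm g f) (compm g' f');
  comp_assoc : forall X Y Z T (h : hom Z T) (g : hom Y Z) (f : hom X Y),
    heq (compm h (compm g f)) (compm (compm h g) f);
  comp_idl : forall X Y (f : hom X Y), heq (compm (idm Y) f) f;
  comp_idr : forall X Y (f : hom X Y), heq (compm f (idm X)) f
}.
Arguments idm {c} X.

Notation "f == g" := (heq f g) : cat_scope.
Notation "g * f" := (compm g f) : cat_scope.

Section CategoryNotions.
Variable A : category.
Local Open Scope cat_scope.

Definition is_zero (Z : A) : Prop :=
  forall X : A, (exists f : hom X Z, forall g : hom X Z, g == f) /\
                (exists f : hom Z X, forall g : hom Z X, g == f).

Definition zero_mor (X Y : A) (f : hom X Y) : Prop :=
  exists (Z : A) (u : hom X Z) (v : hom Z Y), is_zero Z /\ f == v * u.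

Definition is_mono (X Y : A) (f : hom X Y) : Prop :=
  forall (T : A) (u v : hom T X), f * u == f * v -> u == v.

Definition is_iso (X Y : A) (f : hom X Y) : Prop :=
  exists g : hom Y X, g * f == idm X /\ f * g == idm Y.

Definition is_kernel (X Y K : A) (f : hom X Y) (k : hom K X) : Prop :=
  zero_mor (f * k) /\
  forall (T : A) (t : hom T X), zero_mor (f * t) ->
    exists u : hom T K, k * u == t /\
      forall v : hom T K, k * v == t -> v == u.

Definition is_cokernel (X Y C : A) (f : hom X Y) (c : hom Y C) : Prop :=
  zero_mor (c * f) /\
  forall (T : A) (t : hom Y T), zero_mor (t * f) ->
    exists u : hom C T, u * c == t /\
      forall v : hom C T, v * c == t -> v == u.

Definition is_simple (S : A) : Prop :=
  ~ is_zero S /\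
  forall (T : A) (u : hom T S), is_mono u -> is_zero T \/ is_iso u.

(* Objects with a finite composition series, built one simple factor at a time
   from short exact sequences 0 -> Y -> X -> S -> 0. *)
Inductive finite_length : A -> Prop :=
| finite_length_zero X : is_zero X -> finite_length X
| finite_length_ext Y X S (u : hom Y X) (p : hom X S) :
    is_kernel p u -> is_cokernel u p -> is_simple S ->
    finite_length Y -> finite_length X.

End CategoryNotions.

Section FullSubcategory.
Variables (A : category) (P : A -> Prop).

Record full_obj := FullObj { full_val :> A; full_prop : P full_val }.

Definition full_subcategory : category.
Proof.
refine {|
  obj := full_obj;
  hom X Y := hom (full_val X) (full_val Y);
  heq X Y f g := heq f g;
  idm X := idm (full_val X);
  compm X Y Z g f := compm g f |}.
- by move=> *; apply: heq_refl.
- by move=> *; apply: heq_sym.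
- by move=> X Y f g h fg gh; apply: heq_trans fg gh.
- by move=> *; apply: comp_heq.
- by move=> *; apply: comp_assoc.
- by move=> *; apply: comp_idl.
- by move=> *; apply: comp_idr.
Defined.

End FullSubcategory.

(* The Serre quotient A/S of an abelian category by a Serre subcategory S is
   the localization of A at the morphisms with kernel and cokernel in S: it has
   the objects of A, and morphisms freely generated by those of A and by formal
   inverses, modulo the congruence making A -> A/S a functor and the formal
   inverses inverse to the given morphisms. *)
Section SerreQuotient.
Variables (A : category) (S : A -> Prop).

Definition quo_equiv (X Y : A) (f : hom X Y) : Prop :=
  (exists (K : A) (k : hom K X), is_kernel f k /\ S K) /\
  (exists (C : A) (c : hom Y C), is_cokernel f c /\ S C).

Inductive quo_hom : A -> A -> Type :=
| quo_id X : quo_hom X X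
| quo_comp X Y Z : quo_hom Y Z -> quo_hom X Y -> quo_hom X Z
| quo_mor X Y : hom X Y -> quo_hom X Y
| quo_inv X Y (s : hom X Y) : quo_equiv s -> quo_hom Y X.

Inductive quo_heq : forall X Y : A, quo_hom X Y -> quo_hom X Y -> Prop :=
| quo_refl X Y (f : quo_hom X Y) : quo_heq f f
| quo_sym X Y (f g : quo_hom X Y) : quo_heq f g -> quo_heq g f
| quo_trans X Y (f g h : quo_hom X Y) :
    quo_heq f g -> quo_heq g h -> quo_heq f h
| quo_comp_heq X Y Z (g g' : quo_hom Y Z) (f f' : quo_hom X Y) :
    quo_heq g g' -> quo_heq f f' -> quo_heq (quo_comp g f) (quo_comp g' f')
| quo_assoc X Y Z T (h : quo_hom Z T) (g : quo_hom Y Z) (f : quo_hom X Y) :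
    quo_heq (quo_comp h (quo_comp g f)) (quo_comp (quo_comp h g) f)
| quo_idl X Y (f : quo_hom X Y) : quo_heq (quo_comp (quo_id Y) f) f
| quo_idr X Y (f : quo_hom X Y) : quo_heq (quo_comp f (quo_id X)) f
| quo_mor_heq X Y (f g : hom X Y) : heq f g -> quo_heq (quo_mor f) (quo_mor g)
| quo_mor_id X : quo_heq (quo_mor (idm X)) (quo_id X)
| quo_mor_comp X Y Z (g : hom Y Z) (f : hom X Y) :
    quo_heq (quo_mor (compm g f)) (quo_comp (quo_mor g) (quo_mor f))
| quo_invl X Y (s : hom X Y) (hs : quo_equiv s) :
    quo_heq (quo_comp (quo_inv hs) (quo_mor s)) (quo_id X)
| quo_invr X Y (s : hom X Y) (hs : quo_equiv s) :
    quo_heq (quo_comp (quo_mor s) (quo_inv hs)) (quo_id Y).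

Definition serre_quotient : category := {|
  obj := A;
  hom := quo_hom;
  heq := quo_heq;
  idm := quo_id;
  compm := quo_comp;
  heq_refl := quo_refl;
  heq_sym := quo_sym;
  heq_trans := quo_trans;
  comp_heq := quo_comp_heq;
  comp_assoc := quo_assoc;
  comp_idl := quo_idl;
  comp_idr := quo_idr |}.

End SerreQuotient.

(* [KG_filtration A n] is the subcategory A_n of an abelian category A; the base
   case is the quotient by A_{-1} = 0. *)
Fixpoint KG_filtration (A : category) (n : nat) : A -> Prop :=
  match n with
  | 0%N => fun X => @finite_length (serre_quotient (@is_zero A)) X
  | k.+1 => fun X => @finite_length (serre_quotient (@KG_filtration A k)) X
  end.

Definition KG_exhausted (A : category) : pred nat :=
  fun n => `[< forall X : A, KG_filtration n X >].

(* [None] stands for infinity. *)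
Definition KGdim (A : category) : option nat :=
  match pselect (exists n, KG_exhausted A n) with
  | left h => Some (ex_minn h)
  | right _ => None
  end.

Section FunctorCategory.
Variables (R : comNzRingType) (m : {pred R}).

Record add_functor := AddFunctor {
  fobj :> mcm m -> zmodType;
  fmap : forall M N : mcm m, HomR M N -> {additive fobj N -> fobj M};
  fmap_id : forall (M : mcm m) (x : fobj M), fmap (HomR_id M) x = x;
  fmap_comp : forall (M N P : mcm m) (g : HomR N P) (f : HomR M N) x,
    fmap (HomR_comp g f) x = fmap f (fmap g x);
  fmap_add : forall (M N : mcm m) (f g : HomR M N) x,
    fmap (f + g) x = fmap f x + fmap g x
}.

Record nat_trans (F G : add_functor) := NatTrans {
  nt :> forall M : mcm m, {additive F M -> G M};
  nt_natural : forall (M N : mcm m) (f : HomR M N) (x : F N),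
    nt M (fmap F f x) = fmap G f (nt N x)
}.

Definition nt_id (F : add_functor) : nat_trans F F :=
  @NatTrans F F (fun M => idfun) (fun _ _ _ _ => erefl).

Definition nt_comp (F G H : add_functor)
  (b : nat_trans G H) (a : nat_trans F G) : nat_trans F H.
Proof.
exists (fun M => b M \o a M : {additive F M -> H M}).
by move=> M N f x /=; rewrite !nt_natural.
Defined.

Definition functor_category : category.
Proof.
refine {|
  obj := add_functor;
  hom := nat_trans;
  heq F G a b := forall M : mcm m, a M =1 b M;
  idm := nt_id;
  compm := nt_comp |} => //.
- by move=> F G a b ab M x; rewrite ab.
- by move=> F G a b c ab bc M x; rewrite ab bc.
- by move=> F G H b b' a a' bb' aa' M x /=; rewrite aa' bb'.
Defined.

Section Representable.
Variable X : mcm m.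

Section Precomposition.
Variables (M N : mcm m) (f : HomR M N).

Definition precomp (h : HomR N X) : HomR M X := HomR_comp h f.

Fact precomp_is_zmod_morphism : zmod_morphism precomp.
Proof. by move=> h k; apply: HomR_ext. Qed.

HB.instance Definition _ :=
  GRing.isZmodMorphism.Build (HomR N X) (HomR M X) precomp
    precomp_is_zmod_morphism.

End Precomposition.

Definition representable : add_functor.
Proof.
refine {| fobj M := HomR M X : zmodType;
          fmap M N f := precomp f : {additive HomR N X -> HomR M X} |}.
- by move=> M x; apply: HomR_ext.
- by move=> M N P g f x; apply: HomR_ext.
- by move=> M N f g x; apply: HomR_ext => y /=; rewrite raddfD.
Defined.

End Representable.

Definition finitely_presented (F : add_functor) : Prop :=
  exists (X Y : mcm m) (a : nat_trans (representable Y) (representable X))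
         (b : nat_trans (representable X) F),
    forall M : mcm m,
      (forall x : F M, exists y, b M y = x) /\
      (forall y, b M y = 0 <-> exists z, a M z = y).

Definition mod_category : category :=
  @full_subcategory functor_category finitely_presented.

Definition stable_mod_category (hCM : cohen_macaulay m) : category :=
  @full_subcategory mod_category
    (fun F => forall x : fobj (full_val F) (regular_mcm hCM), x = 0).

End FunctorCategory.

(* Main.v *)
From HB Require Import structures.
From mathcomp Require Import all_boot all_algebra.
From mathcomp Require Import zify ring boolp.
Require Import Defs.

Set Implicit Arguments.
Unset Strict Implicit.
Unset Printing Implicit Defensive.

Import GRing.Theory.
Local Open Scope ring_scope.

(** Write [A] for the category of functors F with F(R) = 0. Its objects are the
cokernels of Hom(-, Y) -> Hom(-, X) for the surjections Y -> X of maximal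
Cohen-Macaulay modules; kernels of surjections are again maximal Cohen-Macaulay, so
fibre products present the pointwise kernels of maps in [A], and kernels and cokernels
in [A] are pointwise. The localisation A/0 is therefore [A] itself, and dimension 0
means that every object of [A] has finite length ([stable_finite_length]).

If every object has finite length then the type is finite
([finite_length_finite_type]). As R is complete, indecomposable modules have local
endomorphism rings ([indecomposable_local]), so a simple functor is nonzero on at most
one indecomposable module ([simple_indecomposable]), and a functor of finite length on
finitely many. A single functor suffices to see all nonfree modules: the functor of
stable maps into the d-th syzygy X of the residue field k, where d = dim R. Indeed the
stable Hom(N, X) is Tor_{d+1}(Tr N, k), with Tr N the Auslander transpose. Simple
functors are killed by m, so by finite length each element of m has a power which is
stably zero on N; dividing N by a regular sequence of such powers, the vanishing of
Tor_{d+1}(Tr N, k) goes down to that of Tor_1(Tr N, N), the stable Hom(N, N)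
([tor_vanish_regular], [tor_vanish_residue]). Then the identity of N factors through a
free module, and an indecomposable N is R.

If the type is finite then every object has finite length
([finite_type_finite_length]). Given a surjection Y -> X, a map h from M to X and r in
m, the fibre products of Y and M along the maps r^j h have boundedly many generators;
two of them are isomorphic, and Miyata's theorem yields that some r^i h lifts to Y
([power_lifts], after Huneke and Leuschke). Hence F(B) has finite length as an R-module
for every F in [A] and every module B. For B the sum of all indecomposable modules a
subfunctor of F is determined by its value on B ([additive_generator]), so chains of
subfunctors of F are bounded. *)

(** * Submodules and linear maps *)

Definition surjective (A B : Type) (f : A -> B) : Prop :=
  forall y, exists x, f x = y.

Lemma inj_of_ker0 (V W : zmodType) (f : {additive V -> W}) :
  (forall x, f x = 0 -> x = 0) -> injective f.
Proof.
by move=> h x y e; apply/eqP; rewrite -subr_eq0; apply/eqP/h; rewrite raddfB e subrr.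
Qed.

Lemma inj_surj_bij (V W : Type) (f : V -> W) : injective f -> surjective f -> bijective f.
Proof. by move=> fI /choice[g gK]; exists g => // x; apply: fI. Qed.

Section Submodules.
Variable R : comNzRingType.
Implicit Types M N A B C : lmodType R.

Definition submod M (U : M -> Prop) : Prop :=
  U 0 /\ forall a x y, U x -> U y -> U (a *: x + y).

Section SubmodTheory.
Variables (M : lmodType R) (U : M -> Prop) (sU : submod U).

Lemma submod0 : U 0. Proof. by case: sU. Qed.
Lemma submodD x y : U x -> U y -> U (x + y).
Proof. by move=> Ux Uy; rewrite -[x]scale1r; apply: sU.2. Qed.
Lemma submodZ a x : U x -> U (a *: x).
Proof. by move=> Ux; rewrite -[_ *: _]addr0; apply: sU.2 => //; apply: submod0. Qed.
Lemma submodN x : U x -> U (- x).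
Proof. by move=> Ux; rewrite -scaleN1r; apply: submodZ. Qed.
Lemma submodB x y : U x -> U y -> U (x - y).
Proof. by move=> Ux Uy; apply: submodD => //; apply: submodN. Qed.
Lemma submod_sum I (r : seq I) (P : pred I) (F : I -> M) :
  (forall i, P i -> U (F i)) -> U (\sum_(i <- r | P i) F i).
Proof.
move=> UF; elim/big_ind: _ => //; [exact: submod0 | exact: submodD].
Qed.
Lemma submodDl x y : U x -> U (x + y) <-> U y.
Proof.
move=> Ux; split=> [Uxy|]; last exact: submodD.
by rewrite -[y](addKr x); apply: submodD => //; apply: submodN.
Qed.
Lemma submodBr x y : U (x - y) -> U x <-> U y.
Proof.
move=> Uxy; split=> Uz; last by rewrite -[x](subrK y); apply: submodD.
by rewrite -[y](subKr x); apply: submodB.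
Qed.
End SubmodTheory.

(** The smallest submodule containing [S], defined impredicatively so that its
elimination rule is its definition. *)
Definition generated M (S : M -> Prop) (z : M) : Prop :=
  forall V : M -> Prop, submod V -> (forall x, S x -> V x) -> V z.

Lemma generated_submod M (S : M -> Prop) : submod (generated S).
Proof.
split=> [|a x y gx gy] V sV SV; first exact: submod0.
by apply: sV.2; [apply: gx | apply: gy].
Qed.

Lemma generated_mem M (S : M -> Prop) x : S x -> generated S x.
Proof. by move=> Sx V _; apply. Qed.

Definition addS M (U V : M -> Prop) (z : M) : Prop :=
  exists u v, [/\ U u, V v & z = u + v].

Definition scaleS M (a : R) (z : M) : Prop := exists w, z = a *: w.

Definition zeroS M (z : M) : Prop := z = 0.

Definition kerS M N (f : M -> N) (x : M) : Prop := f x = 0.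
Definition imS M N (f : M -> N) (y : N) : Prop := exists x, f x = y.

Lemma addS_submod M (U V : M -> Prop) : submod U -> submod V -> submod (addS U V).
Proof.
move=> sU sV; split.
  by exists 0, 0; split; rewrite ?addr0 //; apply: submod0.
move=> a _ _ [u [v [Uu Vv ->]]] [u' [v' [Uu' Vv' ->]]].
exists (a *: u + u'), (a *: v + v'); split; [exact: sU.2|exact: sV.2|].
by rewrite scalerDr addrACA.
Qed.

Lemma scaleS_submod M a : submod (@scaleS M a).
Proof.
split; first by exists 0; rewrite scaler0.
move=> b _ _ [w ->] [w' ->]; exists (b *: w + w').
by rewrite scalerDr !scalerA mulrC.
Qed.

Lemma zeroS_submod M : submod (@zeroS M).
Proof. by split=> // a x y -> ->; rewrite /zeroS scaler0 addr0. Qed.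

Lemma fullS_submod M : submod (fun _ : M => True). Proof. by []. Qed.

Lemma kerS_submod M N (f : {linear M -> N}) : submod (kerS f).
Proof.
split; first exact: raddf0.
by move=> a x y fx fy; rewrite /kerS linearP fx fy scaler0 addr0.
Qed.

Lemma imS_submod M N (f : {linear M -> N}) : submod (imS f).
Proof.
split; first by exists 0; apply: raddf0.
by move=> a _ _ [x <-] [y <-]; exists (a *: x + y); rewrite linearP.
Qed.

Lemma preim_submod M N (f : {linear M -> N}) (U : N -> Prop) :
  submod U -> submod (fun x => U (f x)).
Proof.
move=> sU; split; first by rewrite raddf0; apply: submod0.
by move=> a x y Ux Uy; rewrite linearP; apply: sU.2.
Qed.

Lemma capS_submod M (U V : M -> Prop) :
  submod U -> submod V -> submod (fun x => U x /\ V x).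
Proof.
move=> sU sV; split; first by split; apply: submod0.
by move=> a x y [Ux Vx] [Uy Vy]; split; [apply: sU.2|apply: sV.2].
Qed.

Lemma addSl M (U V : M -> Prop) x : submod V -> U x -> addS U V x.
Proof. by move=> sV Ux; exists x, 0; split; rewrite ?addr0 //; apply: submod0. Qed.

Lemma addSr M (U V : M -> Prop) x : submod U -> V x -> addS U V x.
Proof. by move=> sU Vx; exists 0, x; split; rewrite ?add0r //; apply: submod0. Qed.

Lemma addS_sub M (U V W : M -> Prop) : submod W ->
  (forall x, U x -> W x) -> (forall x, V x -> W x) -> forall x, addS U V x -> W x.
Proof. by move=> sW UW VW _ [u [v [/UW Wu /VW Wv ->]]]; apply: submodD. Qed.

Lemma linear_pack A B (f : A -> B) :
  (forall c x y, f (c *: x + y) = c *: f x + f y) ->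
  exists g : {linear A -> B}, forall x, g x = f x.
Proof.
move=> lf.
pose g : {linear A -> B} := HB.pack f (GRing.isLinear.Build R A B *:%R f lf).
by exists g.
Qed.

(** A linear relation which is everywhere defined and single-valued at 0 is the
graph of a linear map; this is how maps induced on quotients, kernels and
fibre products are obtained below. *)
Lemma linear_of_rel A B (rho : A -> B -> Prop) :
  (forall a, exists b, rho a b) ->
  (forall c a a' b b', rho a b -> rho a' b' -> rho (c *: a + a') (c *: b + b')) ->
  (forall b, rho 0 b -> b = 0) ->
  exists f : {linear A -> B}, forall a b, rho a b <-> b = f a.
Proof.
move=> tot lin inj.
have uniq a b b' : rho a b -> rho a b' -> b = b'.
  move=> h h'; have := lin (-1) _ _ _ _ h' h.
  rewrite !scaleN1r addNr => /inj /eqP; rewrite addrC subr_eq0.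
  by move=> /eqP.
have [f fP] := choice tot.
have [|g gE] := @linear_pack A B f.
  by move=> c x y; apply: uniq (fP _) _; apply: lin.
exists g => a b; rewrite gE; split=> [/uniq|->]; last exact: fP.
by apply; apply: fP.
Qed.

Lemma inl_map A B : exists f : {linear A -> (A * B)%type}, forall x, f x = (x, 0).
Proof. by apply: linear_pack => c x y; congr (_, _); rewrite /= scaler0 addr0. Qed.

Lemma inr_map A B : exists f : {linear B -> (A * B)%type}, forall y, f y = (0, y).
Proof. by apply: linear_pack => c x y; congr (_, _); rewrite /= scaler0 addr0. Qed.

Lemma copair_map A B C (f : {linear A -> C}) (g : {linear B -> C}) :
  exists h : {linear (A * B)%type -> C}, forall t, h t = f t.1 + g t.2.
Proof.
by apply: linear_pack => c x y; rewrite !linearP /= scalerDr addrACA.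
Qed.

Lemma submodule_exists M (U : M -> Prop) : submod U ->
  exists (K : lmodType R) (u : {linear K -> M}),
    injective u /\ forall x, U x <-> imS u x.
Proof.
move=> sU.
pose T := {x : M | `[< U x >]}.
have inU (x : T) : U (val x) by apply/asboolP; case: x.
pose mk x (Ux : U x) : T := exist _ x (asboolT Ux).
pose zr : T := mk 0 (submod0 sU).
pose ad (x y : T) : T := mk _ (submodD sU (inU x) (inU y)).
pose op (x : T) : T := mk _ (submodN sU (inU x)).
pose sc (a : R) (x : T) : T := mk _ (submodZ sU a (inU x)).
have adA : associative ad by move=> x y z; apply: val_inj; rewrite /= addrA.
have adC : commutative ad by move=> x y; apply: val_inj; rewrite /= addrC.
have ad0 : left_id zr ad by move=> x; apply: val_inj; rewrite /= add0r.
have adN : left_inverse zr op ad by move=> x; apply: val_inj; rewrite /= addNr.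
pose Z : zmodType := HB.pack T (GRing.isZmodule.Build T adA adC ad0 adN).
have scA a b (v : Z) : sc a (sc b v) = sc (a * b) v.
  by apply: val_inj; rewrite /= scalerA.
have sc1 : left_id 1 sc by move=> v; apply: val_inj; rewrite /= scale1r.
have scDr : right_distributive sc (@GRing.add Z).
  by move=> a u v; apply: val_inj; rewrite /= scalerDr.
have scDl (v : Z) : {morph sc^~ v : a b / a + b >-> @GRing.add Z a b}.
  by move=> a b; apply: val_inj; rewrite /= scalerDl.
pose K : lmodType R := HB.pack Z (GRing.Zmodule_isLmodule.Build R Z scA sc1 scDr scDl).
have [|u uE] := @linear_pack K M (fun x : T => val x) => //.
exists K, u; split=> [x y|x]; first by rewrite !uE => /val_inj.
split=> [Ux|[y <-]]; first by exists (mk x Ux); rewrite uE.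
by rewrite uE; apply: inU.
Qed.

(** The quotient is carried by a system of representatives of the cosets. *)
Lemma quotient_exists M (U : M -> Prop) : submod U ->
  exists (Q : lmodType R) (p : {linear M -> Q}),
    surjective p /\ forall x, p x = 0 <-> U x.
Proof.
move=> sU.
have [rep [repU repP]] : exists rep : M -> M,
    (forall x, U (rep x - x)) /\ forall x y, U (x - y) -> rep x = rep y.
  pose P x := [pred y | `[< U (y - x) >]].
  have Pxx x : P x x by apply/asboolP; rewrite subrr; apply: submod0.
  exists (fun x => choose (P x) x); split=> [x|x y Uxy].
    by apply/asboolP/(chooseP (Pxx x)).
  have eP : P x =1 P y.
    move=> z; apply: asbool_equiv_eq; apply: submodBr => //.
    by rewrite opprB addrC addrA subrK -opprB; apply: submodN.
  rewrite (eq_choose eP); apply: choose_id => //.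
  by rewrite -eP /=; apply/asboolP; rewrite subrr; apply: submod0.
pose T := {x : M | rep x == x}.
have repK x : rep (rep x) == rep x by apply/eqP/repP.
pose p x : T := exist _ (rep x) (repK x).
have pP x y : U (x - y) -> p x = p y by move=> Uxy; apply/val_inj/repP.
have pK (t : T) : p (val t) = t by apply: val_inj; apply/eqP; case: t.
pose ad (x y : T) := p (val x + val y).
pose op (x : T) := p (- val x).
pose sc (a : R) (x : T) := p (a *: val x).
have adE x y : ad (p x) (p y) = p (x + y).
  by apply: pP; rewrite opprD addrACA; apply: submodD => //; apply: repU.
have opE x : op (p x) = p (- x).
  by apply: pP; rewrite -opprD; apply: submodN => //; apply: repU.
have scE a x : sc a (p x) = p (a *: x).
  by apply: pP; rewrite -scalerBr; apply: submodZ => //; apply: repU.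
have adA : associative ad.
  by move=> x y z; rewrite -(pK x) -(pK y) -(pK z) !adE addrA.
have adC : commutative ad by move=> x y; rewrite -(pK x) -(pK y) !adE addrC.
have ad0 : left_id (p 0) ad by move=> x; rewrite -(pK x) adE add0r.
have adN : left_inverse (p 0) op ad.
  by move=> x; rewrite -(pK x) opE adE addNr.
pose Z : zmodType := HB.pack T (GRing.isZmodule.Build T adA adC ad0 adN).
have scA a b (v : Z) : sc a (sc b v) = sc (a * b) v.
  by rewrite -(pK v) !scE scalerA.
have sc1 : left_id 1 sc by move=> v; rewrite -(pK v) scE scale1r.
have scDr : right_distributive sc (@GRing.add Z).
  by move=> a u v; rewrite -(pK u) -(pK v) /GRing.add /= !(scE, adE) scalerDr.
have scDl (v : Z) : {morph sc^~ v : a b / a + b >-> @GRing.add Z a b}.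
  by move=> a b; rewrite -(pK v) /GRing.add /= !(scE, adE) scalerDl.
pose Q : lmodType R :=
  HB.pack Z (GRing.Zmodule_isLmodule.Build R Z scA sc1 scDr scDl).
have [|q qE] := @linear_pack M Q p.
  by move=> c x y; rewrite -[LHS]adE -scE.
exists Q, q; split=> [y|x]; first by exists (val y); rewrite qE pK.
rewrite qE; split=> [/(congr1 val) /= e|Ux]; last by apply: pP; rewrite subr0.
have := submodB sU (repU 0) (repU x).
by rewrite e subr0 opprB addrCA subrr addr0.
Qed.

End Submodules.

(** * Finitely generated modules over a Noetherian ring *)
Section Noetherian.
Variable R : comNzRingType.
Implicit Types M N A B C : lmodType R.

Lemma in_span_nil M (x : M) : in_span [::] x <-> x = 0.
Proof.
by split=> [[c ->]|->]; [rewrite big_ord0|exists (fun=> 0); rewrite big_ord0].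
Qed.

Lemma in_span_cons M (a : M) s x :
  in_span (a :: s) x <-> exists c y, in_span s y /\ x = c *: a + y.
Proof.
split=> [[c ->]|[c [_ [[d ->] ->]]]].
  rewrite big_ord_recl /=; exists (c ord0), (\sum_(i < size s) c (lift ord0 i) *: s`_i).
  by split=> //; exists (fun i => c (lift ord0 i)).
exists (fun i => oapp d c (unlift ord0 i)).
by rewrite big_ord_recl /= unlift_none; congr (_ + _); apply: eq_bigr => i _; rewrite liftK.
Qed.

Lemma in_spanE M (s : seq M) x : in_span s x <-> generated (fun y => y \in s) x.
Proof.
elim: s x => [|a s IH] x.
  split=> [/in_span_nil-> V sV _|]; first exact: submod0.
  by move=> /(_ _ (@zeroS_submod _ M)) h; apply/in_span_nil/h.
rewrite in_span_cons; split=> [[c [y [/IH gy ->]]] V sV SV|].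
  apply: sV.2; first by apply: SV; rewrite mem_head.
  by apply: gy => // z zs; apply: SV; rewrite inE zs orbT.
move=> h; apply: (h (fun x => exists c y, in_span s y /\ x = c *: a + y)).
  split.
    by exists 0, 0; rewrite scale0r addr0; split=> //; apply/IH; apply: submod0 (generated_submod _).
  move=> d _ _ [c [y [/IH gy ->]]] [c' [y' [/IH gy' ->]]].
  exists (d * c + c'), (d *: y + y'); split.
    by apply/IH; apply: (generated_submod _).2.
  by rewrite scalerDr scalerDl scalerA addrACA.
move=> z; rewrite inE => /orP[/eqP->|zs].
  by exists 1, 0; rewrite scale1r addr0; split=> //; apply/IH; apply: submod0 (generated_submod _).
by exists 0, z; rewrite scale0r add0r; split=> //; apply/IH; apply: generated_mem.
Qed.

Lemma in_span_submod M (s : seq M) : submod (in_span s).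
Proof.
have gs := generated_submod (fun y => y \in s).
split; first by apply/in_spanE; apply: submod0 gs.
by move=> a x y /in_spanE gx /in_spanE gy; apply/in_spanE; apply: gs.2.
Qed.

Lemma in_span_mem M (s : seq M) x : x \in s -> in_span s x.
Proof. by move=> xs; apply/in_spanE; apply: generated_mem. Qed.

Lemma in_span_min M (s : seq M) (V : M -> Prop) : submod V ->
  (forall x, x \in s -> V x) -> forall x, in_span s x -> V x.
Proof. by move=> sV sub x /in_spanE; apply. Qed.

Lemma fin_gen_surj M N (f : {linear M -> N}) :
  surjective f -> fin_gen M -> fin_gen N.
Proof.
move=> fS [s gs]; exists (map f s) => y; have [x <-] := fS y.
apply: (@in_span_min _ s (fun x => in_span (map f s) (f x))) (gs x).
  exact/preim_submod/in_span_submod.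
by move=> z zs; apply/in_span_mem/map_f.
Qed.

Hypothesis noeth : noetherian_ring R.

Lemma ideal_fg (I : R -> Prop) : submod (I : R^o -> Prop) ->
  exists s : seq R^o, forall x, I x <-> in_span s x.
Proof.
move=> sI; have [|s sP] := @noeth (fun x => `[< I x >]).
  split; first exact/asboolP/(submod0 sI).
  by move=> a x y /asboolP Ix /asboolP Iy; apply/asboolP/sI.2.
by exists s => x; rewrite -sP; split=> /asboolP.
Qed.

Lemma fg_submodule_of_span M (s : seq M) (U : M -> Prop) : submod U ->
  (forall x, U x -> in_span s x) -> exists t : seq M, forall x, U x <-> in_span t x.
Proof.
elim: s U => [|a s IH] U sU Us.
  exists [::] => x; split=> [/Us//|]; rewrite in_span_nil => ->; exact: submod0.
pose I c := exists x y, [/\ U x, in_span s y & x = c *: a + y].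
have ss := in_span_submod s.
have [|cs csP] := @ideal_fg I.
  split.
    by exists 0, 0; rewrite scale0r addr0; split=> //; apply: submod0.
  move=> d c c' [x [y [Ux sy xE]]] [x' [y' [Ux' sy' xE']]].
  exists (d *: x + x'), (d *: y + y'); split.
  - exact: sU.2.
  - exact: ss.2.
  - by rewrite xE xE' scalerDr scalerDl -scalerA addrACA.
have [||t tP] := IH (fun x => U x /\ in_span s x).
- exact: capS_submod.
- by move=> x [].
have [g gP] : exists g : R -> M, forall c, I c ->
    U (g c) /\ exists y, in_span s y /\ g c = c *: a + y.
  have [c|g gP] := @choice R M (fun c x => I c -> U x /\ exists y, in_span s y /\ x = c *: a + y).
    have [[x [y [Ux sy e]]]|nI] := pselect (I c); first by exists x => _; split=> //; exists y.
    by exists 0.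
  by exists g.
have UI c : c \in cs -> I c by move=> cs_c; apply/csP/in_span_mem.
exists (map g cs ++ t) => x; have sT := in_span_submod (map g cs ++ t); split; last first.
  apply: in_span_min => // z; rewrite mem_cat => /orP[/mapP[c cs_c ->]|zt].
    by have [] := gP c (UI c cs_c).
  by have /tP[] := in_span_mem zt.
move=> Ux; have /in_span_cons[c [y [sy xE]]] := Us _ Ux.
have : I c by exists x, y.
move=> /csP cspan.
have [x0 [y0 [tx0 Ux0 sy0 x0E]]] : exists x0 y0,
    [/\ in_span (map g cs ++ t) x0, U x0, in_span s y0 & x0 = c *: a + y0].
  apply: (@in_span_min R^o cs (fun c => exists x0 y0,
    [/\ in_span (map g cs ++ t) x0, U x0, in_span s y0 & x0 = c *: a + y0])) cspan.
    split.
      by exists 0, 0; rewrite scale0r addr0; split=> //; apply: submod0.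
    move=> d e e' [z [w [tz Uz sw zE]]] [z' [w' [tz' Uz' sw' zE']]].
    exists (d *: z + z'), (d *: w + w'); split; [exact: sT.2|exact: sU.2|exact: ss.2|].
    by rewrite zE zE' scalerDr scalerDl -scalerA addrACA.
  move=> e es; have [Ug [w [sw gE]]] := gP e (UI e es).
  by exists (g e), w; split=> //; apply: in_span_mem; rewrite mem_cat map_f.
rewrite -(subrK x0 x); apply: submodD => //.
have : in_span t (x - x0).
  apply/tP; split; first exact: submodB.
  by rewrite xE x0E opprD addrACA subrr add0r; apply: submodB.
apply: in_span_min => // z zt; apply: in_span_mem.
by rewrite mem_cat zt orbT.
Qed.

Lemma fg_submodule M (U : M -> Prop) : fin_gen M -> submod U ->
  exists t : seq M, forall x, U x <-> in_span t x.
Proof. by move=> [s gs] sU; apply: (@fg_submodule_of_span _ s). Qed.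

Lemma fin_gen_inj M N (f : {linear M -> N}) :
  injective f -> fin_gen N -> fin_gen M.
Proof.
move=> fI fgN; have [t tP] := fg_submodule fgN (imS_submod f).
have [g gP] : exists g : N -> M, forall y, imS f y -> f (g y) = y.
  have [y|g gP] := @choice N M (fun y x => imS f y -> f x = y).
    by have [[x xy]|n] := pselect (imS f y); [exists x|exists 0].
  by exists g.
have ft y : y \in t -> f (g y) = y by move=> yt; apply/gP/tP/in_span_mem.
exists (map g t) => x; have /tP : imS f (f x) by exists x.
have h : submod (fun y => exists2 x, f x = y & in_span (map g t) x).
  have sT := in_span_submod (map g t); split.
    by exists 0; [exact: raddf0|exact: submod0].
  move=> a _ _ [u <- tu] [v <- tv]; exists (a *: u + v); rewrite ?linearP //.
  exact: sT.2.
move=> /(in_span_min h) [|x' /fI <-//].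
by move=> y yt; exists (g y); [exact: ft|exact/in_span_mem/map_f].
Qed.

(** Ascending chain condition: a chain with no maximal element has a finitely
generated union, whose generators all lie in one member of the chain. *)
Lemma noetherian_maximal M (P : (M -> Prop) -> Prop) (U0 : M -> Prop) :
  fin_gen M -> (forall U, P U -> submod U) -> P U0 ->
  exists U, P U /\ forall V, P V -> (forall x, U x -> V x) -> forall x, V x -> U x.
Proof.
move=> fgM Psub PU0; apply: contrapT => nomax.
have step U : exists V, P U -> [/\ P V, forall x, U x -> V x & ~ forall x, V x -> U x].
  have [PU|nPU] := pselect (P U); last by exists U.
  apply: contrapT => h; apply: nomax; exists U; split=> // V PV UV.
  by apply: contrapT => nVU; apply: h; exists V.
have [f fP] := choice step.
pose W n := iter n f U0.
have PW n : P (W n) by elim: n => //= n /fP[].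
have Wmono n k x : W n x -> W (k + n)%N x.
  by elim: k => //= k IH /IH; have [_ h _] := fP _ (PW (k + n)%N); apply: h.
have Wle n k x : (n <= k)%N -> W n x -> W k x.
  by move=> nk; rewrite -(subnK nk); apply: Wmono.
have sW : submod (fun x => exists n, W n x).
  split.
    by exists 0%N; apply: submod0 (Psub _ (PW 0%N)).
  move=> a x y [n Wx] [k Wy]; exists (maxn n k).
  by apply: (Psub _ (PW _)).2; [apply: Wle Wx|apply: Wle Wy]; rewrite (leq_maxl, leq_maxr).
have [t tP] := fg_submodule fgM sW.
have [n nP] : exists n, forall x, x \in t -> W n x.
  have : forall x, x \in t -> exists n, W n x by move=> x xt; apply: (iffRL (tP x)); apply: in_span_mem.
  elim: t {tP} => [|a t IH] h; first by exists 0%N.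
  have [|n nP] := IH; first by move=> x xt; apply: h; rewrite inE xt orbT.
  have [k Wk] := h a (mem_head _ _); exists (maxn n k) => x.
  rewrite inE => /orP[/eqP->|/nP]; first exact: Wle (leq_maxr n k) Wk.
  exact: Wle (leq_maxl n k).
have [_ _] := fP _ (PW n); apply => x Wx.
have : in_span t x by apply: (iffLR (tP x)); exists n.+1.
by apply: in_span_min => //; apply: Psub.
Qed.

Lemma fin_gen_regular : fin_gen (R^o : lmodType R).
Proof.
exists [:: (1 : R^o)] => x; exists (fun=> x).
by rewrite big_ord1 /= /GRing.scale /= mulr1.
Qed.

Lemma noetherian_maximal_ideal (P : (R -> Prop) -> Prop) (I0 : R -> Prop) :
  (forall I, P I -> submod (I : R^o -> Prop)) -> P I0 ->
  exists I, P I /\ forall J, P J -> (forall x, I x -> J x) -> forall x, J x -> I x.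
Proof. exact: (@noetherian_maximal R^o P I0 fin_gen_regular). Qed.

End Noetherian.

(** * Nakayama's lemma and Krull's intersection theorem *)
Section Local.
Variables (R : comNzRingType) (m : {pred R}).
Hypotheses (noeth : noetherian_ring R) (loc : local_ring m).
Implicit Types M N A B C : lmodType R.

Lemma m0 : 0 \in m. Proof. by have [[[]]] := loc. Qed.
Lemma m1 : 1 \notin m. Proof. by have [[[]]] := loc. Qed.
Lemma mP a x y : x \in m -> y \in m -> a * x + y \in m.
Proof. by have [[[_ _ h] _] _] := loc => xm ym; apply: h. Qed.
Lemma mMl a x : x \in m -> a * x \in m.
Proof. by move=> xm; rewrite -[_ * _]addr0; apply: mP => //; apply: m0. Qed.
Lemma mMr a x : x \in m -> x * a \in m.
Proof. by rewrite mulrC; apply: mMl. Qed.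
Lemma mD x y : x \in m -> y \in m -> x + y \in m.
Proof. by move=> xm ym; rewrite -[x]mul1r; apply: mP. Qed.
Lemma mN x : x \in m -> - x \in m.
Proof. by move=> xm; rewrite -mulN1r; apply: mMl. Qed.

Lemma m_submod : submod (fun x : R^o => x \in m).
Proof. by split; [exact: m0|move=> a x y; apply: mP]. Qed.

(** A proper ideal is contained in a maximal one, hence in [m]. *)
Lemma proper_sub_m (I : R -> Prop) : submod (I : R^o -> Prop) -> ~ I 1 ->
  forall x, I x -> x \in m.
Proof.
move=> sI nI1.
pose P (J : R -> Prop) := [/\ submod (J : R^o -> Prop), ~ J 1 & forall x, I x -> J x].
have [||J [[sJ nJ1 IJ] Jmax]] := @noetherian_maximal_ideal _ noeth P I.
- by move=> J [].
- by [].
have idJ (K : R -> Prop) : submod (K : R^o -> Prop) -> ~ K 1 -> idealr_closed (fun x => `[< K x >] : bool).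
  move=> sK nK1; split; first exact/asboolP/(submod0 sK).
    by apply/asboolP.
  by move=> a u v /asboolP Ku /asboolP Kv; apply/asboolP/sK.2.
have maxJ : maximal_ideal (fun x => `[< J x >]).
  split; first exact: idJ.
  move=> K [K0 K1 KP] JK x; apply/idP/idP; last exact: JK.
  move=> Kx; apply/asboolP; apply: (Jmax (fun x => x \in K)) => //; last first.
    by move=> y Jy; apply: JK; apply/asboolP.
  split; last by move=> y /IJ Jy; apply: JK; apply/asboolP.
    by split=> // a u v Ku Kv; apply: KP.
  by apply/negP.
have [_ uniq] := loc; move=> x /IJ Jx.
by rewrite -(uniq _ maxJ); apply/asboolP.
Qed.

Lemma unitNm s : s \notin m -> exists t, t * s = 1.
Proof.
move=> sm; apply: contrapT => h; case/negP: sm.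
apply: (@proper_sub_m (fun x => exists t, t * s = x)) => //.
- split.
   by exists 0; rewrite mul0r.
  by move=> a _ _ [t <-] [t' <-]; exists (a * t + t'); rewrite mulrDl -mulrA.
- by exists 1; rewrite mul1r.
Qed.

Lemma unit1Bm s : s \in m -> exists t, t * (1 - s) = 1.
Proof.
move=> sm; apply: unitNm; apply/negP => h; case/negP: m1.
by rewrite -(subrK s 1); apply: mD.
Qed.

(** [mulm U] is the submodule mU. *)
Definition mulm M (U : M -> Prop) : M -> Prop :=
  generated (fun z => exists a w, [/\ a \in m, U w & z = a *: w]).

Lemma mulm_submod M (U : M -> Prop) : submod (mulm U).
Proof. exact: generated_submod. Qed.

Lemma mulm_mem M (U : M -> Prop) a w : a \in m -> U w -> mulm U (a *: w).
Proof. by move=> am Uw; apply: generated_mem; exists a, w. Qed.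

Lemma mulm_min M (U V : M -> Prop) : submod V ->
  (forall a w, a \in m -> U w -> V (a *: w)) -> forall z, mulm U z -> V z.
Proof. by move=> sV h z; apply => // _ [a [w [am Uw ->]]]; apply: h. Qed.

Lemma mulm_mono M (U V : M -> Prop) : (forall x, U x -> V x) ->
  forall z, mulm U z -> mulm V z.
Proof.
move=> UV; apply: mulm_min; first exact: mulm_submod.
by move=> a w am Uw; apply: mulm_mem => //; apply: UV.
Qed.

Lemma mulm_sub M (U : M -> Prop) : submod U -> forall z, mulm U z -> U z.
Proof. by move=> sU; apply: mulm_min => // a w _; apply: submodZ. Qed.

(** A generator [a] is congruent modulo [U] and the other generators to [c *: a]
with [c] in [m], so it is redundant because 1 - c is a unit. *)
Lemma nakayama_span M (s : seq M) (U : M -> Prop) : submod U ->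
  (forall x, addS U (in_span s) x) ->
  (forall x, addS U (mulm (fun=> True)) x) -> forall x, U x.
Proof.
move=> sU; elim: s => [|a s IH] Us Um.
  by move=> x; have [u [v [Uu /in_span_nil-> ->]]] := Us x; rewrite addr0.
have ss := in_span_submod s.
have sV : submod (addS U (in_span s)) by apply: addS_submod.
pose Q z := exists c y, [/\ c \in m, addS U (in_span s) y & z = c *: a + y].
have mE : forall z, mulm (fun=> True) z -> Q z.
  apply: mulm_min.
    split.
      by exists 0, 0; rewrite m0 scale0r addr0; split=> //; apply: submod0.
    move=> d _ _ [c [y [cm Vy ->]]] [c' [y' [cm' Vy' ->]]].
    exists (d * c + c'), (d *: y + y'); split; [exact: mP|exact: sV.2|].
    by rewrite scalerDr scalerDl scalerA addrACA.
  move=> b w bm _; have [u [_ [Uu /in_span_cons[c [y [sy ->]]] ->]]] := Us w.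
  exists (b * c), (b *: (u + y)); split; first exact: mMr.
    by apply: submodZ => //; exists u, y.
  by rewrite addrCA scalerDr scalerA.
have Va : addS U (in_span s) a.
  have [u [_ [Uu /mE [c [y [cm Vy ->]]] aE]]] := Um a.
  have [t tE] := unit1Bm cm.
  rewrite -[a]scale1r -tE -scalerA; apply: submodZ => //.
  rewrite scalerBl scale1r {1}aE addrCA addrAC subrr add0r.
  by apply: submodD => //; apply: addSl.
apply: IH => // x.
have [u [_ [Uu /in_span_cons[c [y [sy ->]]] ->]]] := Us x.
apply: submodD => //; first exact: addSl.
by apply: sV.2 => //; apply: addSr.
Qed.

Lemma nakayama M (U : M -> Prop) : fin_gen M -> submod U ->
  (forall x, addS U (mulm (fun=> True)) x) -> forall x, U x.
Proof.
move=> [s gs] sU; apply: (@nakayama_span _ s) => // x.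
by apply: addSr.
Qed.

Lemma nakayama0 M : fin_gen M ->
  (forall x : M, mulm (fun=> True) x) -> forall x : M, x = 0.
Proof.
move=> fgM h; apply: (nakayama fgM (@zeroS_submod _ M)) => x.
by apply: addSr => //; apply: zeroS_submod.
Qed.

(** The powers m^n M. *)
Fixpoint mpow M n : M -> Prop :=
  if n is k.+1 then mulm (@mpow M k) else fun=> True.

Lemma mpow_submod M n : submod (@mpow M n).
Proof. by case: n => [|n]; [exact: fullS_submod|exact: mulm_submod]. Qed.

Lemma mpow_dec M n x : @mpow M n.+1 x -> @mpow M n x.
Proof. exact: mulm_sub (mpow_submod M n) x. Qed.

Lemma mpow_le M n k x : (n <= k)%N -> @mpow M k x -> @mpow M n x.
Proof. by move=> nk; rewrite -(subnK nk); elim: (k - n)%N => //= j IH /mpow_dec/IH. Qed.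

Lemma mpow_linear M N (f : {linear M -> N}) n x : mpow n x -> mpow n (f x).
Proof.
elim: n x => //= n IH; apply: (@mulm_min _ _ (fun x => mulm (@mpow N n) (f x))); first exact: preim_submod (mulm_submod _).
by move=> a w am /IH h; rewrite linearZ; apply: mulm_mem.
Qed.

Lemma mpow_compose M (f : {linear M -> M}) k : (forall x, mpow k (f x)) ->
  forall n x, mpow n x -> mpow (n + k) (f x).
Proof.
move=> h; elim=> [x _|n IH]; first exact: h.
apply: (@mulm_min _ _ (fun x => mpow (n.+1 + k) (f x))); first exact: preim_submod (mulm_submod _).
by move=> a w am /IH hw; rewrite linearZ; apply: mulm_mem.
Qed.

(** The submodules (K : x^t) stabilise at some t. If k + x^t w is in N, with k in K, then
x (k + x^t w) is in K, so x^(t+1) w and therefore x^t w are in K: the submodule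
K + x^t M has the same intersection with N as K, and is K by maximality. *)
Lemma colon_power M (K N : M -> Prop) x : fin_gen M -> submod K -> submod N ->
  x \in m ->
  (forall z, N z -> K (x *: z)) ->
  (forall V, submod V -> (forall z, K z -> V z) ->
     (forall z, V z -> N z -> K z) -> forall z, V z -> K z) ->
  exists t, forall z, K (x ^+ t *: z).
Proof.
move=> fgM sK sN xm NK Kmax.
pose C t z := K (x ^+ t *: z).
have sC t : submod (C t).
  split; first by rewrite /C scaler0; apply: submod0.
  move=> a u v Cu Cv; rewrite /C scalerDr scalerA mulrC -scalerA.
  exact: sK.2.
have [||U [[t UE] Umax]] :=
  @noetherian_maximal _ noeth M (fun U => exists t, U = C t) (C 0%N) fgM.
- by move=> U [t ->].
- by exists 0%N.
have stab z : K (x ^+ t.+1 *: z) -> K (x ^+ t *: z).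
  move=> h; rewrite -[K _]/(C t z) -UE; apply: (Umax (C t.+1)) => //; first by exists t.+1.
  by move=> w; rewrite UE /C exprS -scalerA; apply: submodZ.
exists t => z.
pose V w := addS K (scaleS (x ^+ t)) w.
apply: (Kmax V); rewrite /V.
- by apply: addS_submod => //; apply: scaleS_submod.
- by move=> w Kw; apply: addSl => //; apply: scaleS_submod.
- move=> _ [k [_ [Kk [w ->] ->]]] Nw.
  apply: submodD => //; apply: stab.
  have := NK _ Nw; rewrite scalerDr scalerA -exprS => h.
  by apply: (iffLR (submodDl sK _ _) h); apply: submodZ.
- by apply: addSr => //; exists z.
Qed.

End Local.

Section Regularity.
Variables (R : comNzRingType) (m : {pred R}).
Hypotheses (noeth : noetherian_ring R) (loc : local_ring m).
Implicit Types M N A B C : lmodType R.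

Notation mulm := (@mulm R m _).
Notation mpow := (@mpow R m _).

Lemma colon_submod M (U : M -> Prop) z : submod U ->
  submod (fun a : R^o => U ((a : R) *: z)).
Proof.
move=> sU; split; first by rewrite scale0r; apply: submod0.
move=> a x y Ux Uy; change (U (((a : R) * x + y) *: z)).
by rewrite scalerDl -scalerA; apply: sU.2.
Qed.

Lemma maximal_colon M (U : M -> Prop) (P : M -> Prop) z : submod U -> P z ->
  exists y, [/\ P y, forall a, U (a *: z) -> U (a *: y) &
    forall y', P y' -> (forall a, U (a *: y) -> U (a *: y')) ->
      forall a, U (a *: y') -> U (a *: y)].
Proof.
move=> sU Pz.
have [||I [[y [Py zy ->]] Imax]] := @noetherian_maximal_ideal _ noeth
    (fun I => exists y, [/\ P y, forall a, U (a *: z) -> U (a *: y) & I = fun a => U (a *: y)])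
    (fun a => U (a *: z)).
- by move=> I [y [_ _ ->]]; apply: colon_submod.
- by exists z.
exists y; split=> // y' Py' h; apply: (Imax (fun a => U (a *: y'))) => //.
by exists y'; split=> // b /zy/h.
Qed.

(** Take y in H, outside U, with the largest possible colon ideal (U : y): an element a
of m with a y outside U would enlarge it, because a is nilpotent on y modulo U. *)
Lemma socle_exists M (U H : M -> Prop) z : submod U -> submod H ->
  (forall x z, x \in m -> H z -> exists t, U (x ^+ t *: z)) -> H z -> ~ U z ->
  exists y, [/\ H y, ~ U y & forall a, a \in m -> U (a *: y)].
Proof.
move=> sU sH nil Hz nUz.
have [y [[Hy nUy] _ ymax]] := @maximal_colon M U (fun y => H y /\ ~ U y) z sU (conj Hz nUz).
exists y; split=> // a am; have := nil a y am Hy; case => t.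
elim: t => [|t IH]; first by rewrite expr0 scale1r.
have [/IH//|nUt] := pselect (U (a ^+ t *: y)).
rewrite exprS -scalerA; apply: ymax => [|b Ub]; first by split=> //; apply: submodZ.
by rewrite scalerA mulrC -scalerA; apply: submodZ.
Qed.

(** Some power of m maps M into K as soon as each element of m acts nilpotently
on M/K: a maximal U with m^s U in K is all of M, since otherwise M/U has a nonzero
element killed by m. *)
Lemma mpow_sub M (K : M -> Prop) : fin_gen M -> submod K ->
  (forall x z, x \in m -> exists t, K (x ^+ t *: z)) ->
  exists s, forall z, mpow s z -> K z.
Proof.
move=> fgM sK nil.
pose P U := [/\ submod U, forall z, K z -> U z &
  exists s, forall z, iter s mulm U z -> K z].
have [||U [[sU KU [s sP]] Umax]] := @noetherian_maximal _ noeth M P K fgM.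
- by move=> U [].
- by split=> //; exists 0%N.
suff UT z : U z.
  exists s => z; suff -> : mpow s = iter s mulm U by apply: sP.
  elim: (s) => [|k /= ->//]; apply: funext => w /=.
  by apply: propext; split.
apply: contrapT => nUz.
have [|||y [_ nUy my]] := @socle_exists M U (fun=> True) z sU _ _ _ nUz => //.
  by move=> x w /(nil x w)[t /KU]; exists t.
apply: nUy; pose V := addS U (in_span [:: y]).
have sV : submod V by apply: addS_submod => //; apply: in_span_submod.
apply: (Umax V); last by apply: addSr => //; apply/in_span_mem/mem_head.
  split=> // [w /KU Uw|]; first by apply: addSl => //; apply: in_span_submod.
  exists s.+1 => w; rewrite iterSr.
  have h : forall w, mulm V w -> U w.
    apply: mulm_min => // a _ am [u [_ [Uu /in_span_cons[c [v [/in_span_nil-> ->]]] ->]]].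
    rewrite addr0 scalerDr scalerA mulrC -scalerA.
    by apply: submodD => //; apply: submodZ => //; apply: my.
  have hs : forall k w, iter k mulm (mulm V) w -> iter k mulm U w.
    by elim=> [|k IH] //=; apply: mulm_mono.
  by move=> /hs/sP.
by move=> w Uw; apply: addSl => //; apply: in_span_submod.
Qed.

(** Let N be the intersection of the m^n M, and K maximal with K :&: N = mN. Each
element of m acts nilpotently on M/K by [colon_power], so K contains some m^s M, hence
N. Thus N = mN, and N = 0 by Nakayama's lemma. *)
Lemma krull_intersection M (x : M) : fin_gen M -> (forall n, mpow n x) -> x = 0.
Proof.
move=> fgM xN; pose N (z : M) := forall n, mpow n z.
have sN : submod N.
  split=> [n|a y z Ny Nz n]; first exact: submod0 (mpow_submod _ _ _).
  by apply: (mpow_submod _ _ _).2.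
have mN : forall z, mulm N z -> N z by apply: mulm_sub.
pose P K := [/\ submod K, forall z, mulm N z -> K z & forall z, K z -> N z -> mulm N z].
have [||K [[sK NK KN] Kmax]] := @noetherian_maximal _ noeth M P (mulm N) fgM.
- by move=> K [].
- by split=> //; apply: mulm_submod.
have [|s sP] := @mpow_sub M K fgM sK.
  move=> a z am.
  have [||t tP] := @colon_power R m noeth M K N a fgM sK sN am.
  - by move=> w Nw; apply: NK; apply: mulm_mem.
  - move=> V sV KV VN; apply: Kmax => //; split=> //.
      by move=> w /NK /KV.
    by move=> w Vw Nw; apply: KN => //; apply: VN.
  by exists t.
have Nm z : N z -> mulm N z by move=> Nz; apply: KN => //; apply: sP.
have [L [u [uI uE]]] := submodule_exists sN.
have fgL := fin_gen_inj noeth uI fgM.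
have mL : forall z, mulm N z -> exists w, u w = z /\ mulm (fun=> True) w.
  apply: mulm_min.
    split; first by exists 0; split; [exact: raddf0|exact: submod0 (mulm_submod _ _)].
    move=> a _ _ [w [<- mw]] [w' [<- mw']]; exists (a *: w + w').
    by rewrite linearP; split=> //; apply: (mulm_submod _ _).2.
  move=> a w am /uE[l <-]; exists (a *: l); rewrite linearZ; split=> //.
  exact: mulm_mem.
have [l lE] : imS u x by apply/uE.
suff l0 : l = 0 by rewrite -lE l0 raddf0.
apply: (nakayama0 noeth loc fgL) => w.
have /uE/Nm/mL[w' [/uI <-]] : imS u (u w) by exists w.
by [].
Qed.

(** * Regular elements *)

(** [regular x U] says that [x] is a nonzerodivisor on M/U, [socle_free U] that
no nonzero element of M/U is killed by [m]. *)
Definition regular M (x : R) (U : M -> Prop) : Prop := forall z, U (x *: z) -> U z.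
Definition socle_free M (U : M -> Prop) : Prop :=
  forall z, (forall a, a \in m -> U (a *: z)) -> U z.

Lemma regular_socle_free M x (U : M -> Prop) :
  x \in m -> regular x U -> socle_free U.
Proof. by move=> xm rx z h; apply/rx/h. Qed.

Lemma regularX M x (U : M -> Prop) t : regular x U -> regular (x ^+ t) U.
Proof.
move=> rx; elim: t => [|t IH] z; first by rewrite expr0 scale1r.
by rewrite exprS -scalerA => /rx/IH.
Qed.

(** The maximal elements among the associated primes of M/U are finitely many, because
the elements with these annihilators generate a finitely generated submodule. If none
of them is [m], prime avoidance gives a nonzerodivisor in [m]. *)
Definition maximal_annihilator M (U : M -> Prop) z :=
  ~ U z /\ forall z', ~ U z' -> (forall a, U (a *: z) -> U (a *: z')) ->
    forall a, U (a *: z') -> U (a *: z).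

Lemma maximal_annihilator_prime M (U : M -> Prop) z a b : submod U ->
  maximal_annihilator U z -> U ((a * b) *: z) -> U (a *: z) \/ U (b *: z).
Proof.
move=> sU [nUz zmax] Uab; have [|nUa] := pselect (U (a *: z)); first by left.
right; apply: (zmax (a *: z)) => // [c Uc|]; last by rewrite scalerA mulrC.
by rewrite scalerA mulrC -scalerA; apply: submodZ.
Qed.

(** The prime ideal (U : z) contains one of the ideals (U : y) once it contains their
intersection. *)
Lemma annihilator_list M (U : M -> Prop) (zs : seq M) z : submod U ->
  maximal_annihilator U z ->
  (forall a, (forall y, y \in zs -> U (a *: y)) -> U (a *: z)) ->
  exists2 y, y \in zs & forall a, U (a *: y) -> U (a *: z).
Proof.
move=> sU zmax; elim: zs => [|y zs IH] h.
  by case: zmax => nUz _; case: nUz; rewrite -[z]scale1r; apply: h.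
have [yz|] := pselect (forall a, U (a *: y) -> U (a *: z)).
  by exists y => //; apply: mem_head.
move=> /existsNP [b] /not_implyP [Uby nUbz].
have [|w wzs wz] := IH; last by exists w => //; rewrite inE wzs orbT.
move=> a azs; have : U ((b * a) *: z).
  apply: h => w; rewrite inE -scalerA => /orP[/eqP->|/azs]; last exact: submodZ.
  by rewrite scalerA mulrC -scalerA; apply: submodZ.
by case/(maximal_annihilator_prime sU zmax).
Qed.

Lemma prime_avoidance M (U : M -> Prop) (zs : seq M) : submod U -> socle_free U ->
  (forall z, z \in zs -> maximal_annihilator U z) ->
  exists2 x, x \in m & forall z, z \in zs -> ~ U (x *: z).
Proof.
move=> sU socU; elim: zs => [|z zs IH] zsP.
  by exists 0 => //; apply: m0.
have [|x xm xP] := IH; first by move=> y yzs; apply: zsP; rewrite inE yzs orbT.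
have [nUz zmax] := zsP z (mem_head _ _).
have [Uxz|nUxz] := pselect (U (x *: z)); last first.
  by exists x => // y; rewrite inE => /orP[/eqP->//|/xP].
have [b bm nUb] : exists2 b, b \in m & ~ U (b *: z).
  apply: contrapT => h; apply/nUz/socU => a am; apply: contrapT => nUa.
  by apply: h; exists a.
have [a azs nUa] : exists2 a, (forall y, y \in zs -> U (a *: y)) & ~ U (a *: z).
  apply: contrapT => h.
  have [|y yzs yz] := @annihilator_list M U zs z sU (zsP z (mem_head _ _)).
    by move=> a azs; apply: contrapT => nUa; apply: h; exists a.
  have [nUy ymax] : maximal_annihilator U y by apply: zsP; rewrite inE yzs orbT.
  by apply: (xP y yzs); apply: (ymax z).
exists (x + b * a); first by apply: mD => //; apply: mMr.
move=> y; rewrite inE scalerDl => /orP[/eqP->|yzs] Uy.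
  move: Uy; rewrite submodDl // => /(maximal_annihilator_prime sU (zsP z (mem_head _ _))).
  by case.
apply: (xP y yzs); rewrite -(submodDl sU (x := (b * a) *: y)).
  by rewrite addrC.
by rewrite -scalerA; apply: submodZ => //; apply: azs.
Qed.

Lemma regular_exists M (U : M -> Prop) : fin_gen M -> submod U -> socle_free U ->
  exists2 x, x \in m & regular x U.
Proof.
move=> fgM sU socU.
have [||W [[zs [zsP ->]] Wmax]] := @noetherian_maximal _ noeth M
   (fun W => exists zs, (forall z, z \in zs -> maximal_annihilator U z) /\ W = in_span zs)
   (in_span [::]) fgM.
- by move=> W [zs [_ ->]]; apply: in_span_submod.
- by exists [::].
have [x xm xP] := prime_avoidance sU socU zsP.
exists x => // z Uxz; apply: contrapT => nUz.
have [y [nUy zy ymax]] := @maximal_colon M U (fun y => ~ U y) z sU nUz.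
have myz : maximal_annihilator U y by [].
have [|w wzs wy] := @annihilator_list M U zs y sU myz.
  move=> a azs; have : in_span zs y.
    apply: (Wmax (in_span (y :: zs))).
    - by exists (y :: zs); split=> // v; rewrite inE => /orP[/eqP->//|/zsP].
    - by apply: in_span_min => [|v vzs]; [exact: in_span_submod|apply: in_span_mem; rewrite inE vzs orbT].
    - exact/in_span_mem/mem_head.
  apply: (@in_span_min _ _ _ (fun v => U (a *: v))) => //.
  split; first by rewrite scaler0; apply: submod0.
  move=> b u v Uu Uv; rewrite scalerDr scalerA mulrC -scalerA.
  exact: sU.2.
have [_ wmax] := zsP w wzs.
by apply: (xP w wzs); apply: (wmax y) => //; apply: zy.
Qed.

Definition prodS M N (U : M -> Prop) (V : N -> Prop) (z : M * N) : Prop :=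
  U z.1 /\ V z.2.

Lemma prodS_submod M N (U : M -> Prop) (V : N -> Prop) :
  submod U -> submod V -> submod (prodS U V : (M * N)%type -> Prop).
Proof.
move=> sU sV; split; first by split; apply: submod0.
by move=> a x y [Ux Vx] [Uy Vy]; split; [apply: sU.2|apply: sV.2].
Qed.

Lemma fin_gen_prod M N : fin_gen M -> fin_gen N -> fin_gen (M * N)%type.
Proof.
move=> [s sP] [t tP].
exists ([seq (x, 0) | x <- s] ++ [seq (0, y) | y <- t]) => -[x y].
set l := _ ++ _; have sl := in_span_submod l.
rewrite (_ : (x, y) = (x, 0) + (0, y)); last by congr (_, _); rewrite /= (addr0, add0r).
apply: submodD => //.
  apply: (in_span_min (V := fun x => in_span l (x, 0))) (sP x).
    split; first exact: (submod0 sl).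
    move=> a u v lu lv; rewrite (_ : (_, _) = a *: (u, 0) + (v, 0)); first exact: sl.2.
    by congr (_, _); rewrite /= scaler0 addr0.
  by move=> u us; apply: in_span_mem; rewrite mem_cat map_f.
apply: (in_span_min (V := fun y => in_span l (0, y))) (tP y).
  split; first exact: (submod0 sl).
  move=> a u v lu lv; rewrite (_ : (_, _) = a *: (0, u) + (0, v)); first exact: sl.2.
  by congr (_, _); rewrite /= scaler0 addr0.
by move=> u us; apply: in_span_mem; rewrite mem_cat (map_f (fun y => (0, y))) ?orbT.
Qed.

Lemma regular_exists2 M N (U : M -> Prop) (V : N -> Prop) :
  fin_gen M -> fin_gen N -> submod U -> submod V -> socle_free U -> socle_free V ->
  exists x, [/\ x \in m, regular x U & regular x V].
Proof.
move=> fgM fgN sU sV socU socV.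
have [|x xm xP] := regular_exists (fin_gen_prod fgM fgN) (prodS_submod sU sV).
  move=> [z1 z2] h; split; [apply: socU|apply: socV] => a /h[] //.
exists x; split=> // z.
  move=> Uz; have [] // := xP (z, 0); split=> //=; rewrite scaler0; exact: submod0.
move=> Vz; have [] // := xP (0, z); split=> //=; rewrite scaler0; exact: submod0.
Qed.

(** * Depth *)

Definition addx M (U : M -> Prop) (x : R) := addS U (scaleS x).

Lemma addx_submod M (U : M -> Prop) x : submod U -> submod (addx U x).
Proof. by move=> sU; apply: addS_submod => //; apply: scaleS_submod. Qed.

Lemma addxl M (U : M -> Prop) x z : U z -> addx U x z.
Proof. by move=> Uz; apply: addSl => //; apply: scaleS_submod. Qed.

Lemma addxr M (U : M -> Prop) x z : submod U -> addx U x (x *: z).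
Proof. by move=> sU; apply: addSr => //; exists z. Qed.

Lemma addxC M (U : M -> Prop) x y : addx (addx U x) y = addx (addx U y) x.
Proof.
suff h (a b : R) z : addx (addx U a) b z -> addx (addx U b) a z.
  by apply: funext => z; apply: propext; split; apply: h.
move=> [_ [_ [[u [_ [Uu [w ->] ->]]] [w' ->] ->]]].
exists (u + b *: w'), (a *: w); split; last by rewrite addrAC.
  by exists u, (b *: w'); split=> //; exists w'.
by exists w.
Qed.

(** [depth_ge n U] is the statement depth (M/U) >= n, where a zero module has
infinite depth. Working with pairs [U] in M avoids iterated quotients. *)
Fixpoint depth_ge n M (U : M -> Prop) : Prop :=
  if n is k.+1 then exists x, [/\ x \in m, regular x U & depth_ge k (addx U x)]
  else True.

Lemma depth_geW n M (U : M -> Prop) : depth_ge n.+1 U -> depth_ge n U.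
Proof.
elim: n U => [//|n IH] U [x [xm rx Ex]]; exists x; split=> //.
exact: IH.
Qed.

Lemma depth_socle_free n M (U : M -> Prop) : depth_ge n.+1 U -> socle_free U.
Proof. by move=> [x [xm rx _]]; apply: regular_socle_free rx. Qed.

Lemma depth_ge_full n M (U : M -> Prop) : (forall z, U z) -> depth_ge n U.
Proof.
elim: n U => //= n IH U UT; exists 0; split=> //; first exact: m0.
by apply: IH => z; apply: addxl.
Qed.

(** If x and y are regular then the socles of M/xM and M/yM correspond: m z in xM gives
y z = x w, and the class of w modulo yM is killed by m. *)
Lemma socle_exchange M (U : M -> Prop) x y : submod U -> x \in m -> y \in m ->
  regular x U -> regular y U ->
  socle_free (addx U y) -> socle_free (addx U x).
Proof.
move=> sU xm ym rx ry soc z mz.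
have [u [_ [Uu [w ->] yzE]]] := mz y ym.
have [v [_ [Uv [w' ->] wE]]] : addx U y w.
  apply: soc => a am; have [v [_ [Uv [t ->] azE]]] := mz a am.
  exists (a *: w - y *: t), (y *: t); split; [|by exists t|by rewrite subrK].
  apply: rx; rewrite scalerBr !scalerA.
  have -> : (x * a) *: w = y *: (a *: z) - a *: u.
    by rewrite scalerA (mulrC y) -(scalerA a y z) yzE scalerDr addrAC subrr add0r scalerA mulrC.
  rewrite azE scalerDr scalerA (mulrC x y) addrAC addrK.
  by apply: submodB => //; apply: submodZ.
exists (z - x *: w'), (x *: w'); split; [|by exists w'|by rewrite subrK].
apply: ry; rewrite scalerBr yzE wE !scalerDr !scalerA (mulrC y x) addrA addrK.
by apply: submodD => //; apply: submodZ.
Qed.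

(** From y z = x w follows w = y t, as x is regular modulo y; then y cancels. *)
Lemma regular_swap M (U : M -> Prop) x y : submod U ->
  regular x (addx U y) -> regular y U -> regular y (addx U x).
Proof.
move=> sU rx ry z [u [_ [Uu [w ->] yzE]]].
have [v [_ [Uv [t ->] wE]]] : addx U y w.
  apply: rx; exists (- u), (y *: z); split; [exact: submodN|by exists z|].
  by rewrite yzE addKr.
exists (z - x *: t), (x *: t); split; [|by exists t|by rewrite subrK].
apply: ry; rewrite scalerBr yzE wE scalerDr !scalerA (mulrC y x) addrA addrK.
by apply: submodD => //; apply: submodZ.
Qed.

(** For an element z of [m] regular on M, M/xM and M/yM, where y begins a regular
sequence, y can be exchanged for z and z for x. The socles of M/xM and M/yM
correspond, so that such a z exists. *)
Lemma depth_regular n M (U : M -> Prop) x : fin_gen M -> submod U ->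
  depth_ge n.+1 U -> x \in m -> regular x U -> depth_ge n (addx U x).
Proof.
move=> fgM; elim: n U x => // n IH U x sU [y [ym ry Ey]] xm rx.
have sUy := addx_submod y sU; have sUx := addx_submod x sU.
have socy := depth_socle_free Ey.
have socx := socle_exchange sU xm ym rx ry socy.
have soc := regular_socle_free ym ry.
have [z [zm rz [rzx rzy]]] : exists z, [/\ z \in m, regular z U &
    regular z (addx U x) /\ regular z (addx U y)].
  have sP := prodS_submod sUx sUy.
  have [|z [zm rz rzP]] := regular_exists2 fgM (fin_gen_prod fgM fgM) sU sP soc.
    by move=> [z1 z2] h; split; [apply: socx|apply: socy] => a /h[].
  exists z; split=> //; split=> w Uw.
    by have [] // := rzP (w, 0); split=> //=; rewrite scaler0; apply: submod0.
  by have [] // := rzP (0, w); split=> //=; rewrite scaler0; apply: submod0.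
have Ez : depth_ge n.+1 (addx U z).
  exists y; split=> //; first exact: regular_swap.
  by rewrite addxC; apply: IH.
exists z; split=> //; rewrite addxC; apply: IH => //.
  exact: addx_submod.
exact: regular_swap.
Qed.

(** The map [f] identifies M/U with a submodule of N/V, and [g] presents P/W as
its cokernel. *)
Record relative_exact M N (P : lmodType R) (U : M -> Prop) (V : N -> Prop) (W : P -> Prop)
    (f : {linear M -> N}) (g : {linear N -> P}) : Prop := RelativeExact {
  rel_inj : forall x, V (f x) <-> U x;
  rel_cmp : forall x, W (g (f x));
  rel_map : forall y, V y -> W (g y);
  rel_mid : forall y, W (g y) -> exists x, V (y - f x);
  rel_srj : forall z, exists y, W (z - g y)
}.

Lemma relative_exact_addx M N (P : lmodType R) (U : M -> Prop) (V : N -> Prop) (W : P -> Prop)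
    (f : {linear M -> N}) (g : {linear N -> P}) x :
  submod U -> submod V -> submod W -> regular x W ->
  relative_exact U V W f g -> relative_exact (addx U x) (addx V x) (addx W x) f g.
Proof.
move=> sU sV sW rx [inj cmp map mid srj]; split.
- move=> z; split; last first.
    move=> [u [_ [Uu [w ->] ->]]]; rewrite linearD linearZ.
    by exists (f u), (x *: f w); split=> //; [apply/inj|exists (f w)].
  move=> [v [_ [Vv [w ->] fzE]]].
  have /rx/mid [t Vwt] : W (x *: g w).
    rewrite -linearZ; have -> : x *: w = f z - v by rewrite fzE addrC addKr.
    by rewrite linearB; apply: submodB => //; apply: map.
  exists (z - x *: t), (x *: t); split; [|by exists t|by rewrite subrK].
  apply/inj; rewrite linearB fzE linearZ -addrA -scalerBr.
  by apply: submodD => //; apply: submodZ.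
- by move=> z; apply: addxl.
- move=> _ [v [_ [Vv [w ->] ->]]]; rewrite linearD linearZ.
  by apply: submodD; [exact: addx_submod|apply/addxl/map|apply: addxr].
- move=> y [w [_ [Ww [p ->] gyE]]]; have [q Wq] := srj p.
  have /mid[z Vz] : W (g (y - x *: q)).
    by rewrite linearB gyE linearZ -addrA -scalerBr; apply: submodD => //; apply: submodZ.
  exists z, (y - x *: q - f z), (x *: q); split=> //; first by exists q.
  by rewrite addrAC subrK.
- by move=> z; have [y Wy] := srj z; exists y; apply: addxl.
Qed.

(** The depth lemma: depth A >= min (depth B) (depth C + 1) in 0 -> A -> B -> C -> 0.
Dividing by an element regular on B and on C keeps the sequence exact. *)
Lemma depth_lemma n M N (P : lmodType R) (U : M -> Prop) (V : N -> Prop) (W : P -> Prop)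
    (f : {linear M -> N}) (g : {linear N -> P}) :
  fin_gen M -> fin_gen N -> fin_gen P -> submod U -> submod V -> submod W ->
  relative_exact U V W f g -> depth_ge n.+1 V -> depth_ge n W -> depth_ge n.+1 U.
Proof.
move=> fgM fgN fgP; elim: n U V W => [|n IH] U V W sU sV sW ex EV EW.
  have [x [xm rx _]] := EV; exists x; split=> // z.
  by rewrite -2!(rel_inj ex) linearZ; apply: rx.
have [x [xm rxV rxW]] := regular_exists2 fgN fgP sV sW
  (depth_socle_free EV) (depth_socle_free EW).
have rxU : regular x U by move=> z; rewrite -2!(rel_inj ex) linearZ; apply: rxV.
exists x; split=> //; apply: (IH _ (addx V x) (addx W x)); try exact: addx_submod.
- exact: relative_exact_addx.
- exact: depth_regular.
- exact: depth_regular.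
Qed.

Lemma depth_prod n M N (U : M -> Prop) (V : N -> Prop) :
  fin_gen M -> fin_gen N -> submod U -> submod V ->
  depth_ge n U -> depth_ge n V -> depth_ge n (prodS U V : (M * N)%type -> Prop).
Proof.
move=> fgM fgN; elim: n U V => // n IH U V sU sV EU EV.
have [x [xm rxU rxV]] := regular_exists2 fgM fgN sU sV
  (depth_socle_free EU) (depth_socle_free EV).
exists x; split=> //; first by move=> z [/rxU Uz /rxV Vz].
have -> : addx (prodS U V : (M * N)%type -> Prop) x = prodS (addx U x) (addx V x).
  apply: funext => -[z1 z2]; apply: propext; split.
    move=> [[u v] [_ [[Uu Vv] [[w1 w2] ->] [-> ->]]]].
    by split; [exists u, (x *: w1)|exists v, (x *: w2)]; split=> //; [exists w1|exists w2].
  move=> [[u [_ [Uu [w1 ->] /= ->]]] [v [_ [Vv [w2 ->] /= ->]]]].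
  by exists (u, v), (x *: ((w1, w2) : (M * N)%type)); split=> //; exists (w1, w2).
apply: IH; try exact: addx_submod.
  exact: depth_regular.
exact: depth_regular.
Qed.

Lemma depth_ge_surj n M N (p : {linear M -> N}) (V : N -> Prop) : surjective p ->
  submod V -> depth_ge n (fun x => V (p x)) <-> depth_ge n V.
Proof.
move=> pS; elim: n V => //= n IH V sV.
have e x : addx (fun x => V (p x)) x = fun z => addx V x (p z).
  apply: funext => z; apply: propext; split.
    move=> [u [_ [Vu [w ->] ->]]]; rewrite linearD linearZ.
    by exists (p u), (x *: p w); split=> //; exists (p w).
  move=> [v [_ [Vv [w ->] pzE]]]; have [w' w'E] := pS w.
  exists (z - x *: w'), (x *: w'); split; [|by exists w'|by rewrite subrK].
  by rewrite linearB pzE linearZ w'E addrK.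
split=> -[x [xm rx Ex]]; exists x; split=> //.
- by move=> z; have [y <-] := pS z; rewrite -linearZ; apply: rx.
- by apply/IH; [exact: addx_submod|rewrite -e].
- by move=> z; rewrite linearZ; apply: rx.
- by rewrite e; apply/IH => //; apply: addx_submod.
Qed.

End Regularity.

(** * Support and dimension *)
Section Dimension.
Variables (R : comNzRingType) (m : {pred R}).
Hypotheses (noeth : noetherian_ring R) (loc : local_ring m).
Implicit Types M N A B C : lmodType R.

Notation mulm := (@mulm R m _).
Notation mpow := (@mpow R m _).
Notation depth_ge := (depth_ge m).

(** [in_supp U q] says that q lies in the support of M/U. *)
Definition in_supp M (U : M -> Prop) (q : {pred R}) : Prop :=
  prime_ideal q /\ exists z, forall s, s \notin q -> ~ U (s *: z).

Lemma prime_idealP (I : R -> Prop) : submod (I : R^o -> Prop) -> ~ I 1 ->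
  (forall a b, I (a * b) -> I a \/ I b) -> prime_ideal (fun x => `[< I x >]).
Proof.
move=> sI nI1 Ip; split.
  split; first exact/asboolP/(submod0 sI).
    exact/asboolP.
  by move=> a u v /asboolP Iu /asboolP Iv; apply/asboolP/sI.2.
move=> a b /asboolP/Ip[] h; apply/orP; [left|right]; exact/asboolP.
Qed.

Lemma prime_sub_m q : prime_ideal q -> {subset q <= m}.
Proof.
move=> [[q0 q1 qP] _] x; apply: (proper_sub_m noeth loc (I := fun x => x \in q)) => //.
exact/negP.
Qed.

Lemma m_prime : prime_ideal m.
Proof.
have [[mI _] _] := loc; split=> // a b abm.
have [//|am] := boolP (a \in m); rewrite /=.
have [t tE] := unitNm noeth loc am.
by rewrite -[b]mul1r -tE -mulrA; apply: (mMl loc).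
Qed.

(** A colon ideal (U : y) maximal among those contained in q is prime, and it does
not contain a regular element. *)
Lemma supp_below M (U : M -> Prop) x q : submod U -> regular x U ->
  in_supp (addx U x) q ->
  exists p, [/\ in_supp U p, {subset p <= q} & ~ {subset q <= p}].
Proof.
move=> sU rx [[[q0 q1 qI] qP] [z zq]].
have [|y [yq _ ymax]] := @maximal_colon R noeth M U
  (fun y => forall s, s \notin q -> ~ U (s *: y)) z sU.
  by move=> s sq /(addxl x); apply: zq.
have sI := colon_submod y sU.
have yp : prime_ideal (fun a => `[< U (a *: y) >]).
  apply: prime_idealP => //; first by apply: yq.
  move=> a b Uab; have [|nUa] := pselect (U (a *: y)); [by left|right].
  have [h|] := pselect (forall s, s \notin q -> ~ U (s *: (a *: y))).
    apply: (ymax (a *: y)) => // [c Uc|]; last by rewrite scalerA mulrC.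
    by rewrite scalerA mulrC -scalerA; apply: submodZ.
  move=> /existsNP[s /not_implyP [sq /contrapT Us]]; case: nUa.
  apply: (ymax (s *: y)) => [t tq Ut|c Uc|].
  - apply: (yq (t * s)); last by rewrite -scalerA.
    by apply/negP => /qP; rewrite (negPf sq) (negPf tq).
  - by rewrite scalerA mulrC -scalerA; apply: submodZ.
  - by rewrite scalerA mulrC -scalerA.
exists (fun a => `[< U (a *: y) >]); split.
- by split=> //; exists y => s sy Us; case/negP: sy; apply/asboolP.
- move=> a /asboolP Ua; apply: contrapT => /negP aq; exact: yq Ua.
- move=> h; have xq : x \in q.
    by apply: contrapT => /negP xq; apply: (zq x xq); apply: addxr.
  move/h: xq => /asboolP/rx Uy; apply: (yq 1) => //.
  by rewrite scale1r.
Qed.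

Definition cons_chain (q : {pred R}) (p : nat -> {pred R}) i :=
  if i is j.+1 then p j else q.

Lemma prime_chain_cons q p n : prime_ideal q -> {subset q <= p 0%N} ->
  ~ {subset p 0%N <= q} -> prime_chain n p -> prime_chain n.+1 (cons_chain q p).
Proof.
move=> qP qp npq [pP pS]; split; first by case=> [|i] //= /pP.
by case=> [|i] //= /pS.
Qed.

(** The dimension of M/U, by the chains of primes which start in its support. *)
Definition dim_le n M (U : M -> Prop) : Prop :=
  forall k p, in_supp U (p 0%N) -> prime_chain k p -> (k <= n)%N.

Lemma dim_le_addx n M (U : M -> Prop) x : submod U -> regular x U ->
  dim_le n.+1 U -> dim_le n (addx U x).
Proof.
move=> sU rx Un k p /(supp_below sU rx) [q [qU qp pq]] pk.
rewrite -ltnS; apply: (Un _ (cons_chain q p)) => //.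
by apply: prime_chain_cons => //; case: qU.
Qed.

Lemma dim_le_krull d M (U : M -> Prop) : krull_dim R d -> dim_le d U.
Proof. by move=> [_ dmax] k p _ pk; apply: dmax; exists p. Qed.

(** If no power of x kills z modulo U then a colon ideal (U : y) maximal among those
containing no power of x is a prime of the support, strictly below m. *)
Lemma dim0_nilpotent M (U : M -> Prop) x z : submod U -> dim_le 0 U ->
  x \in m -> exists t, U (x ^+ t *: z).
Proof.
move=> sU U0 xm; apply: contrapT => h.
have [|y [yx _ ymax]] := @maximal_colon R noeth M U
  (fun y => forall t, ~ U (x ^+ t *: y)) z sU.
  by move=> t Ut; apply: h; exists t.
pose p : {pred R} := fun a => `[< U (a *: y) >].
have pP : prime_ideal p.
  apply: prime_idealP; [exact: colon_submod|exact: (yx 0%N)|].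
  move=> a b Uab; have [|nUa] := pselect (U (a *: y)); [by left|right].
  have [h'|] := pselect (forall t, ~ U (x ^+ t *: (a *: y))).
    apply: (ymax (a *: y)) => // [c Uc|]; last by rewrite scalerA mulrC.
    by rewrite scalerA mulrC -scalerA; apply: submodZ.
  move=> /existsNP[t /contrapT Ut]; case: nUa.
  apply: (ymax (x ^+ t *: y)) => [s|c Uc|].
  - by rewrite scalerA -exprD; apply: yx.
  - by rewrite scalerA mulrC -scalerA; apply: submodZ.
  - by rewrite scalerA mulrC -scalerA.
suff : (1 <= 0)%N by [].
apply: (U0 _ (cons_chain p (fun=> m))).
  by split=> //; exists y => s sy Us; case/negP: sy; apply/asboolP.
apply: prime_chain_cons => //; first exact: prime_sub_m.
  by move=> /(_ x xm) /asboolP Ux; apply: (yx 1%N); rewrite expr1.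
by split=> // i _; apply: m_prime.
Qed.

(** * Maximal Cohen-Macaulay modules *)

Fixpoint regular_on M (U : M -> Prop) (s : seq R) : Prop :=
  if s is x :: s' then regular x U /\ regular_on (addx U x) s' else True.

Lemma in_ideal_mul_nil M z : @in_ideal_mul R M [::] z <-> z = 0.
Proof.
by split=> [[w ->]|->]; [rewrite big_ord0|exists (fun=> 0); rewrite big_ord0].
Qed.

Lemma in_ideal_mul_cons M x s z :
  @in_ideal_mul R M (x :: s) z <-> addS (scaleS x) (in_ideal_mul s) z.
Proof.
split=> [[w ->]|[_ [_ [[u ->] [w ->] ->]]]].
  rewrite big_ord_recl; exists (x *: w ord0), (\sum_(i < size s) s`_i *: w (lift ord0 i)).
  by split=> //; [exists (w ord0)|exists (fun i => w (lift ord0 i))].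
exists (fun i => oapp w u (unlift ord0 i)).
by rewrite big_ord_recl /= unlift_none; congr (_ + _); apply: eq_bigr => i _; rewrite liftK.
Qed.

Lemma addS_in_ideal_mul_cons M (U : M -> Prop) x s :
  addS U (in_ideal_mul (x :: s)) = addS (addx U x) (in_ideal_mul s).
Proof.
apply: funext => z; apply: propext; split.
  move=> [u [v [Uu /in_ideal_mul_cons[a [b [xa sb ->]]] ->]]].
  by exists (u + a), b; rewrite addrA; split=> //; exists u, a.
move=> [_ [b [[u [a [Uu xa ->]]] sb ->]]]; exists u, (a + b).
by rewrite addrA; split=> //; apply/in_ideal_mul_cons; exists a, b.
Qed.

Lemma addS_in_ideal_mul_nil M (U : M -> Prop) : addS U (in_ideal_mul [::]) = U.
Proof.
apply: funext => z; apply: propext; split.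
  by move=> [u [v [Uu /in_ideal_mul_nil-> ->]]]; rewrite addr0.
by exists z, 0; rewrite addr0; split=> //; apply/in_ideal_mul_nil.
Qed.

Lemma regular_onP M (U : M -> Prop) s :
  regular_on U s <->
  forall i, (i < size s)%N -> regular s`_i (addS U (in_ideal_mul (take i s))).
Proof.
elim: s U => [|x s IH] U //=; split.
  move=> [rx /IH rs] [_|i /rs] /=; first by rewrite addS_in_ideal_mul_nil.
  by rewrite addS_in_ideal_mul_cons.
move=> h; split; first by have := h 0%N isT; rewrite addS_in_ideal_mul_nil.
by apply/IH => i /(h i.+1) /=; rewrite addS_in_ideal_mul_cons.
Qed.

Lemma depth_geP n M (U : M -> Prop) :
  depth_ge n U <-> exists s, [/\ size s = n, {subset s <= m} & regular_on U s].
Proof.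
elim: n U => [|n IH] U; split=> //.
- by move=> _; exists [::].
- move=> [x [xm rx /IH [s [sn sm rs]]]]; exists (x :: s); split=> /=; [by rewrite sn| |by []].
  by move=> y; rewrite inE => /orP[/eqP->|/sm].
- move=> [[|x s] [//= [sn] sm [rx rs]]]; exists x; split=> //.
    by apply: sm; rewrite mem_head.
  by apply/IH; exists s; split=> // y ys; apply: sm; rewrite inE ys orbT.
Qed.

(** The maximal ideal lies in the support of M/(s)M, and the support goes down
strictly with each regular element: depth <= dim. *)
Lemma regular_on_chain M (U : M -> Prop) s q : submod U -> {subset s <= m} ->
  regular_on U s -> in_supp (addS U (in_ideal_mul s)) q ->
  exists p, prime_chain (size s) p /\ in_supp U (p 0%N).
Proof.
elim: s U => [|x s IH] U sU sm.
  rewrite addS_in_ideal_mul_nil => _ qU; exists (fun=> q); split=> //.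
  by split=> // i _; case: qU.
move=> /= [rx rs]; rewrite addS_in_ideal_mul_cons.
move=> /(IH _ (addx_submod x sU) _ rs)[|p [pC /(supp_below sU rx) [q' [qU qp pq]]]].
  by move=> y ys; apply: sm; rewrite inE ys orbT.
exists (cons_chain q' p); split=> //; apply: prime_chain_cons => //.
by case: qU.
Qed.

Lemma zeroS_regular_seq M s : regular_on (@zeroS R M) s <->
  forall i, (i < size s)%N -> forall z : M,
     in_ideal_mul (take i s) (s`_i *: z) -> in_ideal_mul (take i s) z.
Proof.
rewrite regular_onP.
have e i : addS (@zeroS R M) (in_ideal_mul (take i s)) = in_ideal_mul (take i s).
  apply: funext => z; apply: propext; split; last by exists 0, z; rewrite add0r.
  by move=> [_ [v [-> h ->]]]; rewrite add0r.
by split=> h i /h; rewrite /regular e.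
Qed.

Lemma in_ideal_mul_mulm M s (z : M) : {subset s <= m} -> in_ideal_mul s z ->
  mulm (fun=> True) z.
Proof.
move=> sm [w ->]; apply: submod_sum => [|i _]; first exact: mulm_submod.
by apply: mulm_mem => //; apply/sm/mem_nth.
Qed.

Lemma in_ideal_mul_submod M s : submod (@in_ideal_mul R M s).
Proof.
split.
  exists (fun=> 0); rewrite big1 // => i _; exact: scaler0.
move=> a _ _ [v ->] [w ->]; exists (fun i => a *: v i + w i).
rewrite scaler_sumr -big_split /=; apply: eq_bigr => i _.
by rewrite scalerDr !scalerA mulrC.
Qed.

Lemma regular_seq_dim d M s : krull_dim R d -> {subset s <= m} ->
  regular_seq M s -> (size s <= d)%N.
Proof.
move=> [_ dmax] sm [/zeroS_regular_seq rs [z nz]].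
have [|p [pC _]] := regular_on_chain (q := m) (@zeroS_submod _ _) sm rs.
  split; first exact: m_prime.
  exists z => a am [_ [v [-> sv]]]; rewrite add0r => avE.
  apply: nz; have [t tE] := unitNm noeth loc am.
  rewrite -[z]scale1r -tE -scalerA avE; apply: submodZ => //.
  exact: in_ideal_mul_submod.
by apply: dmax; exists p.
Qed.

(** Depth is bounded by dimension ([regular_seq_dim]), so a single inequality
characterises maximal Cohen-Macaulay modules; the zero module satisfies it. *)
Lemma is_mcmP d M : krull_dim R d ->
  is_mcm m M <-> fin_gen M /\ depth_ge d (@zeroS R M).
Proof.
move=> dd; split=> -[fgM].
  move=> [M0|[d' [dd' [[s [sd sm [rs _]]] _]]]]; split=> //.
    exact: depth_ge_full.
  have -> : d = d' by apply/eqP; rewrite eqn_leq (dd'.2 _ dd.1) (dd.2 _ dd'.1).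
  by apply/depth_geP; exists s; split=> //; apply/zeroS_regular_seq.
move=> /depth_geP[s [sd sm rs]]; split=> //.
have [M0|nM0] := pselect (forall x : M, x = 0); [by left|right; exists d; split=> //; split].
  exists s; split=> //; split; first exact/zeroS_regular_seq.
  apply: contrapT => h; apply/nM0/(nakayama0 noeth loc fgM) => z.
  apply: (in_ideal_mul_mulm sm); apply: contrapT => nz.
  by apply: h; exists z.
by move=> k [t [<- tm rt]]; apply: regular_seq_dim dd tm rt.
Qed.

End Dimension.

(** * Polynomials in an endomorphism *)
Section PolyAction.
Variables (R : comNzRingType) (M : lmodType R) (e : {linear M -> M}).
Implicit Types (p q : {poly R}) (x y : M) (n : nat) (c : R).

(** The action on [M] of a polynomial evaluated at the endomorphism [e]. *)
Definition pact (p : {poly R}) (x : M) : M := \sum_(i < size p) p`_i *: iter i e x.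

Lemma pact_widen n p x : (size p <= n)%N -> pact p x = \sum_(i < n) p`_i *: iter i e x.
Proof.
move=> pn; rewrite /pact (big_ord_widen n (fun i => p`_i *: iter i e x)) // big_mkcond /=.
apply: eq_bigr => i _; case: ltnP => // /(nth_default 0) ->.
by rewrite scale0r.
Qed.

Lemma iter_linear i c x y : iter i e (c *: x + y) = c *: iter i e x + iter i e y.
Proof. by elim: i => //= i ->; rewrite linearP. Qed.

Lemma pact_linear p c x y : pact p (c *: x + y) = c *: pact p x + pact p y.
Proof.
rewrite /pact scaler_sumr -big_split /=; apply: eq_bigr => i _.
by rewrite iter_linear scalerDr !scalerA mulrC.
Qed.

Lemma pact0 x : pact 0 x = 0.
Proof. by rewrite /pact size_poly0 big_ord0. Qed.

Lemma pactr0 p : pact p 0 = 0.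
Proof.
have := pact_linear p (-1) 0 0.
by rewrite scaler0 addr0 scaleN1r addNr.
Qed.

Lemma pactD p q x : pact (p + q) x = pact p x + pact q x.
Proof.
pose n := maxn (size p) (size q).
rewrite (@pact_widen n) ?(@pact_widen n p) ?(@pact_widen n q) ?leq_maxl ?leq_maxr //.
  by rewrite -big_split; apply: eq_bigr => i _; rewrite coefD scalerDl.
exact: leq_trans (size_polyD _ _) _.
Qed.

Lemma pactZ c p x : pact (c *: p) x = c *: pact p x.
Proof.
rewrite (@pact_widen (size p)) ?size_scale_leq // /pact scaler_sumr.
by apply: eq_bigr => i _; rewrite coefZ scalerA.
Qed.

Lemma pactN p x : pact (- p) x = - pact p x.
Proof. by rewrite -(scaleN1r p) pactZ scaleN1r. Qed.

Lemma pactB p q x : pact (p - q) x = pact p x - pact q x.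
Proof. by rewrite pactD pactN. Qed.

Lemma pactC c x : pact c%:P x = c *: x.
Proof. by rewrite (@pact_widen 1) ?size_polyC_leq1 // big_ord1 coefC eqxx. Qed.

Lemma pact1 x : pact 1 x = x.
Proof. by rewrite -[1]/(1%:P) pactC scale1r. Qed.

Lemma pactMX p x : pact (p * 'X) x = e (pact p x).
Proof.
rewrite (@pact_widen (size p).+1); last first.
  by have [->|p0] := eqVneq p 0; [rewrite mul0r size_poly0|rewrite size_mulX].
rewrite big_ord_recl coefMX eqxx scale0r add0r /pact linear_sum.
by apply: eq_bigr => i _; rewrite coefMX linearZ.
Qed.

Lemma pactM p q x : pact (p * q) x = pact p (pact q x).
Proof.
elim/poly_ind: p => [|p c IH].
  by rewrite mul0r !pact0.
by rewrite mulrDl mulrAC !pactD !pactMX IH mul_polyC pactZ pactC.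
Qed.

(** Cayley-Hamilton, for the matrix of [e] on generators of [M]. *)
Lemma pact_annihilator : fin_gen M ->
  exists p : {poly R}, p \is monic /\ forall x, pact p x = 0.
Proof.
(* The additional generator 0 makes the matrices of positive size, hence a ring. *)
move=> [s0 gs0]; pose s := 0 :: s0; pose n := size s0.
have gs x : in_span s x.
  by apply: in_span_min (gs0 x) => [|y ys]; [exact: in_span_submod|apply: in_span_mem; rewrite inE ys orbT].
pose lin (v : 'rV[R]_n.+1) : M := \sum_(i < n.+1) v 0 i *: s`_i.
have linD v w : lin (v + w) = lin v + lin w.
  by rewrite -big_split; apply: eq_bigr => i _; rewrite mxE scalerDl.
have linZ c v : lin (c *: v) = c *: lin v.
  by rewrite /lin scaler_sumr; apply: eq_bigr => i _; rewrite mxE scalerA.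
have lin0 : lin 0 = 0 by rewrite /lin big1 // => i _; rewrite mxE scale0r.
have [j|a aP] := @choice 'I_n.+1 ('I_n.+1 -> R)
  (fun j b => e s`_j = \sum_(i < n.+1) b i *: s`_i); first exact: gs.
pose A := \matrix_(j, i) a j i.
have eA v : e (lin v) = lin (v *m A).
  rewrite linear_sum; under eq_bigr => j _.
    rewrite linearZ /= aP scaler_sumr; under eq_bigr => i _ do rewrite scalerA.
    over.
  rewrite exchange_big; apply: eq_bigr => i _; rewrite mxE scaler_suml.
  by apply: eq_bigr => j _; rewrite mxE.
exists (char_poly A); split=> [|x]; first exact: char_poly_monic.
have pA p v : pact p (lin v) = lin (v *m horner_mx A p).
  elim/poly_ind: p => [|p c IH].
    by rewrite rmorph0 mulmx0 pact0 lin0.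
  rewrite pactD pactMX IH eA pactC -linZ -linD rmorphD rmorphM /= horner_mx_X horner_mx_C.
  by rewrite mulmxDr mulmxA mul_mx_scalar.
have [c ->] := gs x.
rewrite [\sum_(_ < _) _](_ : _ = lin (\row_i c i)); last first.
  by apply: eq_bigr => i _; rewrite mxE.
by rewrite pA Cayley_Hamilton mulmx0 lin0.
Qed.

End PolyAction.

Lemma pact_map (R : comNzRingType) (M : lmodType R) (e : {linear M -> M}) q :
  exists g : {linear M -> M}, forall x, g x = pact e q x.
Proof. by apply: linear_pack => c x y; apply: pact_linear. Qed.

(** * Complete local rings *)
Section Completeness.
Variables (R : comNzRingType) (m : {pred R}).
Hypotheses (noeth : noetherian_ring R) (loc : local_ring m).
Hypothesis (compl : adically_complete m).

Notation mulm := (@mulm R m _).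
Notation mpow := (@mpow R m _).
Notation ipow := (in_ideal_power m).

Lemma ipow0 x : ipow 0 x.
Proof.
exists 1%N, (fun=> x), (fun _ _ => 0); split=> [_ []//|].
by rewrite big_ord1 big_ord0 mulr1.
Qed.

Lemma ipow_submod n : submod (ipow n : R^o -> Prop).
Proof.
split.
  by exists 0%N, (fun=> 0), (fun _ _ => 0); split=> [[]//|]; rewrite big_ord0.
move=> b _ _ [k [c [a [am ->]]]] [k' [c' [a' [am' ->]]]].
exists (k + k')%N, (fun i => match split i with inl j => b * c j | inr j => c' j end),
  (fun i => match split i with inl j => a j | inr j => a' j end); split.
  by move=> i j; case: (split i).
rewrite big_split_ord /= /GRing.scale /= mulr_sumr; congr (_ + _).
  apply: eq_bigr => i _; rewrite (unsplitK (inl i)) mulrA //.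
by apply: eq_bigr => i _; rewrite (unsplitK (inr i)).
Qed.

Lemma ipowM n b x : b \in m -> ipow n x -> ipow n.+1 (b * x).
Proof.
move=> bm [k [c [a [am ->]]]].
exists k, c, (fun i j => oapp (a i) b (unlift ord0 j)); split.
  by move=> i j; case: (unlift ord0 j) => [l|] //=.
rewrite mulr_sumr; apply: eq_bigr => i _.
rewrite big_ord_recl unlift_none /= mulrCA; congr (_ * (_ * _)).
by apply: eq_bigr => j _; rewrite liftK.
Qed.

Lemma ipow_mpow (M : lmodType R) n c (z : M) : ipow n c -> mpow n (c *: z).
Proof.
move=> [k [d [a [am ->]]]]; rewrite scaler_suml; apply: submod_sum => [|i _].
  exact: mpow_submod.
rewrite -scalerA; apply: submodZ; first exact: mpow_submod.
move: (a i) (am i) => b {am}; elim: n b {a} => // n IH b bm; rewrite big_ord_recl -scalerA /=.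
by apply: mulm_mem => //; apply: IH.
Qed.

Lemma mpow_coef (M : lmodType R) (s : seq M) n x : (forall x, in_span s x) ->
  mpow n x -> exists c : 'I_(size s) -> R,
    (forall i, ipow n (c i)) /\ x = \sum_(i < size s) c i *: s`_i.
Proof.
move=> gs; elim: n x => [|n IH] x.
  by have [c ->] := gs x => _; exists c; split=> // i; apply: ipow0.
apply: (@mulm_min _ _ _ _ (fun x => exists c : 'I_(size s) -> R,
    (forall i, ipow n.+1 (c i)) /\ x = \sum_(i < size s) c i *: s`_i)).
  split.
    exists (fun=> 0); split=> [i|]; first exact: submod0 (ipow_submod _).
    by rewrite big1 // => i _; rewrite scale0r.
  move=> a _ _ [c [cm ->]] [c' [cm' ->]].
  exists (fun i => a * c i + c' i); split=> [i|]; first exact: (ipow_submod _).2.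
  rewrite scaler_sumr -big_split; apply: eq_bigr => i _.
  by rewrite scalerDl scalerA.
move=> a w am /IH[c [cm ->]]; exists (fun i => a * c i); split=> [i|].
  exact: ipowM.
by rewrite scaler_sumr; apply: eq_bigr => i _; rewrite scalerA.
Qed.

Lemma complete_module (M : lmodType R) (u : nat -> M) : fin_gen M ->
  (forall n, mpow n (u n.+1 - u n)) -> exists l, forall n, mpow n (l - u n).
Proof.
move=> [s gs] cu.
have [c0 c0E] := gs (u 0%N).
have [n|c cP] := @choice nat ('I_(size s) -> R) (fun n c =>
  (forall i, ipow n (c i)) /\ u n.+1 - u n = \sum_(i < size s) c i *: s`_i).
  exact: mpow_coef.
pose v n i := c0 i + \sum_(k < n) c k i.
have uE n : u n = \sum_(i < size s) v n i *: s`_i.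
  elim: n => [|n IH].
    by rewrite c0E; apply: eq_bigr => i _; rewrite /v big_ord0 addr0.
  rewrite -(subrK (u n) (u n.+1)) (cP n).2 IH -big_split; apply: eq_bigr => i _.
  by rewrite /v big_ord_recr /= [in RHS]addrA [RHS]scalerDl addrC.
have [i|l lP] := @choice 'I_(size s) R (fun i l => forall n, ipow n (l - v n i)).
  apply: compl.2 => n; rewrite /v big_ord_recr /= addrA [_ - _]addrC addKr.
  exact: (cP n).1.
exists (\sum_(i < size s) l i *: s`_i) => n.
rewrite uE -sumrB; apply: submod_sum => [|i _]; first exact: mpow_submod.
by rewrite -scalerBl; apply: ipow_mpow.
Qed.

(** * Endomorphism rings of indecomposable modules *)

Section Endomorphism.
Variables (M : lmodType R) (e : {linear M -> M}).
Hypotheses (fgM : fin_gen M).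
Notation pact := (pact e).

(** The polynomials which map M into m^k M. *)
Definition pzero k (p : {poly R}) : Prop := forall x, mpow k (pact p x).

Lemma pzeroM k p q : pzero k p -> pzero k (q * p).
Proof.
move=> hp x; rewrite pactM.
have [g gE] := pact_map e q.
by rewrite -gE; apply: mpow_linear.
Qed.

Lemma pzeroMM k l p q : pzero k p -> pzero l q -> pzero (k + l) (q * p).
Proof.
move=> hp hq x; rewrite pactM.
have [g gE] := pact_map e q.
by rewrite -gE; apply: mpow_compose => // y; rewrite gE.
Qed.

Lemma pzero_le k l p : (k <= l)%N -> pzero l p -> pzero k p.
Proof. by move=> kl hp x; apply: mpow_le kl (hp x). Qed.

(** Fitting's lemma modulo m: from a monic relation for [e] drop the terms whose
coefficient is in m, up to the first unit coefficient. *)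
Lemma fitting_poly : exists a w, pzero 1 ('X^(a.+1) * (1 - 'X * w)).
Proof.
have [p [pmon p0]] := pact_annihilator e fgM.
have ex : exists i, p`_i \notin m.
  exists (size p).-1; rewrite -[p`_ _]/(lead_coef p) (eqP pmon); exact: m1 loc.
pose a := ex_minn ex; have [pa amin] : p`_a \notin m /\ forall i, (i < a)%N -> p`_i \in m.
  rewrite /a; case: ex_minnP => b pb bmin; split=> // i ib.
  by apply: contraLR ib => /bmin; rewrite -leqNgt.
have [t tE] := unitNm noeth loc pa.
pose q := drop_poly a p; pose w := - t *: drop_poly 1 q.
exists a, w.
have qE : q = drop_poly 1 q * 'X + (p`_a)%:P.
  rewrite -[LHS](poly_take_drop 1) addrC; congr (_ + _).
  apply/polyP => i; rewrite coef_take_poly coefC; case: i => [|i] //=.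
  by rewrite coef_drop_poly add0n.
have wE : 1 - 'X * w = t *: q.
  rewrite [in RHS]qE /w -!mul_polyC mulrDr -polyCM tE polyCN.
  by ring.
have low : pzero 1 (take_poly a p).
  move=> x; apply: submod_sum => [|i _]; first exact: mpow_submod.
  apply: mulm_mem => //; rewrite coef_take_poly; case: ltnP => [/amin//|_].
  exact: m0 loc.
have -> : 'X^(a.+1) * (1 - 'X * w) = (t%:P * 'X) * (p - take_poly a p).
  rewrite wE -[X in _ * (X - _)](poly_take_drop a p) addrAC subrr add0r -mul_polyC exprS /q.
  by ring.
apply: pzeroM => x; rewrite pactB p0 sub0r; apply: (submodN (mpow_submod m M 1)).
exact: low.
Qed.

Fixpoint newton (E : {poly R}) n : {poly R} :=
  if n is k.+1 then 3%:R * newton E k ^+ 2 - 2%:R * newton E k ^+ 3 else E.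

(** Newton iteration refines an idempotent modulo m to one modulo m^n for all n. *)
Lemma newton_idem E n : pzero 1 (E ^+ 2 - E) ->
  pzero n.+1 (newton E n ^+ 2 - newton E n).
Proof.
move=> E0; elim: n => //= n; set F := newton E n => IH.
set D := F ^+ 2 - F in IH.
rewrite (_ : _ - _ = (4%:R * D - 3%:R) * (D * D)); last by rewrite /D; ring.
apply: pzeroM; apply: (@pzero_le _ (n.+1 + n.+1)); last exact: pzeroMM.
by rewrite addSn addnS ltnS ltnS leq_addr.
Qed.

Lemma newton_step E n : pzero 1 (E ^+ 2 - E) -> pzero n.+1 (newton E n.+1 - newton E n).
Proof.
move=> E0; rewrite /=; set F := newton E n.
rewrite (_ : _ - _ = (1 - 2%:R * F) * (F ^+ 2 - F)); last by ring.
by apply: pzeroM; apply: newton_idem.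
Qed.

(** On each element of M the Newton iterates of E converge, because M is complete; the
limit is idempotent because M is separated. *)
Lemma lift_idempotent E : pzero 1 (E ^+ 2 - E) ->
  exists f : {linear M -> M}, (forall x, f (f x) = f x) /\
    forall x, mpow 1 (f x - pact E x).
Proof.
move=> E0.
pose rho x y := forall n, mpow n (y - pact (newton E n) x).
have sm n := @mpow_submod _ m M n.
have [|||f fP] := @linear_of_rel _ M M rho.
- move=> x; apply: complete_module => // n; rewrite -pactB.
  by apply: mpow_dec; apply: newton_step.
- move=> c x x' y y' h h' n; rewrite pact_linear opprD addrACA -scalerBr.
  exact: (sm n).2.
- move=> y h; apply: krull_intersection noeth loc _ _ fgM _ => n.
  by have := h n; rewrite pactr0 subr0.
have fr x : rho x (f x) by apply/fP.
exists f; split=> x.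
  apply/eqP; rewrite -subr_eq0; apply/eqP; apply: krull_intersection noeth loc _ _ fgM _ => n.
  have h1 := fr x n; have h2 := fr (f x) n.
  have h3 : mpow n (pact (newton E n) (f x - pact (newton E n) x)).
    have [g gE] := pact_map e (newton E n).
    by rewrite -gE; apply: mpow_linear.
  have h4 : mpow n (pact (newton E n ^+ 2 - newton E n) x).
    by apply: mpow_dec; apply: newton_idem.
  have [g gE] := pact_map e (newton E n).
  rewrite pactB expr2 pactM in h4; rewrite -!gE in h1 h2 h3 h4.
  rewrite linearB in h3.
  have -> : f (f x) - f x = (f (f x) - g (f x)) + (g (f x) - g (g x)) + (g (g x) - g x) - (f x - g x).
    by rewrite !addrA !subrK opprB addrA subrK.
  by apply: submodB => //; apply: submodD => //; apply: submodD.
have -> : f x - pact E x = (f x - pact (newton E 1) x) + pact (newton E 1 - newton E 0) x.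
  by rewrite pactB addrA subrK.
by apply: (submodD (sm 1%N)); [exact: (fr x 1%N)|exact: (newton_step (n := 0) E0)].
Qed.

Lemma surjective_bijective : surjective e -> bijective e.
Proof.
move=> eS.
have sK n : submod (fun x => iter n e x = 0).
  split; first by elim: n => //= n ->; rewrite raddf0.
  by move=> a x y hx hy; rewrite iter_linear hx hy scaler0 addr0.
have [||U [[n UE] Umax]] := @noetherian_maximal _ noeth M
  (fun U => exists n, U = fun x => iter n e x = 0) (fun x => x = 0) fgM.
- by move=> U [n ->].
- by exists 0%N.
have eI : injective e.
  move=> x y exy; have [z zE] : exists z, iter n e z = x - y.
    elim: (n) (x - y) => [|k IH] w; first by exists w.
    by have [w' <-] := eS w; have [z <-] := IH w'; exists z.
  apply/eqP; rewrite -subr_eq0 -zE; apply/eqP.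
  suff : U z by rewrite UE.
  apply: (Umax (fun x => iter n.+1 e x = 0)) => [|w|].
  - by exists n.+1.
  - by rewrite UE /= => ->; rewrite raddf0.
  - by rewrite /= zE linearB exy subrr.
have [g gK] := choice eS.
by exists g => // x; apply: eI.
Qed.

Lemma surjective_mod_m : (forall x, exists y, mpow 1 (x - e y)) -> surjective e.
Proof.
move=> h; apply: (nakayama noeth loc fgM (imS_submod e)) => x.
have [y my] := h x; exists (e y), (x - e y); split; last by rewrite addrC subrK.
  by exists y.
exact: my.
Qed.

End Endomorphism.

Definition idB (M : lmodType R) (e : {linear M -> M}) : {linear M -> M} := idfun \- e.

(** The endomorphism ring of an indecomposable module is local. By [fitting_poly] a
power of e w(e) is idempotent modulo m, with image and kernel the parts of M/mM on
which e is bijective and nilpotent. It lifts to an idempotent of M, which is 0 or 1. If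
it is 0 then e is nilpotent modulo m and 1 - e is surjective; if it is 1 then e is
surjective. Surjective endomorphisms of M are bijective. *)
Theorem indecomposable_local (M : lmodType R) (e : {linear M -> M}) :
  fin_gen M -> indecomposable M -> bijective e \/ bijective (idB e).
Proof.
move=> fgM [_ indec]; have [a [w aw]] := fitting_poly e fgM.
pose u := 'X * w; pose b := a.+1.
have ub k : pzero e 1 ('X^b * (1 - u ^+ k)).
  rewrite -[1 - _]opprB subrX1 -mulNr opprB mulrA mulrC.
  exact: pzeroM.
have E0 : pzero e 1 ((u ^+ b) ^+ 2 - u ^+ b).
  have -> : (u ^+ b) ^+ 2 - u ^+ b = - w ^+ b * ('X^b * (1 - u ^+ b)).
    by rewrite /u exprMn_comm; [ring|exact: mulrC].
  exact: pzeroM.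
have [f [ff fE]] := lift_idempotent fgM E0.
have eX q x : exists y, pact e (q * 'X) x = e y.
  by exists (pact e q x); rewrite pactMX.
have [||||f0|f1] := indec (fun x => `[< f x = x >]) (fun x => `[< f x = 0 >]).
- split; first by apply/asboolP; rewrite raddf0.
  by move=> c x y /asboolP fx /asboolP fy; apply/asboolP; rewrite linearP fx fy.
- split; first by apply/asboolP; rewrite raddf0.
  move=> c x y /asboolP fx /asboolP fy; apply/asboolP.
  by rewrite linearP fx fy scaler0 addr0.
- move=> x; exists (f x), (x - f x); split; last by rewrite addrC subrK.
    exact/asboolP.
  by apply/asboolP; rewrite linearB ff subrr.
- by move=> x /asboolP fx /asboolP; rewrite fx.
- right; apply: surjective_bijective => //; apply: surjective_mod_m => // x.
  have Xb : mpow 1 (pact e 'X^b x).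
    have -> : 'X^b = 'X^b * (1 - u ^+ b) + 'X^b * u ^+ b by rewrite mulrBr mulr1 subrK.
    rewrite pactD; apply: (submodD (mpow_submod m M 1)); first exact: ub.
    apply: pzeroM => y; have := fE y; rewrite (f0 (f y)); last exact/asboolP.
    by rewrite sub0r => /(submodN (mpow_submod m M 1)); rewrite opprK.
  exists (pact e (\sum_(i < b) 'X^i) x); rewrite /idB /=.
  suff -> : x - (pact e (\sum_(i < b) 'X^i) x - e (pact e (\sum_(i < b) 'X^i) x)) =
    pact e 'X^b x by [].
  rewrite -pactMX -pactB -{1}[x](pact1 e) -pactB; congr (pact e _ x).
  by have := subrX1 ('X : {poly R}) b; set S := \sum_(i < b) _ => h; rewrite -[LHS](addrNK 1) -[RHS](addrNK 1) h; ring.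
- left; apply: surjective_bijective => //; apply: surjective_mod_m => // x.
  have fx : f x = x.
    by apply/eqP; rewrite -subr_eq0 -oppr_eq0 opprB; apply/eqP/f1/asboolP; rewrite linearB ff subrr.
  have [y yE] := eX (u ^+ a * w) x.
  exists y; have := fE x; rewrite fx -yE.
  by rewrite (_ : u ^+ b = u ^+ a * w * 'X) // exprSr /u; ring.
Qed.

End Completeness.

(** * Equivalences of categories, and the quotient by the zero subcategory *)
Section Equivalence.
Local Open Scope cat_scope.
Variables (C D : category) (o : C -> D)
  (T : forall X Y : C, hom X Y -> hom (o X) (o Y)).
Hypotheses
  (TP : forall X Y (f g : hom X Y), T f == T g <-> f == g)
  (Tfull : forall X Y (h : hom (o X) (o Y)), exists f : hom X Y, T f == h)
  (Tid : forall X, T (idm X) == idm (o X))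
  (Tcomp : forall X Y Z (g : hom Y Z) (f : hom X Y), T (g * f) == T g * T f)
  (osurj : forall Y : D, exists X, o X = Y).

Lemma comp_heql (E : category) (X Y Z : E) (g g' : hom Y Z) (f : hom X Y) :
  g == g' -> g * f == g' * f.
Proof. by move=> h; apply: comp_heq => //; apply: heq_refl. Qed.

Lemma comp_heqr (E : category) (X Y Z : E) (g : hom Y Z) (f f' : hom X Y) :
  f == f' -> g * f == g * f'.
Proof. by move=> h; apply: comp_heq => //; apply: heq_refl. Qed.

Lemma equiv_zero X : is_zero (o X) <-> is_zero X.
Proof.
split=> [h Y|h Y].
  have [[f fP] [g gP]] := h (o Y).
  have [f' f'P] := Tfull f; have [g' g'P] := Tfull g; split.
    exists f' => k; apply/TP; apply: heq_trans (fP _) _; exact: heq_sym.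
  exists g' => k; apply/TP; apply: heq_trans (gP _) _; exact: heq_sym.
have [Y' <-] := osurj Y; have [[f fP] [g gP]] := h Y'; split.
  exists (T f) => k; have [k' k'P] := Tfull k.
  by apply: heq_trans (heq_sym k'P) _; apply/TP.
exists (T g) => k; have [k' k'P] := Tfull k.
by apply: heq_trans (heq_sym k'P) _; apply/TP.
Qed.

Lemma equiv_zero_mor X Y (f : hom X Y) : zero_mor (T f) <-> zero_mor f.
Proof.
split=> -[Z [u [v [Z0 e]]]].
  have [Z' Z'E] := osurj Z; subst Z; have [u' u'P] := Tfull u; have [v' v'P] := Tfull v.
  exists Z', u', v'; split; first exact/equiv_zero.
  apply/TP; apply: heq_trans e _; apply: heq_trans (heq_sym (Tcomp _ _)).
  by apply: comp_heq; apply: heq_sym.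
exists (o Z), (T u), (T v); split; first exact/equiv_zero.
by apply: heq_trans (Tcomp _ _); apply/TP.
Qed.

Lemma zero_mor_heq (E : category) (X Y : E) (f g : hom X Y) :
  f == g -> zero_mor f -> zero_mor g.
Proof.
move=> fg [Z [u [v [Z0 e]]]]; exists Z, u, v; split=> //.
exact: heq_trans (heq_sym fg) e.
Qed.

Lemma equiv_kernel X Y K (f : hom X Y) (k : hom K X) :
  is_kernel (T f) (T k) <-> is_kernel f k.
Proof.
split=> -[z h]; split.
- by apply/equiv_zero_mor; apply: zero_mor_heq z; apply/heq_sym/Tcomp.
- move=> Z t zt; have [|u [uP uniq]] := h _ (T t).
    by apply: zero_mor_heq (Tcomp _ _) _; apply/equiv_zero_mor.
  have [u' u'P] := Tfull u; exists u'; split.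
    apply/TP; apply: heq_trans (Tcomp _ _) _; apply: heq_trans uP.
    exact: comp_heqr.
  move=> v e; apply/TP; apply: heq_trans _ (heq_sym u'P); apply: uniq.
  by apply: heq_trans (heq_sym (Tcomp _ _)) _; apply/TP.
- by apply: zero_mor_heq (Tcomp _ _) _; apply/equiv_zero_mor.
- move=> Z t zt; have [Z' Z'E] := osurj Z; subst Z; have [t' t'P] := Tfull t.
  have [|u [uP uniq]] := h _ t'.
    apply/equiv_zero_mor; apply: zero_mor_heq zt.
    apply: heq_trans (heq_sym (Tcomp _ _)); by apply: comp_heqr; apply: heq_sym.
  exists (T u); split.
    by apply: heq_trans (heq_sym (Tcomp _ _)) _; apply: heq_trans t'P; apply/TP.
  move=> v e; have [v' v'P] := Tfull v; apply: heq_trans (heq_sym v'P) _.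
  apply/TP/uniq/TP; apply: heq_trans (Tcomp _ _) _.
  apply: heq_trans (comp_heqr _ v'P) _; apply: heq_trans e _; exact: heq_sym.
Qed.

Lemma equiv_cokernel X Y Q (f : hom X Y) (c : hom Y Q) :
  is_cokernel (T f) (T c) <-> is_cokernel f c.
Proof.
split=> -[z h]; split.
- by apply/equiv_zero_mor; apply: zero_mor_heq z; apply/heq_sym/Tcomp.
- move=> Z t zt; have [|u [uP uniq]] := h _ (T t).
    by apply: zero_mor_heq (Tcomp _ _) _; apply/equiv_zero_mor.
  have [u' u'P] := Tfull u; exists u'; split.
    apply/TP; apply: heq_trans (Tcomp _ _) _; apply: heq_trans uP.
    exact: comp_heql.
  move=> v e; apply/TP; apply: heq_trans _ (heq_sym u'P); apply: uniq.
  by apply: heq_trans (heq_sym (Tcomp _ _)) _; apply/TP.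
- by apply: zero_mor_heq (Tcomp _ _) _; apply/equiv_zero_mor.
- move=> Z t zt; have [Z' Z'E] := osurj Z; subst Z; have [t' t'P] := Tfull t.
  have [|u [uP uniq]] := h _ t'.
    apply/equiv_zero_mor; apply: zero_mor_heq zt.
    apply: heq_trans (heq_sym (Tcomp _ _)); by apply: comp_heql; apply: heq_sym.
  exists (T u); split.
    by apply: heq_trans (heq_sym (Tcomp _ _)) _; apply: heq_trans t'P; apply/TP.
  move=> v e; have [v' v'P] := Tfull v; apply: heq_trans (heq_sym v'P) _.
  apply/TP/uniq/TP; apply: heq_trans (Tcomp _ _) _.
  apply: heq_trans (comp_heql _ v'P) _; apply: heq_trans e _; exact: heq_sym.
Qed.

Lemma equiv_mono X Y (f : hom X Y) : is_mono (T f) <-> is_mono f.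
Proof.
split=> h Z u v e.
  apply/TP/h; apply: heq_trans (heq_sym (Tcomp _ _)) _.
  by apply: heq_trans (Tcomp _ _); apply/TP.
have [Z' Z'E] := osurj Z; subst Z; have [u' u'P] := Tfull u; have [v' v'P] := Tfull v.
apply: heq_trans (heq_sym u'P) _; apply: (heq_trans _ v'P); apply/TP/h/TP.
apply: heq_trans (Tcomp _ _) _; apply: heq_trans (heq_sym (Tcomp _ _)).
apply: heq_trans (comp_heqr _ u'P) _; apply: heq_trans e _.
exact: comp_heqr (heq_sym v'P).
Qed.

Lemma equiv_iso X Y (f : hom X Y) : is_iso (T f) <-> is_iso f.
Proof.
split=> -[g [gf fg]].
  have [g' g'P] := Tfull g; exists g'; split; apply/TP.
    apply: heq_trans (Tcomp _ _) _; apply: heq_trans (heq_sym (Tid _)).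
    by apply: heq_trans gf; apply: comp_heql.
  apply: heq_trans (Tcomp _ _) _; apply: heq_trans (heq_sym (Tid _)).
  by apply: heq_trans fg; apply: comp_heqr.
exists (T g); split.
  by apply: heq_trans (Tid _); apply: heq_trans (heq_sym (Tcomp _ _)) _; apply/TP.
by apply: heq_trans (Tid _); apply: heq_trans (heq_sym (Tcomp _ _)) _; apply/TP.
Qed.

Lemma mono_heq (E : category) (X Y : E) (f g : hom X Y) :
  f == g -> is_mono f -> is_mono g.
Proof.
move=> fg mf Z u v e; apply: mf; apply: heq_trans (comp_heql _ fg) _.
by apply: heq_trans e _; (apply: comp_heql; apply: heq_sym).
Qed.

Lemma iso_heq (E : category) (X Y : E) (f g : hom X Y) : f == g -> is_iso f -> is_iso g.
Proof.
move=> fg [h [hf fh]]; exists h; split.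
  by apply: heq_trans hf; (apply: comp_heqr; apply: heq_sym).
by apply: heq_trans fh; (apply: comp_heql; apply: heq_sym).
Qed.

Lemma equiv_simple X : is_simple (o X) <-> is_simple X.
Proof.
split=> -[nz h]; split; try by move=> /equiv_zero.
  by move=> Y u /equiv_mono/h[/equiv_zero|/equiv_iso]; [left|right].
move=> Y u; have [Y' Y'E] := osurj Y; subst Y; have [u' u'P] := Tfull u.
move=> /(mono_heq (heq_sym u'P))/equiv_mono/h[?|]; [by left; apply/equiv_zero|right].
by apply: iso_heq u'P _; apply/equiv_iso.
Qed.

Lemma kernel_heq (E : category) (X Y K : E) (f f' : hom X Y) (k k' : hom K X) :
  f == f' -> k == k' -> is_kernel f k -> is_kernel f' k'.
Proof.
move=> ff' kk' [z h]; split; first by apply: zero_mor_heq z; apply: comp_heq.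
move=> Z t zt; have [|u [uP uniq]] := h Z t.
  by apply: zero_mor_heq zt; (apply: comp_heql; apply: heq_sym).
exists u; split; first by apply: heq_trans uP; (apply: comp_heql; apply: heq_sym).
by move=> v e; apply: uniq; apply: heq_trans e; apply: comp_heql.
Qed.

Lemma cokernel_heq (E : category) (X Y Q : E) (f f' : hom X Y) (c c' : hom Y Q) :
  f == f' -> c == c' -> is_cokernel f c -> is_cokernel f' c'.
Proof.
move=> ff' cc' [z h]; split; first by apply: zero_mor_heq z; apply: comp_heq.
move=> Z t zt; have [|u [uP uniq]] := h Z t.
  by apply: zero_mor_heq zt; (apply: comp_heqr; apply: heq_sym).
exists u; split; first by apply: heq_trans uP; (apply: comp_heqr; apply: heq_sym).
by move=> v e; apply: uniq; apply: heq_trans e; apply: comp_heqr.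
Qed.

Lemma equiv_finite_length X : finite_length (o X) <-> finite_length X.
Proof.
split=> h.
  have [W WE] : exists W, W = o X by exists (o X).
  rewrite -WE in h; elim: h X WE => {W}.
    by move=> W W0 X e; apply: finite_length_zero; apply/equiv_zero; rewrite -e.
  move=> Y W S u p kP cP sS _ IH X e; subst W.
  have [Y' Y'E] := osurj Y; subst Y; have [S' S'E] := osurj S; subst S.
  have [u' u'P] := Tfull u; have [p' p'P] := Tfull p.
  apply: (@finite_length_ext _ Y' X S' u' p').
  - by apply/equiv_kernel; apply: kernel_heq kP; apply: heq_sym.
  - by apply/equiv_cokernel; apply: cokernel_heq cP; apply: heq_sym.
  - exact/equiv_simple.
  - exact: IH.
elim: h => {X} [X X0|Y X S u p kP cP sS _ IH].
  by apply: finite_length_zero; apply/equiv_zero.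
apply: finite_length_ext IH; [exact/equiv_kernel/kP|exact/equiv_cokernel|exact/equiv_simple].
Qed.

End Equivalence.

(** Formally inverting maps that are isomorphisms changes nothing: the
localisation functor A -> A/0 has the inverse [quo_eval]. *)
Section QuotientByZero.
Local Open Scope cat_scope.
Variable A : category.
Hypothesis balanced : forall (X Y : A) (f : hom X Y), quo_equiv (@is_zero A) f -> is_iso f.

Fixpoint quo_eval (X Y : A) (f : quo_hom (@is_zero A) X Y) : hom X Y :=
  match f with
  | quo_id X => idm X
  | quo_comp _ _ _ g f => quo_eval g * quo_eval f
  | quo_mor _ _ f => f
  | quo_inv _ _ _ hs => sval (cid (balanced hs))
  end.

Lemma quo_eval_heq (X Y : A) (f g : quo_hom (@is_zero A) X Y) :
  quo_heq f g -> quo_eval f == quo_eval g.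
Proof.
elim=> {X Y f g} //=.
- by move=> *; apply: heq_refl.
- by move=> *; apply: heq_sym.
- by move=> X Y f g h _ fg _ gh; apply: heq_trans fg gh.
- by move=> *; apply: comp_heq.
- by move=> *; apply: comp_assoc.
- by move=> *; apply: comp_idl.
- by move=> *; apply: comp_idr.
- by move=> *; apply: heq_refl.
- by move=> *; apply: heq_refl.
- by move=> X Y s hs; case: cid => g [].
- by move=> X Y s hs; case: cid => g [].
Qed.

Lemma quo_evalK (X Y : A) (f : quo_hom (@is_zero A) X Y) : quo_heq (quo_mor _ (quo_eval f)) f.
Proof.
elim: f => {X Y} /= [X|X Y Z g gP f fP|X Y f|X Y s hs].
- exact: quo_mor_id.
- by apply: quo_trans (quo_mor_comp _ _ _) _; apply: quo_comp_heq.
- exact: quo_refl.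
- case: cid => g [gs sg] /=.
  apply: quo_trans (quo_sym (quo_idr _)) _.
  apply: quo_trans (quo_comp_heq (quo_refl _) (quo_sym (quo_invr hs))) _.
  apply: quo_trans (quo_assoc _ _ _) _.
  apply: quo_trans (quo_idl _); apply: quo_comp_heq (quo_refl _).
  apply: quo_trans (quo_sym (quo_mor_comp _ _ _)) _.
  by apply: quo_trans (quo_mor_id _ _); apply: quo_mor_heq.
Qed.

Lemma finite_length_mod_zero (X : A) :
  @finite_length (serre_quotient (@is_zero A)) X <-> finite_length X.
Proof.
apply: (@equiv_finite_length A (serre_quotient (@is_zero A)) id (@quo_mor _ _)).
- move=> Y Z f g; split; first by move=> /quo_eval_heq.
  exact: quo_mor_heq.
- by move=> Y Z h; exists (quo_eval h); apply: quo_evalK.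
- by move=> Y; apply: quo_mor_id.
- by move=> Y Z W g f; apply: quo_mor_comp.
- by move=> Y; exists Y.
Qed.

End QuotientByZero.

Lemma KGdim_zero (A : category) :
  KGdim A = Some 0%N <-> forall X : A, KG_filtration 0 X.
Proof.
rewrite /KGdim; case: pselect => [h|nh]; split=> //.
- by case: ex_minnP => n /asboolP nP _ [n0] X; rewrite -n0; apply: nP.
- move=> h0; case: ex_minnP => n _ /(_ 0%N); rewrite leqn0.
  by move=> n0; congr Some; apply/eqP/n0/asboolP.
- by move=> h; case: nh; exists 0%N; apply/asboolP.
Qed.

(** * Kernels, summands, products and fibre products of maximal Cohen-Macaulay modules *)
Section McmClosure.
Variables (R : comNzRingType) (m : {pred R}).
Hypotheses (noeth : noetherian_ring R) (loc : local_ring m).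
Hypothesis hCM : cohen_macaulay m.
Implicit Types M N A B C : lmodType R.

Definition short_exact A B C (f : {linear A -> B}) (g : {linear B -> C}) : Prop :=
  [/\ injective f, surjective g & forall y, g y = 0 <-> imS f y].

Lemma short_exact_relative A B C (f : {linear A -> B}) (g : {linear B -> C}) :
  short_exact f g -> relative_exact (@zeroS R A) (@zeroS R B) (@zeroS R C) f g.
Proof.
move=> [fI gS ex]; split.
- move=> x; split=> [fx0|->]; last exact: raddf0.
  by apply: fI; rewrite fx0 raddf0.
- by move=> x; apply/ex; exists x.
- by move=> y ->; apply: raddf0.
- by move=> y /ex[x <-]; exists x; apply: subrr.
- by move=> z; have [y <-] := gS z; exists y; apply: subrr.
Qed.

Lemma kernel_exists A B (g : {linear A -> B}) : surjective g ->
  exists (K : lmodType R) (f : {linear K -> A}), short_exact f g.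
Proof.
move=> gS; have [K [f [fI fE]]] := submodule_exists (kerS_submod g).
by exists K, f; split.
Qed.

Lemma is_mcm_kernel A B C (f : {linear A -> B}) (g : {linear B -> C}) :
  short_exact f g -> is_mcm m B -> is_mcm m C -> is_mcm m A.
Proof.
have [d [dd _]] := hCM; move=> ex.
rewrite !(is_mcmP noeth loc _ dd) => -[fgB dB] [fgC dC].
have fgA : fin_gen A by have [fI _ _] := ex; exact (fin_gen_inj noeth fI fgB).
split=> //; case: (d) dB dC => // n dB dC.
apply: (depth_lemma noeth loc fgA fgB fgC _ _ _ (short_exact_relative ex)) => //.
- exact: zeroS_submod.
- exact: zeroS_submod.
- exact: zeroS_submod.
- exact: depth_geW.
Qed.

Lemma depth_retract n A B (U : A -> Prop) (V : B -> Prop)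
    (f : {linear A -> B}) (g : {linear B -> A}) :
  (forall x, U x -> V (f x)) -> (forall y, V y -> U (g y)) -> cancel f g ->
  depth_ge m n V -> depth_ge m n U.
Proof.
move=> UV VU fK; elim: n U V UV VU => //= n IH U V UV VU [x [xm rx dV]].
exists x; split=> // [z /UV|].
  by rewrite linearZ => /rx/VU; rewrite fK.
apply: IH dV.
  move=> _ [u [_ [Uu [w ->] ->]]]; rewrite linearD linearZ.
  by exists (f u), (x *: f w); split; [exact: UV|exists (f w)|].
move=> _ [u [_ [Vu [w ->] ->]]]; rewrite linearD linearZ.
by exists (g u), (x *: g w); split; [exact: VU|exists (g w)|].
Qed.

Lemma is_mcm_retract A B (f : {linear A -> B}) (g : {linear B -> A}) :
  cancel f g -> is_mcm m B -> is_mcm m A.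
Proof.
have [d [dd _]] := hCM; move=> fK.
rewrite !(is_mcmP noeth loc _ dd) => -[fgB dB]; split.
  by apply: (fin_gen_surj (f := g)) fgB => x; exists (f x).
by apply: depth_retract dB => [x ->|y ->|//]; apply: raddf0.
Qed.

Lemma is_mcm_prod A B : is_mcm m A -> is_mcm m B -> is_mcm m (A * B)%type.
Proof.
have [d [dd _]] := hCM.
rewrite !(is_mcmP noeth loc _ dd) => -[fgA dA] [fgB dB]; split.
  exact: fin_gen_prod.
have -> : @zeroS R (A * B)%type = prodS (@zeroS R A) (@zeroS R B).
  apply: funext => -[x y]; apply: propext; split; first by case.
  by move=> [/= -> ->].
by apply: depth_prod => //; apply: zeroS_submod.
Qed.

Lemma fin_gen_row n : fin_gen 'rV[R]_n.
Proof.
exists [seq delta_mx 0 i | i : 'I_n] => v; rewrite (row_sum_delta v).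
apply: submod_sum => [|i _]; first exact: in_span_submod.
apply: submodZ; first exact: in_span_submod.
by apply: in_span_mem; apply: image_f.
Qed.

Lemma is_mcm_zero M : (forall x : M, x = 0) -> is_mcm m M.
Proof.
by move=> M0; split; [exists [::] => x; apply/in_span_nil|left].
Qed.

Lemma is_mcm_row n : is_mcm m 'rV[R]_n.
Proof.
elim: n => [|n IH].
  by apply: is_mcm_zero => x; rewrite thinmx0.
have hR : is_mcm m (R^o * 'rV[R]_n)%type.
  by apply: is_mcm_prod => //; apply: regular_module_mcm.
have [|f fE] := @linear_pack R 'rV[R]_n.+1 (R^o * 'rV[R]_n)%type
   (fun v => (v 0 0, \row_j v 0 (lift 0 j))).
  move=> c x y; congr (_, _); first by rewrite !mxE.
  by apply/rowP => j; rewrite !mxE.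
have [|g gE] := @linear_pack R (R^o * 'rV[R]_n)%type 'rV[R]_n.+1
  (fun v => \row_j oapp (v.2 0) v.1 (unlift 0 j)).
  move=> c x y; apply/rowP => j; rewrite !mxE.
  by case: unlift => [k|] //=; rewrite !mxE.
apply: (is_mcm_retract (f := f) (g := g)) hR => v.
rewrite fE gE; apply/rowP => j; rewrite !mxE.
by case: unliftP => [k|] -> /=; rewrite ?mxE.
Qed.

Definition row_mcm n : mcm m := Mcm (is_mcm_row n).
Definition prod_mcm (X Y : mcm m) : mcm m :=
  Mcm (is_mcm_prod (mcm_is_mcm X) (mcm_is_mcm Y)).

Lemma linear_pack_Hom A B (f : A -> B) :
  (forall c x y, f (c *: x + y) = c *: f x + f y) ->
  exists g : HomR A B, forall x, g x = f x.
Proof. exact: linear_pack. Qed.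

Lemma row_map n A (s : 'I_n -> A) :
  exists f : {linear 'rV[R]_n -> A}, forall v, f v = \sum_i v 0 i *: s i.
Proof.
apply: linear_pack => c x y; rewrite scaler_sumr -big_split; apply: eq_bigr => i _.
by rewrite !mxE scalerDl scalerA.
Qed.

Lemma free_cover A : fin_gen A ->
  exists n (p : {linear 'rV[R]_n -> A}), surjective p.
Proof.
move=> [s gs]; have [p pE] := row_map (fun i : 'I_(size s) => s`_i).
exists (size s), p => x; have [c ->] := gs x.
by exists (\row_i c i); rewrite pE; apply: eq_bigr => i _; rewrite mxE.
Qed.

Definition projective A : Prop :=
  forall B C (p : {linear B -> C}) (f : {linear A -> C}), surjective p ->
    exists g : {linear A -> B}, forall x, p (g x) = f x.

Lemma row_projective n : projective 'rV[R]_n.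
Proof.
move=> B C p f pS; have [s sP] := choice pS.
have [g gE] := row_map (fun i => s (f (delta_mx 0 i))).
exists g => v; rewrite gE linear_sum [in RHS](row_sum_delta v) linear_sum.
by apply: eq_bigr => i _; rewrite !linearZ /= sP.
Qed.

Definition is_pullback (X Y Z P : lmodType R) (f : {linear X -> Z}) (g : {linear Y -> Z})
    (p : {linear P -> X}) (q : {linear P -> Y}) : Prop :=
  [/\ forall t, f (p t) = g (q t),
      forall x y, f x = g y -> exists t, p t = x /\ q t = y &
      forall t t', p t = p t' -> q t = q t' -> t = t'].

Lemma fibre_product (X Y Z : lmodType R) (f : {linear X -> Z}) (g : {linear Y -> Z}) :
  exists (P : lmodType R) (p : {linear P -> X}) (q : {linear P -> Y}), is_pullback f g p q.
Proof.
have [|w wE] := @linear_pack R (X * Y)%type Z (fun t => f t.1 - g t.2).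
  by move=> c x y /=; rewrite !linearP /= addrACA scalerDr.
have [P [u [uI uE]]] := submodule_exists (kerS_submod w).
have [|p pE] := @linear_pack R P X (fun t => (u t).1); first by move=> *; rewrite linearP.
have [|q qE] := @linear_pack R P Y (fun t => (u t).2); first by move=> *; rewrite linearP.
exists P, p, q; split=> [t|x y xy|t t'].
- have : kerS w (u t) by apply/uE; exists t.
  by rewrite /kerS wE pE qE => /eqP; rewrite subr_eq0 => /eqP.
- have [|t tE] := iffLR (uE (x, y)); first by rewrite /kerS wE /= xy subrr.
  by exists t; rewrite pE qE tE.
- rewrite !pE !qE => e1 e2; apply: uI.
  by rewrite [LHS]surjective_pairing [RHS]surjective_pairing e1 e2.
Qed.

Lemma pullback_lift (X Y Z P A : lmodType R) (f : {linear X -> Z}) (g : {linear Y -> Z})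
    (p : {linear P -> X}) (q : {linear P -> Y}) (a : {linear A -> X}) (b : {linear A -> Y}) :
  is_pullback f g p q -> (forall x, f (a x) = g (b x)) ->
  exists h : {linear A -> P}, forall x, p (h x) = a x /\ q (h x) = b x.
Proof.
move=> [_ ex uniq] ab.
have [|||h hP] := @linear_of_rel R A P (fun x t => p t = a x /\ q t = b x).
- by move=> x; apply: ex.
- by move=> c x x' t t' [e1 e2] [e1' e2']; rewrite !linearP e1 e2 e1' e2'.
- by move=> t; rewrite !raddf0 => -[e1 e2]; apply: uniq; rewrite raddf0.
by exists h => x; apply/hP.
Qed.

Lemma pullback_surj (X Y Z P : lmodType R) (f : {linear X -> Z}) (g : {linear Y -> Z})
    (p : {linear P -> X}) (q : {linear P -> Y}) :
  is_pullback f g p q -> surjective g -> surjective p.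
Proof.
by move=> [_ ex _] gS x; have [y /esym/ex[t [<- _]]] := gS (f x); exists t.
Qed.

(** The fibre product of X and Y over Z is the kernel of X x Y -> Z. *)
Lemma pullback_exists (X Y Z : mcm m) (f : HomR X Z) (g : HomR Y Z) :
  surjective g -> exists (P : mcm m) (p : HomR P X) (q : HomR P Y), is_pullback f g p q.
Proof.
move=> gS; have [P [p [q pb]]] := fibre_product f g; have [pq ex uniq] := pb.
have [|w wE] := @linear_pack R (X * Y)%type Z (fun t => f t.1 - g t.2).
  by move=> c x y /=; rewrite !linearP /= addrACA scalerDr.
have [|u uE] := @linear_pack R P (X * Y)%type (fun t => (p t, q t)).
  by move=> c x y /=; rewrite !linearP.
have uw : short_exact u w.
  split=> [t t'|z|[x y]].
  - by rewrite !uE => -[]; apply: uniq.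
  - have [y yE] := gS (- z); exists (0, y).
    by rewrite wE /= yE raddf0 sub0r opprK.
  rewrite wE /=; split=> [/eqP|[t]].
    by rewrite subr_eq0 => /eqP/ex[t [<- <-]]; exists t; rewrite uE.
  by rewrite uE => -[<- <-]; rewrite pq subrr.
have Pm : is_mcm m P.
  exact: (is_mcm_kernel uw (mcm_is_mcm (prod_mcm X Y)) (mcm_is_mcm Z)).
by exists (Mcm Pm), p, q.
Qed.

End McmClosure.

(** * Additive groups, as modules over the integers *)

Section AdditiveGroups.

Definition subgroup (V : zmodType) (U : V -> Prop) : Prop :=
  U 0 /\ forall x y, U x -> U y -> U (x - y).

Lemma subgroup_submod (V : zmodType) (U : V -> Prop) :
  subgroup U -> submod (U : (zmodule V) -> Prop).
Proof.
move=> [U0 UB].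
have UN x : U x -> U (- x) by move=> Ux; rewrite -sub0r; apply: UB.
have UD x y : U x -> U y -> U (x + y).
  by move=> Ux Uy; rewrite -[y]opprK; apply: UB => //; apply: UN.
have Un x n : U x -> U (x *+ n).
  by move=> Ux; elim: n => [|n IH]; rewrite ?mulr0n // mulrS; apply: UD.
split=> // -[n|n] x y Ux Uy; apply: UD => //.
  exact: (Un x n).
exact/(UN (x *+ n.+1))/Un.
Qed.

Lemma additive_pack (V W : zmodType) (f : V -> W) :
  (forall x y, f (x - y) = f x - f y) ->
  exists g : {additive V -> W}, forall x, g x = f x.
Proof.
move=> fB.
pose g : {additive V -> W} := HB.pack f (GRing.isZmodMorphism.Build V W f fB).
by exists g.
Qed.

Lemma additive_of_rel (V W : zmodType) (rho : V -> W -> Prop) :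
  (forall x, exists y, rho x y) ->
  (forall x x' y y', rho x y -> rho x' y' -> rho (x - x') (y - y')) ->
  (forall y, rho 0 y -> y = 0) ->
  exists f : {additive V -> W}, forall x y, rho x y <-> y = f x.
Proof.
move=> tot lin inj.
have uniq x y y' : rho x y -> rho x y' -> y = y'.
  move=> h h'; have := lin _ _ _ _ h h'; rewrite subrr => /inj /eqP.
  by rewrite subr_eq0 => /eqP.
have [f fP] := choice tot.
have [|g gE] := @additive_pack V W f.
  by move=> x y; apply: uniq (fP _) _; apply: lin.
exists g => x y; rewrite gE; split=> [/uniq|->]; last exact: fP.
by apply; apply: fP.
Qed.

Lemma subgroup_exists (V : zmodType) (U : V -> Prop) : subgroup U ->
  exists (K : zmodType) (u : {additive K -> V}),
    injective u /\ forall x, U x <-> exists k, u k = x.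
Proof.
move=> /subgroup_submod/submodule_exists[K [u [uI uE]]].
have [|w wE] := @additive_pack K V u; first by move=> x y; apply: raddfB.
exists K, w; split=> [x y|x]; first by rewrite !wE => /uI.
by rewrite uE; split=> -[k kE]; exists k; rewrite -kE wE.
Qed.

Lemma quotient_group_exists (V : zmodType) (U : V -> Prop) : subgroup U ->
  exists (Q : zmodType) (p : {additive V -> Q}),
    surjective p /\ forall x, p x = 0 <-> U x.
Proof.
move=> /subgroup_submod/quotient_exists[Q [p [pS pE]]].
have [|w wE] := @additive_pack V Q p; first by move=> x y; apply: raddfB.
exists Q, w; split=> [y|x]; last by rewrite wE.
by have [x <-] := pS y; exists x.
Qed.

End AdditiveGroups.

(** * Subfunctors and quotient functors *)

Section Functors.
Variables (R : comNzRingType) (m : {pred R}).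
Implicit Types (F G H : add_functor m) (X Y M N : mcm m).

Lemma nat_trans_of_rel F G (rho : forall M, F M -> G M -> Prop) :
  (forall M x, exists y, rho M x y) ->
  (forall M x x' y y', rho M x y -> rho M x' y' -> rho M (x - x') (y - y')) ->
  (forall M y, rho M 0 y -> y = 0) ->
  (forall M N (f : HomR M N) x y, rho N x y -> rho M (fmap F f x) (fmap G f y)) ->
  exists t : nat_trans F G, forall M x y, rho M x y <-> y = t M x.
Proof.
move=> tot lin inj nat.
have ex M := additive_of_rel (tot M) (@lin M) (@inj M).
pose t M := sval (cid (ex M)).
have tP M x y : rho M x y <-> y = t M x by rewrite /t; case: cid.
have tnat M N (f : HomR M N) x : t M (fmap F f x) = fmap G f (t N x).
  by apply/esym/tP/nat/tP.
by exists (NatTrans tnat).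
Qed.

Definition subfunctor F (G : forall M, F M -> Prop) : Prop :=
  (forall M, subgroup (@G M)) /\
  forall M N (f : HomR M N) x, G N x -> G M (fmap F f x).

Lemma subfunctor_exists F (G : forall M, F M -> Prop) : subfunctor G ->
  exists (K : add_functor m) (u : nat_trans K F),
    (forall M, injective (u M)) /\ forall M x, G M x <-> exists k, u M k = x.
Proof.
move=> [Gsub Gnat]; have ex M := subgroup_exists (Gsub M).
pose K M := sval (cid (ex M)).
have exu M : exists u : {additive K M -> F M},
    injective u /\ forall x, G M x <-> exists k, u k = x.
  by rewrite /K; case: cid.
pose u M := sval (cid (exu M)).
have uI M : injective (u M) by rewrite /u; case: cid => ? [].
have uE M x : G M x <-> exists k, u M k = x by rewrite /u; case: cid => ? [].
have exf M N (f : HomR M N) : exists g : {additive K N -> K M},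
    forall k k', u M k' = fmap F f (u N k) <-> k' = g k.
  apply: (@additive_of_rel _ _ (fun k k' => u M k' = fmap F f (u N k))) => [k|k l k' l' e e'|k].
  - by apply/uE/Gnat/uE; exists k.
  - by rewrite !raddfB e e'.
  - by rewrite !raddf0 => e; apply: uI; rewrite e raddf0.
pose fm M N (f : HomR M N) := sval (cid (exf M N f)).
have fmE M N (f : HomR M N) k : u M (fm M N f k) = fmap F f (u N k).
  by rewrite /fm; case: cid => /= g gP; apply/gP.
have fm_id M (x : K M) : fm M M (HomR_id M) x = x.
  by apply: uI; rewrite fmE fmap_id.
have fm_comp M N (P : mcm m) (g : HomR N P) (f : HomR M N) x :
    fm M P (HomR_comp g f) x = fm M N f (fm N P g x).
  by apply: uI; rewrite !fmE fmap_comp.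
have fm_add M N (f g : HomR M N) x : fm M N (f + g) x = fm M N f x + fm M N g x.
  by apply: uI; rewrite raddfD !fmE fmap_add.
pose KF := @AddFunctor R m K fm fm_id fm_comp fm_add.
by exists KF, (@NatTrans R m KF F u fmE); split.
Qed.

Lemma quotient_functor_exists F (G : forall M, F M -> Prop) : subfunctor G ->
  exists (Q : add_functor m) (p : nat_trans F Q),
    (forall M, surjective (p M)) /\ forall M x, p M x = 0 <-> G M x.
Proof.
move=> [Gsub Gnat]; have ex M := quotient_group_exists (Gsub M).
pose Q M := sval (cid (ex M)).
have exp M : exists p : {additive F M -> Q M}, surjective p /\ forall x, p x = 0 <-> G M x.
  by rewrite /Q; case: cid.
pose p M := sval (cid (exp M)).
have pS M : surjective (p M) by rewrite /p; case: cid => ? [].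
have pE M x : p M x = 0 <-> G M x by rewrite /p; case: cid => ? [].
have exf M N (f : HomR M N) : exists g : {additive Q N -> Q M},
    forall q q', (exists x, p N x = q /\ p M (fmap F f x) = q') <-> q' = g q.
  apply: additive_of_rel => [q|q r q' r' [x [xq xq']] [y [yr yr']]|q [x [/pE xG <-]]].
  - by have [x <-] := pS N q; exists (p M (fmap F f x)), x.
  - by exists (x - y); rewrite !raddfB xq xq' yr yr'.
  - exact/pE/Gnat.
pose fm M N (f : HomR M N) := sval (cid (exf M N f)).
have fmE M N (f : HomR M N) x : p M (fmap F f x) = fm M N f (p N x).
  by rewrite /fm; case: cid => /= g gP; apply/gP; exists x.
have fm_id M (x : Q M) : fm M M (HomR_id M) x = x.
  by have [y <-] := pS M x; rewrite -fmE fmap_id.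
have fm_comp M N (P : mcm m) (g : HomR N P) (f : HomR M N) x :
    fm M P (HomR_comp g f) x = fm M N f (fm N P g x).
  by have [y <-] := pS P x; rewrite -!fmE fmap_comp.
have fm_add M N (f g : HomR M N) x : fm M N (f + g) x = fm M N f x + fm M N g x.
  by have [y <-] := pS N x; rewrite -!fmE fmap_add raddfD.
pose QF := @AddFunctor R m Q fm fm_id fm_comp fm_add.
by exists QF, (@NatTrans R m F QF p fmE); split.
Qed.

Lemma nat_trans_factor_mono F G H (u : nat_trans G F) (t : nat_trans H F) :
  (forall M, injective (u M)) -> (forall M x, exists k, u M k = t M x) ->
  exists s : nat_trans H G, forall M x, u M (s M x) = t M x.
Proof.
move=> uI im.
have [||||s sP] := @nat_trans_of_rel H G (fun M x y => u M y = t M x).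
- exact: im.
- by move=> M x x' y y' e e'; rewrite !raddfB e e'.
- by move=> M y e; apply: uI; rewrite e !raddf0.
- by move=> M N f x y e; rewrite !nt_natural e.
by exists s => M x; apply/sP.
Qed.

Lemma nat_trans_factor_epi F G H (p : nat_trans F G) (t : nat_trans F H) :
  (forall M, surjective (p M)) -> (forall M x, p M x = 0 -> t M x = 0) ->
  exists s : nat_trans G H, forall M x, s M (p M x) = t M x.
Proof.
move=> pS ker.
have [||||s sP] := @nat_trans_of_rel G H (fun M x y => exists z, p M z = x /\ t M z = y).
- by move=> M x; have [z <-] := pS M x; exists (t M z), z.
- move=> M x x' y y' [z [<- <-]] [z' [<- <-]]; exists (z - z').
  by rewrite !raddfB.
- by move=> M y [z [/ker zt <-]].
- move=> M N f x y [z [<- <-]]; exists (fmap F f z).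
  by rewrite !nt_natural.
by exists s => M x; apply/esym/sP; exists x.
Qed.

Lemma fmap0 F M N (f : HomR M N) : (forall x, f x = 0) -> forall x, fmap F f x = 0.
Proof.
move=> f0 x; have -> : f = 0 by apply: HomR_ext.
by apply: (addrI (fmap F (0 : HomR M N) x)); rewrite -fmap_add !addr0.
Qed.

Lemma fmapB F M N (f g : HomR M N) x : fmap F (f - g) x = fmap F f x - fmap F g x.
Proof. by apply: (addIr (fmap F g x)); rewrite -fmap_add !subrK. Qed.

Definition generated_by F (G : forall M, F M -> Prop) M0 (g : F M0) : Prop :=
  forall M x, G M x <-> exists h : HomR M M0, x = fmap F h g.

Lemma generated_subfunctor F (G : forall M, F M -> Prop) M0 (g : F M0) :
  generated_by G g -> subfunctor G.
Proof.
move=> gen; split=> [M|M N f x /gen[h ->]]; last first.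
  by apply/gen; exists (HomR_comp h f); rewrite fmap_comp.
split=> [|x y /gen[h ->] /gen[k ->]]; apply/gen.
  by exists 0; rewrite fmap0.
by exists (h - k); rewrite fmapB.
Qed.

(** * Functors presented by an epimorphism of maximal Cohen-Macaulay modules *)

Hypotheses (noeth : noetherian_ring R) (loc : local_ring m).
Hypothesis hCM : cohen_macaulay m.

(** [F] is the cokernel of Hom(-, Y) -> Hom(-, X) for a surjection [pi] from Y to
X, with [x0] the image of the identity of X. These functors are the objects of the
stable category: F(R) = 0 exactly when [pi] is surjective. *)
Definition presented F X Y (pi : HomR Y X) (x0 : F X) : Prop :=
  [/\ surjective pi, forall M (x : F M), exists h : HomR M X, x = fmap F h x0 &
   forall M (h : HomR M X), fmap F h x0 = 0 <-> exists h' : HomR M Y, h = HomR_comp pi h'].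

Definition stable F : Prop :=
  exists (X Y : mcm m) (pi : HomR Y X) (x0 : F X), presented pi x0.

Lemma HomR_compBr M N X (h : HomR N X) (f g : HomR M N) :
  HomR_comp h (f - g) = HomR_comp h f - HomR_comp h g.
Proof. by apply: HomR_ext => x; rewrite /HomR_comp /= raddfB. Qed.

Lemma scalar_map (A : lmodType R) (x : A) :
  exists h : HomR R^o A, forall r : R, h r = r *: x.
Proof. by apply: linear_pack_Hom => c u v; rewrite scalerDl scalerA. Qed.

Lemma yoneda F X (x0 : F X) : exists b : nat_trans (representable X) F,
  forall M (h : HomR M X), b M h = fmap F h x0.
Proof.
have [||||b bP] := @nat_trans_of_rel (representable X) F (fun M h y => y = fmap F (h : HomR M X) x0).
- by move=> M h; exists (fmap F (h : HomR M X) x0).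
- by move=> M h h' y y' -> ->; rewrite fmapB.
- by move=> M y ->; rewrite fmap0.
- by move=> M N f h y ->; rewrite -fmap_comp.
by exists b => M h; apply/esym/bP.
Qed.

Lemma stableP F : stable F <->
  finitely_presented F /\ forall x : F (regular_mcm hCM), x = 0.
Proof.
split.
  move=> [X [Y [pi [x0 [piS gen ker]]]]]; split; last first.
    move=> x; have [h ->] := gen _ x; apply/ker.
    have [y yE] := piS (h (1 : R^o)); have [h' h'E] := scalar_map y.
    exists h'; apply: HomR_ext => r; rewrite /HomR_comp /= h'E linearZ /= yE -linearZ.
    by congr (h _); rewrite /GRing.scale /= mulr1.
  have [a aE] := @yoneda (representable X) Y pi; have [b bE] := yoneda x0.
  exists X, Y, a, b => M; split=> [x|y].
    by have [h ->] := gen _ x; exists h; rewrite bE.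
  rewrite bE ker; split=> [[h' ->]|[z <-]]; first by exists h'; rewrite aE.
  by exists z; rewrite aE.
move=> [[X [Y [a [b ab]]]] F0].
have bE M (h : HomR M X) : b M h = fmap F h (b X (HomR_id X)).
  by rewrite -nt_natural; congr (b M _); apply: HomR_ext.
have aE M (h : HomR M Y) : a M h = HomR_comp (a Y (HomR_id Y)) h.
  rewrite -[RHS](nt_natural a h (HomR_id Y)); congr (a M _); exact: HomR_ext.
have gen M (x : F M) : exists h : HomR M X, x = fmap F h (b X (HomR_id X)).
  by have [h <-] := (ab M).1 x; exists h; rewrite bE.
have ker M (h : HomR M X) : fmap F h (b X (HomR_id X)) = 0 <->
    exists h' : HomR M Y, h = HomR_comp (a Y (HomR_id Y)) h'.
  by rewrite -bE (ab M).2; split=> -[h' h'E]; exists h'; rewrite -?aE // aE.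
exists X, Y, (a Y (HomR_id Y)), (b X (HomR_id X)); split=> // x.
have [h hE] := scalar_map x.
have /ker[h' h'E] := F0 (fmap F (h : HomR (regular_mcm hCM) X) (b X (HomR_id X))).
by exists (h' (1 : R^o)); rewrite -[LHS]/(HomR_comp (a Y (HomR_id Y)) h' (1 : R^o)) -h'E hE scale1r.
Qed.

(** A lift t of g to X exhibits the relations of g: a map h to M0 kills g when t h
factors through Y, that is, when h factors through the fibre product of M0 and Y. *)
Lemma stable_sub F K (u : nat_trans K F) M0 (g : K M0) : stable F ->
  (forall M, injective (u M)) -> (forall M (k : K M), exists h : HomR M M0, k = fmap K h g) ->
  stable K.
Proof.
move=> [X [Y [pi [x0 [piS gen ker]]]]] uI Kgen.
have [t tE] := gen _ (u M0 g).
have [P [p [q pb]]] := pullback_exists noeth loc hCM t piS.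
have pS := pullback_surj pb piS; have [pq _ _] := pb.
exists M0, P, p, g; split=> // M h.
have -> : fmap K h g = 0 <-> fmap F (HomR_comp t h) x0 = 0.
  by rewrite fmap_comp -tE -nt_natural; split=> [->|e]; [rewrite raddf0|apply: uI; rewrite e raddf0].
rewrite ker; split=> [[h' e]|[h' ->]].
  have [|w wE] := pullback_lift (a := h) (b := h') pb.
    by move=> x; have := congr1 (fun k : HomR M X => k x) e.
  by exists w; apply: HomR_ext => x; have [] := wE x.
by exists (HomR_comp q h'); apply: HomR_ext => x; apply: pq.
Qed.

(** The relations Y -> X are enlarged by a lift M0 -> X of g. *)
Lemma stable_quotient F Q (p : nat_trans F Q) M0 (g : F M0) : stable F ->
  (forall M, surjective (p M)) ->
  (forall M x, p M x = 0 <-> exists h : HomR M M0, x = fmap F h g) -> stable Q.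
Proof.
move=> [X [Y [pi [x0 [piS gen ker]]]]] pS pker.
have [t tE] := gen _ g.
have [|w wE] := @linear_pack_Hom R (Y * M0)%type X (fun z => pi z.1 + t z.2).
  by move=> c x y; rewrite !linearP /= scalerDr addrACA.
exists X, (prod_mcm noeth loc hCM Y M0), w, (p X x0); split.
- by move=> x; have [y <-] := piS x; exists (y, 0); rewrite wE /= raddf0 addr0.
- move=> M x; have [y <-] := pS M x; have [h ->] := gen _ y.
  by exists h; rewrite nt_natural.
move=> M h; rewrite -nt_natural pker; split.
  move=> [h' e]; have /ker[k kE] : fmap F (h - HomR_comp t h') x0 = 0.
    by rewrite fmapB fmap_comp -tE e subrr.
  have [|l lE] := @linear_pack_Hom R M (Y * M0)%type (fun x => (k x, h' x)).
    by move=> c x y; rewrite !linearP.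
  exists l; apply: HomR_ext => x; rewrite /HomR_comp /= wE lE /=.
  have := congr1 (fun k : HomR M X => k x) kE; rewrite /= => <-.
  by rewrite subrK.
move=> [l ->].
have [|l1 l1E] := @linear_pack_Hom R M Y (fun x => (l x).1); first by move=> *; rewrite linearP.
have [|l2 l2E] := @linear_pack_Hom R M M0 (fun x => (l x).2); first by move=> *; rewrite linearP.
exists l2; have -> : HomR_comp w l = HomR_comp pi l1 + HomR_comp t l2.
  by apply: HomR_ext => x; rewrite /HomR_comp /= wE l1E l2E.
rewrite fmap_add [fmap F (HomR_comp t l2) x0]fmap_comp -tE.
by have /ker -> : exists h', HomR_comp pi l1 = HomR_comp pi h'; [exists l1|rewrite add0r].
Qed.

(** If phi is induced by t from X to X', then the class of h in F is in the kernel when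
t h factors through Y', that is, when h factors through the fibre product of X and
Y'. *)
Lemma stable_kernel F F' (phi : nat_trans F F') : stable F -> stable F' ->
  exists (P : mcm m) (g : F P), forall M x, phi M x = 0 <-> exists h : HomR M P, x = fmap F h g.
Proof.
move=> [X [Y [pi [x0 [piS gen ker]]]]] [X' [Y' [pi' [x0' [piS' gen' ker']]]]].
have [t tE] := gen' _ (phi X x0).
have [P [p [q pb]]] := pullback_exists noeth loc hCM t piS'; have [pq _ _] := pb.
have kerE M (h : HomR M X) : phi M (fmap F h x0) = 0 <-> exists k, h = HomR_comp p k.
  rewrite nt_natural tE -fmap_comp ker'; split=> [[h' e]|[k ->]].
    have [|w wE] := pullback_lift (a := h) (b := h') pb.
      by move=> x; have := congr1 (fun k : HomR M X' => k x) e.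
    by exists w; apply: HomR_ext => x; have [] := wE x.
  by exists (HomR_comp q k); apply: HomR_ext => x; apply: pq.
exists P, (fmap F p x0) => M x; have [h ->] := gen _ x; rewrite kerE.
split=> [[k ->]|[k e]]; first by exists k; rewrite fmap_comp.
apply/kerE; rewrite e -fmap_comp; apply/kerE; by exists k.
Qed.

Lemma stable_cokernel_exists X Y (pi : HomR Y X) : surjective pi ->
  exists (F : add_functor m) (x0 : F X), presented pi x0.
Proof.
move=> piS.
have [|Q [p [pS pE]]] := @quotient_functor_exists (representable X)
  (fun M h => exists h' : HomR M Y, (h : HomR M X) = HomR_comp pi h').
  split=> [M|M N f _ [h' ->]]; last by exists (HomR_comp h' f); apply: HomR_ext.
  split; first by exists 0; apply: HomR_ext => x; rewrite /HomR_comp /= raddf0.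
  move=> _ _ [h ->] [k ->]; exists (h - k); by rewrite HomR_compBr.
have pF M (h : HomR M X) : p M h = fmap Q h (p X (HomR_id X)).
  by rewrite -nt_natural; congr (p M _); apply: HomR_ext.
exists Q, (p X (HomR_id X)); split=> // M; last by move=> h; rewrite -pF pE.
by move=> x; have [h <-] := pS M x; exists h; apply: pF.
Qed.

Lemma stable_generated F : stable F ->
  exists (X : mcm m) (x0 : F X), forall M (x : F M), exists h : HomR M X, x = fmap F h x0.
Proof. by move=> [X [Y [pi [x0 [_ gen _]]]]]; exists X, x0. Qed.

Lemma zero_nat_trans F G : exists t : nat_trans F G, forall M x, t M x = 0.
Proof.
have [||||t tP] := @nat_trans_of_rel F G (fun M x y => y = 0).
- by move=> M x; exists 0.
- by move=> M x x' y y' -> ->; rewrite subrr.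
- by [].
- by move=> M N f x y ->; rewrite raddf0.
by exists t => M x; apply/esym/tP.
Qed.

End Functors.

(** * The stable category *)

Section StableCategory.
Variables (R : comNzRingType) (m : {pred R}).
Hypotheses (noeth : noetherian_ring R) (loc : local_ring m).
Hypothesis hCM : cohen_macaulay m.
Local Notation A := (stable_mod_category hCM).

Definition functor_of (X : A) : add_functor m := full_val (full_val X).

(** Morphisms of the stable category are natural transformations; going through
these identity functions keeps the subcategories from being unfolded. *)
Definition nt_of (X Y : A) (f : hom X Y) : nat_trans (functor_of X) (functor_of Y) := f.
Definition hom_of (X Y : A) (t : nat_trans (functor_of X) (functor_of Y)) : hom X Y := t.

Lemma nt_of_hom_of (X Y : A) (t : nat_trans (functor_of X) (functor_of Y)) :
  nt_of (hom_of t) = t.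
Proof. by []. Qed.

Lemma heq_nt (X Y : A) (f g : hom X Y) :
  heq f g <-> forall M x, nt_of f M x = nt_of g M x.
Proof. by []. Qed.

Lemma nt_of_comp (X Y Z : A) (g : hom Y Z) (f : hom X Y) M x :
  nt_of (compm g f) M x = nt_of g M (nt_of f M x).
Proof. by []. Qed.

Lemma nt_of_id (X : A) M x : nt_of (idm X) M x = x.
Proof. by []. Qed.

Lemma functor_of_stable (X : A) : stable (functor_of X).
Proof.
by apply/(stableP hCM); split; [exact: full_prop (full_val X)|exact: full_prop X].
Qed.

Lemma stable_objP F : stable F -> exists X : A, functor_of X = F.
Proof.
move=> /(stableP hCM) [h1 h2].
by exists (@FullObj (mod_category m) _ (@FullObj (functor_category m) _ F h1) h2).
Qed.

Opaque functor_of nt_of hom_of.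

Definition pt_zero (F : add_functor m) : Prop := forall M (x : F M), x = 0.

Lemma is_zeroP (X : A) : is_zero X <-> pt_zero (functor_of X).
Proof.
have [z zE] := zero_nat_trans (functor_of X) (functor_of X).
split=> [h M x|h Y].
  have [[f fP] _] := h X.
  have e1 := iffLR (heq_nt _ _) (fP (idm X)) M x.
  have e2 := iffLR (heq_nt _ _) (fP (hom_of z)) M x.
  by rewrite -(nt_of_id x) e1 -e2 nt_of_hom_of zE.
have [u uE] := zero_nat_trans (functor_of Y) (functor_of X).
have [v vE] := zero_nat_trans (functor_of X) (functor_of Y).
split.
  by exists (hom_of u) => g; apply/heq_nt => M x; rewrite nt_of_hom_of uE; apply: h.
by exists (hom_of v) => g; apply/heq_nt => M x; rewrite nt_of_hom_of vE (h M x) raddf0.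
Qed.

Lemma zero_obj_exists : exists Z : A, is_zero Z.
Proof.
pose X := regular_mcm hCM.
have [|F [x0 pr]] := @stable_cokernel_exists R m X X (HomR_id X); first by move=> x; exists x.
have sF : stable F by exists X, X, (HomR_id X), x0.
have [Z ZF] := stable_objP sF; exists Z; apply/is_zeroP; rewrite ZF => M x.
have [_ gen ker] := pr; have [h ->] := gen M x; apply/ker.
by exists h; apply: HomR_ext.
Qed.

Lemma zero_morP (X Y : A) (f : hom X Y) : zero_mor f <-> forall M x, nt_of f M x = 0.
Proof.
split=> [[Z [u [v [/is_zeroP Z0 /heq_nt e]]]] M x|h].
  by rewrite e nt_of_comp (Z0 M (nt_of u M x)) raddf0.
have [Z Z0] := zero_obj_exists.
have [u uE] := zero_nat_trans (functor_of X) (functor_of Z).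
have [v vE] := zero_nat_trans (functor_of Z) (functor_of Y).
exists Z, (hom_of u), (hom_of v); split=> //; apply/heq_nt => M x.
by rewrite h nt_of_comp !nt_of_hom_of vE.
Qed.

(** The pointwise kernel is generated by one element ([stable_kernel]), and finitely
generated subfunctors of stable functors are stable ([stable_sub]). *)
Lemma kernel_obj_exists (X Y : A) (f : hom X Y) : exists (K : A) (k : hom K X),
  (forall M, injective (nt_of k M)) /\
  forall M x, nt_of f M x = 0 <-> exists y, nt_of k M y = x.
Proof.
have [P [g gP]] := stable_kernel noeth loc hCM (nt_of f) (functor_of_stable X) (functor_of_stable Y).
have [K [u [uI uE]]] := subfunctor_exists (generated_subfunctor gP).
have [g' g'E] : exists g', u P g' = g.
  by apply/uE/gP; exists (HomR_id P); rewrite fmap_id.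
have sK : stable K.
  apply: (stable_sub noeth loc hCM (u := u) (g := g') (functor_of_stable X) uI) => M k.
  have /gP[h hE] : nt_of f M (u M k) = 0 by apply/uE; exists k.
  by exists h; apply: uI; rewrite hE nt_natural g'E.
have [Z ZK] := stable_objP sK; case: _ / ZK u uI uE g' g'E sK => u uI uE _ _ _.
by exists Z, (hom_of u); rewrite nt_of_hom_of.
Qed.

Lemma cokernel_obj_exists (X Y : A) (f : hom X Y) : exists (Q : A) (p : hom Y Q),
  (forall M, surjective (nt_of p M)) /\
  forall M y, nt_of p M y = 0 <-> exists x, nt_of f M x = y.
Proof.
have [M0 [g gen]] := stable_generated (functor_of_stable X).
have gP : generated_by (fun M y => exists x, nt_of f M x = y) (nt_of f M0 g).
  move=> M y; split=> [[x <-]|[h ->]].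
    by have [h ->] := gen M x; exists h; rewrite nt_natural.
  by exists (fmap _ h g); rewrite nt_natural.
have [Q [p [pS pE]]] := quotient_functor_exists (generated_subfunctor gP).
have sQ : stable Q.
  apply: (stable_quotient noeth loc hCM (p := p) (g := nt_of f M0 g) (functor_of_stable Y) pS) => M x.
  by rewrite pE; apply: gP.
have [Z ZQ] := stable_objP sQ; case: _ / ZQ p pS pE sQ => p pS pE _.
by exists Z, (hom_of p); rewrite nt_of_hom_of.
Qed.

Lemma kernel_pt (X Y K : A) (f : hom X Y) (k : hom K X) : is_kernel f k ->
  forall M x, nt_of f M x = 0 -> exists y, nt_of k M y = x.
Proof.
move=> [_ kP] M x; have [K' [u [uI uE]]] := kernel_obj_exists f.
move=> /uE[y <-]; have [|v [/heq_nt vE _]] := kP K' u.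
  by apply/zero_morP => N z; rewrite nt_of_comp; apply/uE; exists z.
by exists (nt_of v M y); rewrite -vE nt_of_comp.
Qed.

Lemma cokernel_pt (X Y Q : A) (f : hom X Y) (c : hom Y Q) : is_cokernel f c ->
  forall M y, nt_of c M y = 0 -> exists x, nt_of f M x = y.
Proof.
move=> [_ cP] M y c0; have [Q' [p [pS pE]]] := cokernel_obj_exists f.
apply/pE; have [|v [/heq_nt vE _]] := cP Q' p.
  by apply/zero_morP => N z; rewrite nt_of_comp; apply/pE; exists z.
by rewrite -vE nt_of_comp c0 raddf0.
Qed.

Lemma pt_kernel (X Y K : A) (f : hom X Y) (k : hom K X) :
  (forall M, injective (nt_of k M)) ->
  (forall M x, nt_of f M x = 0 <-> exists y, nt_of k M y = x) -> is_kernel f k.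
Proof.
move=> kI kE; split.
  by apply/zero_morP => M x; rewrite nt_of_comp; apply/kE; exists x.
move=> T t /zero_morP ft.
have [|v vE] := nat_trans_factor_mono (u := nt_of k) (t := nt_of t) kI.
  by move=> M x; apply/kE; rewrite -nt_of_comp.
exists (hom_of v); split=> [|w /heq_nt wE]; apply/heq_nt => M x.
  by rewrite nt_of_comp nt_of_hom_of vE.
by apply: kI; rewrite nt_of_hom_of vE -wE nt_of_comp.
Qed.

Lemma pt_cokernel (X Y Q : A) (f : hom X Y) (c : hom Y Q) :
  (forall M, surjective (nt_of c M)) ->
  (forall M y, nt_of c M y = 0 <-> exists x, nt_of f M x = y) -> is_cokernel f c.
Proof.
move=> cS cE; split.
  by apply/zero_morP => M x; rewrite nt_of_comp; apply/cE; exists x.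
move=> T t /zero_morP ft.
have [|v vE] := nat_trans_factor_epi (p := nt_of c) (t := nt_of t) cS.
  by move=> M y /cE[x <-]; rewrite -nt_of_comp.
exists (hom_of v); split=> [|w /heq_nt wE]; apply/heq_nt => M x.
  by rewrite nt_of_comp nt_of_hom_of vE.
by have [y <-] := cS M x; rewrite nt_of_hom_of vE -wE nt_of_comp.
Qed.

Lemma mono_pt (X Y : A) (f : hom X Y) : is_mono f -> forall M, injective (nt_of f M).
Proof.
move=> fm M x y e; have [K [u [uI uE]]] := kernel_obj_exists f.
have [v vE] := zero_nat_trans (functor_of K) (functor_of X).
have /heq_nt uv : heq u (hom_of v).
  apply: fm; apply/heq_nt => N z; rewrite !nt_of_comp nt_of_hom_of vE raddf0.
  by apply/uE; exists z.
have /uE[z zE] : nt_of f M (x - y) = 0 by rewrite raddfB e subrr.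
by apply/eqP; rewrite -subr_eq0 -zE uv nt_of_hom_of vE.
Qed.

Lemma pt_mono (X Y : A) (f : hom X Y) : (forall M, injective (nt_of f M)) -> is_mono f.
Proof.
move=> fI T u v /heq_nt e; apply/heq_nt => M x; apply: fI.
by rewrite -!nt_of_comp.
Qed.

Lemma iso_pt (X Y : A) (f : hom X Y) : is_iso f -> forall M, bijective (nt_of f M).
Proof.
move=> [g [/heq_nt gf /heq_nt fg]] M; exists (nt_of g M) => x.
  by rewrite -nt_of_comp gf nt_of_id.
by rewrite -nt_of_comp fg nt_of_id.
Qed.

Lemma pt_iso (X Y : A) (f : hom X Y) : (forall M, bijective (nt_of f M)) -> is_iso f.
Proof.
move=> fB; have [|M y|g gE] := nat_trans_factor_mono (u := nt_of f) (t := nt_of (idm Y)).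
- by move=> M; apply: bij_inj.
- by have [g _ gK] := fB M; exists (g (nt_of (idm Y) M y)); apply: gK.
exists (hom_of g); split; apply/heq_nt => M x; rewrite nt_of_comp nt_of_hom_of.
  by apply: (bij_inj (fB M)); rewrite gE !nt_of_id.
exact: gE.
Qed.

(** Kernels and cokernels are pointwise, and a homomorphism of groups with zero kernel
and cokernel is bijective. *)
Lemma stable_balanced (X Y : A) (f : hom X Y) : quo_equiv (@is_zero A) f -> is_iso f.
Proof.
move=> [[K [k [kP /is_zeroP K0]]] [Q [c [cP /is_zeroP Q0]]]].
apply: pt_iso => M; apply: inj_surj_bij.
  apply: inj_of_ker0 => x /(kernel_pt kP)[y <-].
  by rewrite (K0 M y) raddf0.
by move=> y; apply: (cokernel_pt cP); apply: Q0.
Qed.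

Lemma stable_finite_length (X : A) : KG_filtration 0 X <-> finite_length X.
Proof. exact: (finite_length_mod_zero stable_balanced). Qed.

End StableCategory.

(** * Vanishing of Tor *)

Section Vanishing.
Variables (R : comNzRingType) (N : lmodType R).
Implicit Types (A B C G K L : lmodType R).

(** Equivalently, every map from N to L factors through a projective module: the stable
Hom(N, L) vanishes. *)
Definition lifts L : Prop :=
  forall (f : {linear N -> L}) (Q : lmodType R) (p : {linear Q -> L}), surjective p ->
    exists g : {linear N -> Q}, forall x, p (g x) = f x.

(** [tor_vanish i L] is the vanishing of Tor_{i+1}(Tr N, L), where Tr N is the
Auslander transpose: Tor_1(Tr N, L) is the stable Hom(N, L), and higher Tor are
computed by replacing [L] with a syzygy. *)
Fixpoint tor_vanish i L : Prop :=
  if i is j.+1 then exists (K G : lmodType R) (u : {linear K -> G}) (p : {linear G -> L}),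
    [/\ projective G, short_exact u p & tor_vanish j K]
  else lifts L.

Lemma lifts_along A L (Q : lmodType R) (a : {linear A -> L}) (p : {linear Q -> L}) (f : {linear N -> A}) :
  lifts A -> surjective p -> exists g : {linear N -> Q}, forall x, p (g x) = a (f x).
Proof.
move=> lA pS; have [P [q [r pb]]] := fibre_product a p; have [qr _ _] := pb.
have [g gE] := lA f P q (pullback_surj pb pS).
by exists (r \o g) => x /=; rewrite -qr gE.
Qed.

Lemma projective_prod A B : projective A -> projective B -> projective (A * B)%type.
Proof.
move=> pA pB C D p f pS.
have [i iE] := inl_map A B.
have [j jE] := inr_map A B.
have [g gE] := pA _ _ p (f \o i) pS; have [h hE] := pB _ _ p (f \o j) pS.
have [k kE] := copair_map g h.
exists k => -[x y]; rewrite kE linearD gE hE /= iE jE -linearD.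
by congr (f _); congr (_, _); rewrite /= (addr0, add0r).
Qed.

Lemma tor_vanish_projective i G : projective G -> tor_vanish i G.
Proof.
elim: i G => [|i IH] G pG.
  move=> f Q p pS; have [s sE] := pG _ _ p idfun pS.
  by exists (s \o f) => x; apply: sE.
have [|u uE] := @linear_pack R 'rV[R]_0 G (fun=> 0).
  by move=> *; rewrite scaler0 addr0.
exists 'rV[R]_0, G, u, idfun; split=> //; last exact/IH/row_projective.
split=> [x y _|x|x].
- by rewrite (thinmx0 x) (thinmx0 y).
- by exists x.
- by split=> [x0|[y <-]]; [exists 0; rewrite uE; apply: esym x0|rewrite /= uE].
Qed.

Lemma short_exact_factor A B C L (a : {linear A -> B}) (b : {linear B -> C})
    (f : {linear L -> B}) : short_exact a b -> (forall x, b (f x) = 0) ->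
  exists g : {linear L -> A}, forall x, a (g x) = f x.
Proof.
move=> [aI _ ex] bf.
have [|||g gE] := @linear_of_rel R L A (fun x y => a y = f x).
- by move=> x; apply/ex.
- by move=> c x x' y y' e e'; rewrite !linearP e e'.
- by move=> y e; apply: aI; rewrite e !raddf0.
by exists g => x; apply/gE.
Qed.

(** The horseshoe lemma: a projective cover of B is built from covers of A and C, and
its kernel is an extension of theirs. *)
Lemma tor_vanish_ext i A B C (a : {linear A -> B}) (b : {linear B -> C}) :
  short_exact a b -> tor_vanish i A -> tor_vanish i C -> tor_vanish i B.
Proof.
elim: i A B C a b => [|i IH] A B C a b ex.
  move=> lA lC f Q p pS; have [aI bS abE] := ex.
  have [|g1 g1E] := lC (b \o f) Q (b \o p).
    by move=> z; have [y <-] := bS z; have [q <-] := pS y; exists q.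
  have {}g1E x : b (p (g1 x)) = b (f x) := g1E x.
  have [|h hE] := short_exact_factor (f := f \- (p \o g1)) ex.
    by move=> x; rewrite /= linearB; apply/eqP; rewrite subr_eq0 g1E.
  have [g2 g2E] := lifts_along a h lA pS.
  by exists (g1 \+ g2) => x /=; rewrite linearD g2E hE /= addrC subrK.
move=> [K' [G' [u' [p' [pG' ex' vK']]]]] [K'' [G'' [u'' [p'' [pG'' ex'' vK'']]]]].
have [aI bS abE] := ex; have [u'I p'S e'] := ex'; have [u''I p''S e''] := ex''.
have [r rE] := pG'' _ _ b p'' bS.
have [|p pE] := @linear_pack R (G' * G'')%type B (fun t => a (p' t.1) + r t.2).
  by move=> c x y /=; rewrite !linearP /= scalerDr addrACA.
have pS : surjective p.
  move=> y; have [g gE] := p''S (b y).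
  have /abE[x xE] : b (y - r g) = 0 by rewrite linearB rE gE subrr.
  have [g' g'E] := p'S x; exists (g', g).
  by rewrite pE /= g'E xE subrK.
have [K [u exK]] := kernel_exists pS; have [uI _ uE] := exK.
have uK k : p (u k) = 0 by apply/uE; exists k.
have [|i' i'E] := @linear_pack R K' (G' * G'')%type (fun k => (u' k, 0)).
  by move=> c x y; congr (_, _); rewrite /= ?linearP // scaler0 addr0.
have [|al alE] := short_exact_factor (f := i') exK.
  by move=> k; rewrite i'E pE /= (iffRL (e' _)) ?raddf0 ?addr0 //; exists k.
have [|sn snE] := @linear_pack R K G'' (fun k => (u k).2); first by move=> *; rewrite linearP.
have [|be beE] := short_exact_factor (f := sn) ex''.
  move=> k; rewrite snE -rE; have := congr1 b (uK k).
  rewrite pE linearD raddf0 => <-; rewrite [X in X + _](_ : _ = 0) ?add0r //.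
  by apply/abE; exists (p' (u k).1).
exists K, (G' * G'')%type, u, p; split=> //; first exact: projective_prod.
apply: (IH K' K K'' al be) vK' vK''; split.
- move=> x y e; apply: u'I; have := congr1 u e.
  by rewrite !alE !i'E => -[].
- move=> k''; have /abE[y yE] : b (r (u'' k'')) = 0 by rewrite rE; apply/e''; exists k''.
  have [g' g'E] := p'S y.
  have /uE[k kE] : p (- g', u'' k'') = 0 by rewrite pE /= !linearN g'E yE addNr.
  by exists k; apply: u''I; rewrite beE snE kE.
- move=> k; split=> [k0|[k' <-]].
    have s0 : (u k).2 = 0 by rewrite -snE -beE k0 raddf0.
    have /e'[k' k'E] : p' (u k).1 = 0.
      by apply: aI; have := uK k; rewrite pE s0 raddf0 addr0 raddf0.
    exists k'; apply: uI; rewrite alE i'E k'E -s0.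
    by rewrite -surjective_pairing.
  by apply: u''I; rewrite beE snE alE i'E raddf0.
Qed.

Lemma short_exact_prod A B (a : {linear A -> (A * B)%type}) :
  (forall x, a x = (x, 0)) -> short_exact a (snd : {linear (A * B)%type -> B}).
Proof.
move=> aE; split=> [x y|y|[x y]]; first by rewrite !aE => -[].
  by exists (0, y).
split=> [/= ->|[t]]; first by exists x; rewrite aE.
by rewrite aE => -[].
Qed.

(** Schanuel's lemma: the kernel K' of any projective cover of a retract of L is a
retract of K + G', for K the kernel of a given projective cover of L. *)
Lemma tor_vanish_schanuel i L L' K' G' (f : {linear L' -> L}) (g : {linear L -> L'})
    (u' : {linear K' -> G'}) (p' : {linear G' -> L'}) :
  (forall A B (a : {linear A -> B}) (b : {linear B -> A}), cancel a b ->
     tor_vanish i B -> tor_vanish i A) ->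
  cancel f g -> projective G' -> short_exact u' p' -> tor_vanish i.+1 L -> tor_vanish i K'.
Proof.
move=> retr fK pG' ex' [K [G [u [p [pG ex vK]]]]].
have [uI pS e] := ex; have [u'I p'S e'] := ex'.
have [phi phiE] := pG' _ _ p (f \o p') pS.
have [psi psiE] := pG _ _ p' (g \o p) p'S.
have {}phiE x : p (phi x) = f (p' x) := phiE x.
have {}psiE x : p' (psi x) = g (p x) := psiE x.
have [|phiK phiKE] := short_exact_factor (f := phi \o u') ex.
  by move=> x; rewrite /= phiE /= (iffRL (e' _)) ?raddf0 //; exists x.
have [|psiK psiKE] := short_exact_factor (f := psi \o u) ex'.
  by move=> x; rewrite /= psiE /= (iffRL (e _)) ?raddf0 //; exists x.
have [|h hE] := short_exact_factor (f := (psi \o phi) \- idfun) ex'.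
  by move=> x; rewrite /= linearB psiE /= phiE /= fK subrr.
have [|a aE] := @linear_pack R K' (K * G')%type (fun k => (phiK k, u' k)).
  by move=> c x y; rewrite !linearP.
have [|b bE] := @linear_pack R (K * G')%type K' (fun t => psiK t.1 - h t.2).
  by move=> c x y /=; rewrite !linearP /= addrACA scalerDr.
apply: (retr _ _ a b).
  move=> x; rewrite aE bE /=; apply: u'I.
  by rewrite linearB psiKE /= phiKE hE /= opprB addrC subrK.
have [a' a'E] := inl_map K G'.
exact: (tor_vanish_ext (short_exact_prod a'E) vK (tor_vanish_projective i pG')).
Qed.

Lemma tor_vanish_retract i L L' (f : {linear L' -> L}) (g : {linear L -> L'}) :
  cancel f g -> tor_vanish i L -> tor_vanish i L'.
Proof.
elim: i L L' f g => [|i IH] L L' f g fK.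
  move=> lL h Q p pS; have [k kE] := lifts_along g (f \o h) lL pS.
  by exists k => x; rewrite kE /= fK.
move=> vL; have [K [G [u [p [pG ex vK]]]]] := vL; have [_ pS _] := ex.
have [|K' [u' ex']] := @kernel_exists R G L' (g \o p).
  by move=> y; have [x xE] := pS (f y); exists x; rewrite /= xE fK.
exists K', G, u', (g \o p); split=> //.
by apply: (tor_vanish_schanuel _ fK pG ex' vL) => A B a b; apply: IH.
Qed.

Lemma tor_vanish_syzygy i L K G (u : {linear K -> G}) (p : {linear G -> L}) :
  projective G -> short_exact u p -> tor_vanish i.+1 L -> tor_vanish i K.
Proof.
move=> pG ex; apply: (tor_vanish_schanuel (f := idfun) (g := idfun)) pG ex => //.
by move=> A B a b; apply: tor_vanish_retract.
Qed.

(** As Tor_{i+1}(Tr N, G) = 0, the map from Tor_{i+2}(Tr N, K) to Tor_{i+2}(Tr N, U) is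
onto. *)
Lemma tor_vanish_quotient i G K (U : lmodType R) (a : {linear G -> K}) (b : {linear K -> U}) :
  projective G -> short_exact a b -> tor_vanish i.+1 K -> tor_vanish i.+1 U.
Proof.
move=> pG [aI bS ab] [L [Q [u [p [pQ [uI pS up] vL]]]]].
have bpS : surjective (b \o p).
  by move=> y; have [x <-] := bS y; have [q <-] := pS x; exists q.
have [V [v exV]] := kernel_exists bpS; have [vI _ bpv] := exV.
exists V, Q, v, (b \o p); split=> //.
have [|al alE] := short_exact_factor (f := u) exV.
  by move=> x; rewrite /= (iffRL (up _)) ?raddf0 //; exists x.
have exab : short_exact a b by [].
have [|be beE] := short_exact_factor (f := p \o v) exab.
  by move=> x; apply/bpv; exists x.
apply: (@tor_vanish_ext i L V G al be) vL (tor_vanish_projective i pG); split.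
- by move=> x y e; apply: uI; rewrite -!alE e.
- move=> g; have [q qE] := pS (a g).
  have /bpv[w wE] : (b \o p) q = 0 by rewrite /= qE; apply/ab; exists g.
  by exists w; apply: aI; rewrite beE /= wE.
- move=> w; split=> [w0|[x <-]].
    have /up[x xE] : p (v w) = 0 by rewrite -[LHS]/((p \o v) w) -beE w0 raddf0.
    by exists x; apply: vI; rewrite alE.
  by apply: aI; rewrite raddf0 beE /= alE; apply/up; exists x.
Qed.

(** Equivalently, multiplication by [x] on [N] factors through a projective module. *)
Definition stably_zero (x : R) : Prop :=
  forall (L Q : lmodType R) (f : {linear N -> L}) (p : {linear Q -> L}), surjective p ->
    exists g : {linear N -> Q}, forall y, p (g y) = x *: f y.

(** As [x] kills Tor(Tr N, -), the sequence of Tor for 0 -> L -> L -> L/xL -> 0 makes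
Tor_{i+2}(Tr N, L/xL) -> Tor_{i+1}(Tr N, L) surjective. *)
Lemma tor_vanish_regular i L L1 (c : {linear L -> L1}) x : noetherian_ring R ->
  fin_gen L -> stably_zero x -> (forall r : R, x * r = 0 -> r = 0) ->
  (forall y : L, x *: y = 0 -> y = 0) -> surjective c ->
  (forall y, c y = 0 <-> exists w, y = x *: w) ->
  tor_vanish i.+1 L1 -> tor_vanish i L.
Proof.
move=> noeth fgL xN xR; elim: i L L1 c fgL => [|i IH] L L1 c fgL xL cS cE vL1;
  have [n [p pS]] := free_cover fgL; have [K [k exK]] : exists (K : lmodType R) (k : {linear K -> 'rV[R]_n}),
    short_exact k (c \o p) by apply: kernel_exists => y; have [z <-] := cS y;
      have [t <-] := pS z; exists t.
  have vK := tor_vanish_syzygy (@row_projective R n) exK vL1; have [kI _ kE] := exK.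
  have [|||s sE] := @linear_of_rel R K L (fun t y => p (k t) = x *: y).
  - by move=> t; apply/cE; apply/kE; exists t.
  - by move=> d t t' y y' e e'; rewrite !linearP e e'.
  - by move=> y; rewrite !raddf0 => /esym/xL.
  move=> f Q q qS; have [g gE] := xN _ _ f p pS.
  have [|g' g'E] := short_exact_factor (f := g) exK.
    by move=> y; rewrite /= gE; apply/cE; exists (f y).
  have [h hE] := lifts_along s g' vK qS.
  by exists h => y; rewrite hE; apply/esym/sE; rewrite g'E gE.
have vK := tor_vanish_syzygy (@row_projective R n) exK vL1; have [kI _ kE] := exK.
have [V [v exV]] := kernel_exists pS; have [vI _ vE] := exV.
exists V, 'rV[R]_n, v, p; split=> //; first exact: row_projective.
have fgV : fin_gen V by exact (fin_gen_inj noeth vI (fin_gen_row R n)).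
have [V1 [c' [c'S c'E]]] := quotient_exists (@scaleS_submod R V x).
have xrow (z : 'rV[R]_n) : x *: z = 0 -> z = 0.
  by move=> xz; apply/rowP => j; rewrite [RHS]mxE; apply: xR; have := congr1 (fun t : 'rV_n => t 0 j) xz; rewrite !mxE.
apply: (IH V V1 c') => //.
  by move=> y xy; apply: vI; rewrite raddf0; apply: xrow; rewrite -linearZ xy raddf0.
have [|a aE] := short_exact_factor (f := x \*: idfun) exK.
  by move=> z; rewrite /= linearZ; apply/cE; exists (p z).
have [|||b bE] := @linear_of_rel R K V1 (fun t w => exists g' v', k t = x *: g' + v v' /\ c' v' = w).
- move=> t; have /cE[y yE] : c (p (k t)) = 0 by apply/kE; exists t.
  have [g' g'E] := pS y.
  have /vE[v' v'E] : p (k t - x *: g') = 0 by rewrite linearB linearZ g'E yE subrr.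
  by exists (c' v'), g', v'; rewrite v'E addrC subrK.
- move=> d t t' w w' [g1 [v1 [e1 <-]]] [g2 [v2 [e2 <-]]].
  exists (d *: g1 + g2), (d *: v1 + v2); split; last by rewrite linearP.
  by rewrite !linearP e1 e2 !scalerDr !scalerA mulrC addrACA.
- move=> w [g' [v' [e <-]]]; apply/c'E.
  have pv : p (v v') = 0 by apply/vE; exists v'.
  have /vE[w' w'E] : p g' = 0.
    apply: xL; have : p (x *: g' + v v') = 0 by rewrite -e !raddf0.
    by rewrite linearD pv addr0 linearZ.
  exists (- w'); apply: vI; rewrite linearZ /= linearN w'E scalerN.
  by apply/eqP; rewrite -addr_eq0 addrC -e raddf0.
apply: (tor_vanish_quotient (@row_projective R n) (a := a) (b := b)) vK; split.
- move=> z z' e; apply/eqP; rewrite -subr_eq0; apply/eqP/xrow.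
  by rewrite scalerBr; apply/eqP; rewrite subr_eq0; have := congr1 k e; rewrite !aE /= => ->.
- move=> w; have [v' <-] := c'S w.
  have /kE[t tE] : (c \o p) (v v') = 0.
    by rewrite /= (iffRL (vE _)) ?raddf0 //; exists v'.
  by exists t; apply/esym/bE; exists 0, v'; rewrite scaler0 add0r.
- move=> t; split=> [bt|[z <-]].
    have [g' [v' [tE /c'E]]] := iffRL (bE t 0) (esym bt).
    move=> [w wE]; exists (g' + v w); apply: kI.
    by rewrite aE /= tE wE linearZ scalerDr.
  by apply/esym/bE; exists z, 0; rewrite !raddf0 aE addr0.
Qed.

End Vanishing.

(** * Syzygies of the residue field *)
Section Detection.
Variables (R : comNzRingType) (m : {pred R}).
Hypotheses (noeth : noetherian_ring R) (loc : local_ring m).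
Hypothesis hCM : cohen_macaulay m.
Implicit Types (A B C G K L N : lmodType R).

Notation depth_ge := (depth_ge m).

Lemma residue_exists : exists (k : lmodType R) (p : {linear R^o -> k}),
  surjective p /\ forall r, p r = 0 <-> r \in m.
Proof. exact: (quotient_exists (m_submod loc)). Qed.

(** A module on which m acts nilpotently is filtered by copies of the residue field. *)
Lemma tor_vanish_nilpotent N i L (k : lmodType R) (p : {linear R^o -> k}) :
  surjective p -> (forall r, p r = 0 <-> r \in m) -> fin_gen L ->
  (forall x (z : L), x \in m -> exists t, x ^+ t *: z = 0) ->
  tor_vanish N i k -> tor_vanish N i L.
Proof.
move=> pS pE fgL nil vk.
pose P (U : L -> Prop) := submod U /\ exists (S : lmodType R) (u : {linear S -> L}),
  [/\ injective u, forall x, U x <-> imS u x & tor_vanish N i S].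
have [||U [[sU [S [u [uI uE vS]]]] Umax]] := @noetherian_maximal _ noeth L P (@zeroS R L) fgL.
- by move=> U [].
- split; first exact: zeroS_submod.
  have [|u uE] := @linear_pack R 'rV[R]_0 L (fun=> 0).
    by move=> *; rewrite scaler0 addr0.
  exists 'rV[R]_0, u; split=> [x y _|x|]; first by rewrite (thinmx0 x) (thinmx0 y).
    by split=> [->|[y <-]]; [exists 0|]; rewrite uE.
  exact/tor_vanish_projective/row_projective.
suff UT x : U x.
  have [|||f fE] := @linear_of_rel R L S (fun x s => u s = x).
  - by move=> x; apply/uE.
  - by move=> c x x' s s' <- <-; rewrite linearP.
  - by move=> s e; apply: uI; rewrite e raddf0.
  apply: (tor_vanish_retract (f := f) (g := u)) vS => x.
  exact/fE.
apply: contrapT => nUx.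
have [|||y [_ nUy my]] := @socle_exists R m noeth L U (fun=> True) x sU _ _ _ nUx => //.
  by move=> a z /(nil a z)[t e]; exists t; rewrite e; apply: submod0.
pose V := addS U (in_span [:: y]).
have sy := in_span_submod [:: y].
have sV : submod V by apply: addS_submod.
have Vy : V y by apply: addSr => //; apply/in_span_mem/mem_head.
have um r : U (r *: y) -> r \in m.
  move=> Ur; apply: contrapT => /negP/(unitNm noeth loc)[t tE]; apply: nUy.
  by rewrite -[y]scale1r -tE -scalerA; apply: submodZ.
apply: nUy; apply: (Umax V _ _ y Vy) => [|z Uz]; last exact: addSl.
split=> //; have [S' [u' [u'I u'E]]] := submodule_exists sV; exists S', u'; split=> //.
have UV z : U z -> V z by apply: addSl.
have [|||a aE] := @linear_of_rel R S S' (fun s s' => u' s' = u s).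
- by move=> s; apply/u'E/UV/uE; exists s.
- by move=> c s1 s2 s1' s2' e1 e2; rewrite !linearP e1 e2.
- by move=> s' e; apply: u'I; rewrite e !raddf0.
have aE' s : u' (a s) = u s by apply/aE.
have [|||b bE] := @linear_of_rel R S' k (fun s' w => exists r, U (u' s' - r *: y) /\ p r = w).
- move=> s'; have [|v [_ [Uv /in_span_cons[r [z [/in_span_nil-> ->]]] e]]] := iffRL (u'E (u' s')).
    by exists s'.
  by exists (p r), r; rewrite e addr0 addrK.
- move=> c s1 s2 w1 w2 [r1 [U1 <-]] [r2 [U2 <-]]; exists (c * r1 + r2); split.
    by rewrite linearP scalerDl -scalerA opprD addrACA -scalerBr; apply: sU.2.
  exact: (linearP p c (r1 : R^o) r2).
- move=> w [r [Ur <-]]; apply/pE/um; rewrite raddf0 sub0r in Ur.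
  by rewrite -[_ *: _]opprK; apply: submodN.
have bE' s' r : U (u' s' - r *: y) -> b s' = p r by move=> h; apply/esym/bE; exists r.
apply: (tor_vanish_ext (a := a) (b := b) _ vS vk); split.
- by move=> s1 s2 e; apply: uI; rewrite -!aE' e.
- move=> w; have [r <-] := pS w; have [s' s'E] : imS u' (r *: y) by apply/u'E; apply: submodZ.
  by exists s'; apply: bE'; rewrite s'E subrr; apply: submod0.
move=> s'; split=> [b0|[s <-]]; last first.
  rewrite (bE' _ 0) ?raddf0 // scale0r subr0 aE'; apply/uE; by exists s.
have [r [Ur pr]] := iffRL (bE s' 0) (esym b0).
have /uE[s sE] : U (u' s').
  rewrite -(subrK (r *: y) (u' s')); apply: submodD => //; apply: my; exact/pE.
by exists s; apply: u'I; rewrite aE'.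
Qed.

Lemma in_supp_surj L L1 (c : {linear L -> L1}) (U : L1 -> Prop) q :
  surjective c -> in_supp U q -> in_supp (fun y => U (c y)) q.
Proof.
move=> cS [qP [z zq]]; split=> //; have [y yz] := cS z; exists y => s sq.
by rewrite linearZ yz; apply: zq.
Qed.

(** By induction on the depth n of L, dividing by a regular element at each step:
Tor_{n+i+1}(Tr N, k) = 0 implies Tor_{i+1}(Tr N, L) = 0. *)
Lemma tor_vanish_residue N n i L (k : lmodType R) (p : {linear R^o -> k}) :
  surjective p -> (forall r, p r = 0 <-> r \in m) ->
  (forall x, x \in m -> exists t, stably_zero N (x ^+ t)) ->
  fin_gen L -> depth_ge n (@zeroS R R^o) -> depth_ge n (@zeroS R L) -> dim_le n (@zeroS R L) ->
  tor_vanish N (n + i) k -> tor_vanish N i L.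
Proof.
move=> pS pE stab; elim: n i L => [|n IH] i L fgL dR dL nL vk.
  apply: (tor_vanish_nilpotent pS pE fgL) vk => x z xm.
  exact: (dim0_nilpotent noeth loc z (@zeroS_submod R L) nL xm).
have sR := @zeroS_submod R R^o; have sL := @zeroS_submod R L.
have [y [ym yR yL]] := regular_exists2 noeth loc (fin_gen_regular R) fgL sR sL
  (depth_socle_free dR) (depth_socle_free dL).
have [t tN] := stab y ym; have [xR xL] := (regularX (t := t.+1) yR, regularX (t := t.+1) yL).
have xm : y ^+ t.+1 \in m by rewrite exprS; apply: (mMr loc).
have xN : stably_zero N (y ^+ t.+1).
  move=> L' Q f q qS; have [g gE] := tN _ _ f q qS.
  by exists (y \*: g) => z; rewrite /= linearZ /= gE scalerA exprS.
set x := y ^+ t.+1 in xR xL xm xN.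
have [L1 [c [cS cE]]] := quotient_exists (@scaleS_submod R L x).
have cx : (fun y => @zeroS R L1 (c y)) = addx (@zeroS R L) x.
  apply: funext => z; apply: propext; split=> [/cE zx|].
    by exists 0, z; rewrite add0r.
  by move=> [_ [w [-> wx ->]]]; rewrite add0r; apply/cE.
have sL1 := @zeroS_submod R L1.
apply: (tor_vanish_regular (c := c) (L1 := L1) noeth fgL xN) => //.
apply: IH; last by rewrite addnS.
- exact: fin_gen_surj cS fgL.
- exact: depth_geW.
- by apply/(depth_ge_surj m n cS sL1); rewrite cx; apply: depth_regular.
- move=> j q /(in_supp_surj cS); rewrite cx; apply: dim_le_addx => //.
Qed.

Lemma depth_ge_le n j L (U : L -> Prop) : (n <= j)%N -> depth_ge j U -> depth_ge n U.
Proof. by move=> nj; rewrite -(subnK nj); elim: (j - n)%N => //= l IH /depth_geW/IH. Qed.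

(** X is the n-th syzygy of C, so that Tor_{i+1}(Tr N, X) = Tor_{n+i+1}(Tr N, C). *)
Lemma syzygy_exists d n C : krull_dim R d -> fin_gen C -> (n <= d)%N ->
  exists X : lmodType R, [/\ fin_gen X, depth_ge n (@zeroS R X) &
    forall N i, tor_vanish N i X -> tor_vanish N (n + i) C].
Proof.
move=> dd fgC; elim: n => [|n IH] nd; first by exists C.
have [X [fgX dX vX]] := IH (ltnW nd).
have [k [q qS]] := free_cover fgX; have [K [u ex]] := kernel_exists qS.
have [uI _ _] := ex; have fgK := fin_gen_inj noeth uI (fin_gen_row R k).
have [fgF dF] := iffLR (is_mcmP noeth loc _ dd) (is_mcm_row noeth loc hCM k).
exists K; split=> //.
  apply: (depth_lemma noeth loc fgK fgF fgX _ _ _ (short_exact_relative ex)) => //.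
  - exact: zeroS_submod.
  - exact: zeroS_submod.
  - exact: zeroS_submod.
  - exact: depth_ge_le dF.
move=> N i vK; rewrite addSnnS; apply: vX.
by exists K, 'rV[R]_k, u, q; split=> //; apply: row_projective.
Qed.

(** For X the d-th syzygy of the residue field k, the stable Hom(N, X) is
Tor_{d+1}(Tr N, k), whose vanishing forces that of Tor_1(Tr N, N), the stable
Hom(N, N). *)
Lemma residue_syzygy : exists X : mcm m, forall N : mcm m,
  (forall x, x \in m -> exists t, stably_zero N (x ^+ t)) ->
  lifts N X -> lifts N N.
Proof.
have [d [dd dR]] := hCM.
have [k [p [pS pE]]] := residue_exists.
have fgk := fin_gen_surj pS (fin_gen_regular R).
have [X [fgX dX vX]] := syzygy_exists dd fgk (leqnn d).
have Xm : is_mcm m X by apply/(is_mcmP noeth loc _ dd).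
exists (Mcm Xm) => N stab /(vX N 0%N) vk.
have [fgN dN] := iffLR (is_mcmP noeth loc _ dd) (mcm_is_mcm N).
have [_ dR'] := iffLR (is_mcmP noeth loc _ dd) (regular_module_mcm hCM).
apply: (tor_vanish_residue (i := 0) pS pE stab fgN dR' dN _ vk).
exact: dim_le_krull.
Qed.

(** A module on which the identity factors through a free module has R as a direct
summand: otherwise all maps to R would have values in m, and N = mN. *)
Lemma lifts_id_free N : fin_gen N -> indecomposable N -> lifts N N -> mod_iso N R^o.
Proof.
move=> fgN [[x0 x0N] indec] lN; have [n [p pS]] := free_cover fgN.
have [s sE] := lN idfun _ p pS.
have [j [z sm]] : exists j z, (s z) 0 j \notin m.
  apply: contrapT => h; apply: x0N; apply: (nakayama0 noeth loc fgN) => z.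
  have -> : z = p (s z) by rewrite sE.
  rewrite (row_sum_delta (s z)) linear_sum; apply: submod_sum => [|j _].
    exact: mulm_submod.
  rewrite linearZ; apply: mulm_mem => //; apply: contrapT => /negP sm.
  by apply: h; exists j, z.
have [t tE] := unitNm noeth loc sm.
have [|a aE] := @linear_pack R N R^o (fun y => s y 0 j).
  by move=> c x y; rewrite linearP !mxE.
pose w := t *: z; have aw : a w = 1 by rewrite linearZ aE.
have aZ c : a (c *: w) = c by rewrite linearZ aw; apply: mulr1.
have [||||w0|a0] := indec (fun x => `[< exists c, x = c *: w >]) (fun x => `[< a x = 0 >]).
- split; first by apply/asboolP; exists 0; rewrite scale0r.
  move=> c x y /asboolP[u ->] /asboolP[v ->]; apply/asboolP; exists (c * u + v).
  by rewrite scalerDl scalerA.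
- split; first by apply/asboolP; rewrite raddf0.
  by move=> c x y /asboolP ax /asboolP ay; apply/asboolP; rewrite linearP ax ay scaler0 addr0.
- move=> x; exists (a x *: w), (x - a x *: w); split; last by rewrite addrC subrK.
    by apply/asboolP; exists (a x).
  by apply/asboolP; rewrite linearB aZ subrr.
- by move=> x /asboolP[c ->] /asboolP; rewrite aZ => ->; rewrite scale0r.
- have : w = 0 by apply/w0/asboolP; exists 1; rewrite scale1r.
  move=> w00; have := aw; rewrite w00 raddf0 => /eqP.
  by rewrite eq_sym oner_eq0.
exists a; exists (fun c => c *: w) => [x|c]; last exact: aZ.
apply/eqP; rewrite -subr_eq0; apply/eqP/a0/asboolP.
by rewrite linearB aZ subrr.
Qed.

(** As g f is invertible, f makes M a direct summand of N. *)
Lemma indecomposable_iso (M N : lmodType R) (f : {linear M -> N}) (g : {linear N -> M}) :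
  (exists x : M, x <> 0) -> indecomposable N -> bijective (g \o f) -> mod_iso M N.
Proof.
move=> [x0 x0N] [_ indec] [h hK Kh].
have fI : injective f by move=> x y e; rewrite -[x]hK -[y]hK /= e.
have fS : surjective f; last by exists f; apply: inj_surj_bij.
have [||||f0|g0] := indec (fun y => `[< imS f y >]) (fun y => `[< g y = 0 >]).
- split; first by apply/asboolP; apply: submod0 (imS_submod f).
  by move=> c x y /asboolP fx /asboolP fy; apply/asboolP; apply: (imS_submod f).2.
- split; first by apply/asboolP; rewrite raddf0.
  by move=> c x y /asboolP ax /asboolP ay; apply/asboolP; rewrite linearP ax ay scaler0 addr0.
- move=> y; exists (f (h (g y))), (y - f (h (g y))); split; last by rewrite addrC subrK.
    by apply/asboolP; exists (h (g y)).
  by apply/asboolP; rewrite linearB; have /= -> := Kh (g y); rewrite subrr.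
- move=> _ /asboolP[x <-] /asboolP gf0; have := hK x; rewrite /= gf0 => <-.
  by have := hK 0; rewrite /= !raddf0 => ->; rewrite raddf0.
- by case: x0N; apply: fI; rewrite raddf0; apply/f0/asboolP; exists x0.
move=> y; exists (h (g y)); apply/eqP; rewrite -subr_eq0; apply/eqP/g0/asboolP.
by rewrite linearB; have /= -> := Kh (g y); rewrite subrr.
Qed.

End Detection.

(** * Simple functors *)
Section SimpleFunctors.
Variables (R : comNzRingType) (m : {pred R}).
Hypotheses (noeth : noetherian_ring R) (loc : local_ring m).
Hypothesis hCM : cohen_macaulay m.
Local Notation A := (stable_mod_category hCM).
Implicit Types (M N : mcm m) (X S : A).

Definition scalar_end M (r : R) : HomR M M := r \*: idfun.

Lemma fin_gen_mcm M : fin_gen M. Proof. by case: (mcm_is_mcm M). Qed.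

(** The subfunctor generated by s is an object of the stable category by [stable_sub],
and a nonzero subobject of S is S. *)
Lemma simple_generated S M (s : functor_of S M) : is_simple S -> s <> 0 ->
  forall N (y : functor_of S N), exists h : HomR N M, y = fmap (functor_of S) h s.
Proof.
move=> [_ simp] s0 N y.
have gP : generated_by (fun N y => exists h : HomR N M, y = fmap (functor_of S) h s) s by [].
have [K [u [uI uE]]] := subfunctor_exists (generated_subfunctor gP).
have [s' s'E] : exists s', u M s' = s.
  by apply/uE; exists (HomR_id M); rewrite fmap_id.
have sK : stable K.
  apply: (stable_sub noeth loc hCM (u := u) (g := s') (functor_of_stable S) uI) => L k.
  have [h hE] : exists h : HomR L M, u L k = fmap (functor_of S) h s by apply/uE; exists k.
  by exists h; apply: uI; rewrite hE nt_natural s'E.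
have [Z ZK] := stable_objP hCM sK; case: _ / ZK u uI uE s' s'E sK => u uI uE s' s'E _.
have [|/is_zeroP Z0|/iso_pt uB] := simp Z (hom_of u).
- by apply: pt_mono; rewrite nt_of_hom_of.
- by case: s0; rewrite -s'E (Z0 M s') raddf0.
- by have [v _ vK] := uB N; apply/uE; exists (v y); rewrite -[RHS]vK nt_of_hom_of.
Qed.

Lemma fmap_bijective_eq0 (F : add_functor m) M (e : HomR M M) (x : F M) :
  bijective e -> fmap F e x = 0 -> x = 0.
Proof.
move=> [g gK Kg] ex.
have [|k kE] := @linear_pack_Hom R M M g.
  by move=> c y z; apply: (can_inj gK); rewrite linearP !Kg.
have -> : x = fmap F (HomR_comp e k) x.
  rewrite -[LHS]fmap_id; congr (fmap F _ x); apply: HomR_ext => y.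
  by rewrite /HomR_comp /= kE Kg.
by rewrite fmap_comp ex raddf0.
Qed.

(** Simple functors are determined by an indecomposable module on which they do not
vanish: u = S(gf)u shows that 1 - gf is not invertible, so gf is. *)
Lemma simple_indecomposable S M N (u : functor_of S M) (v : functor_of S N) :
  adically_complete m -> is_simple S -> indecomposable M -> indecomposable N ->
  u <> 0 -> v <> 0 -> mod_iso M N.
Proof.
move=> compl simp iM iN u0 v0.
have [f fE] := simple_generated simp v0 u; have [g gE] := simple_generated simp u0 v.
have e : fmap (functor_of S) (HomR_id M - HomR_comp g f) u = 0.
  by rewrite fmapB fmap_id fmap_comp -gE -fE subrr.
have [gfB|gfB] := indecomposable_local noeth loc compl (HomR_comp g f) (fin_gen_mcm M) iM.
  by apply: (indecomposable_iso (f := f) (g := g)) gfB => //; case: iM.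
by case: u0; apply: fmap_bijective_eq0 e.
Qed.

Lemma bijective_one_sub_scalar M (r : R) (h : HomR M M) : r \in m ->
  bijective (HomR_id M - HomR_comp (scalar_end M r) h : HomR M M).
Proof.
move=> rm; apply: (surjective_bijective noeth (fin_gen_mcm M)).
apply: (surjective_mod_m noeth loc (fin_gen_mcm M)) => x; exists x.
rewrite (_ : _ - _ = r *: h x); first exact: mulm_mem.
by rewrite /= opprB addrC subrK.
Qed.

(** Nakayama's lemma for functors: m annihilates the simple functors. *)
Lemma simple_scalar S r : is_simple S -> r \in m ->
  forall M (x : functor_of S M), fmap (functor_of S) (scalar_end M r) x = 0.
Proof.
move=> simp rm M x; have [X0 [s sgen]] := stable_generated (functor_of_stable S).
have nat N (L : mcm m) (h : HomR N L) : HomR_comp h (scalar_end N r) = HomR_comp (scalar_end L r) h.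
  by apply: HomR_ext => y; rewrite /HomR_comp /= linearZ.
suff s0 : fmap (functor_of S) (scalar_end X0 r) s = 0.
  by have [h ->] := sgen M x; rewrite -fmap_comp nat fmap_comp s0 raddf0.
apply: contrapT => nz; have [h hE] := simple_generated simp nz s.
rewrite -fmap_comp in hE; apply: nz.
rewrite (_ : s = 0) ?raddf0 //; apply: fmap_bijective_eq0 (bijective_one_sub_scalar h rm) _.
by rewrite fmapB fmap_id -hE subrr.
Qed.

(** The exponent t is the number of simple factors, each of which r annihilates. *)
Lemma finite_length_scalar X r : finite_length X -> r \in m ->
  exists t, forall M (x : functor_of X M), fmap (functor_of X) (scalar_end M (r ^+ t)) x = 0.
Proof.
move=> fX rm; elim: fX => {X} [X /is_zeroP X0|Y X S u p kP cP simp _ [t tY]].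
  by exists 0%N => M x; rewrite (X0 M x) raddf0.
exists t.+1 => M x.
have -> : scalar_end M (r ^+ t.+1) = HomR_comp (scalar_end M r) (scalar_end M (r ^+ t)).
  by apply: HomR_ext => y; rewrite /HomR_comp /= scalerA exprS.
rewrite fmap_comp.
have [|y <-] := kernel_pt noeth loc kP (x := fmap (functor_of X) (scalar_end M r) x).
  by rewrite nt_natural simple_scalar.
by rewrite -nt_natural tY raddf0.
Qed.

(** There is one indecomposable module for each simple factor of X. *)
Lemma finite_length_detect X : adically_complete m -> finite_length X ->
  exists n (Z : 'I_n -> mcm m), forall M (x : functor_of X M), indecomposable M -> x <> 0 ->
    exists i, mod_iso M (Z i).
Proof.
move=> compl; elim=> {X} [X /is_zeroP X0|Y X S u p kP cP simp _ [n [Z ZP]]].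
  exists 0%N, (fun=> regular_mcm hCM) => M x _; case; exact: X0.
have [W WP] : exists W : mcm m, forall M (x : functor_of S M), indecomposable M -> x <> 0 -> mod_iso M W.
  have [[W [iW [w w0]]]|nW] := pselect (exists W : mcm m, indecomposable W /\ exists w : functor_of S W, w <> 0).
    by exists W => M x iM x0; apply: simple_indecomposable x0 w0.
  by exists (regular_mcm hCM) => M x iM x0; case: nW; exists M; split=> //; exists x.
exists n.+1, (fun i => oapp Z W (unlift ord0 i)) => M x iM x0.
have [px0|px0] := pselect (nt_of p M x = 0); last first.
  by exists ord0; rewrite unlift_none; apply: WP px0.
have [y yE] := kernel_pt noeth loc kP px0.
have [|i iP] := ZP M y iM; first by move=> y0; apply: x0; rewrite -yE y0 raddf0.
by exists (lift ord0 i); rewrite liftK.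
Qed.

(** The functor of stable maps into the module X of [residue_syzygy] is nonzero on only
finitely many indecomposable modules, up to isomorphism. If it vanishes on M then M is
free: the powers of elements of m needed in [residue_syzygy] are given by
[finite_length_scalar], for the functor of stable maps into M. *)
Theorem finite_length_finite_type : adically_complete m ->
  (forall X, finite_length X) -> finite_cm_type m.
Proof.
move=> compl fl.
have [X XP] := residue_syzygy noeth loc hCM.
have [k [q qS]] := free_cover (fin_gen_mcm X).
have [F [x0 pr]] := stable_cokernel_exists (Y := row_mcm noeth loc hCM k) (pi := q) qS.
have [Z ZF] : exists Z : A, functor_of Z = F by apply: stable_objP; exists X, (row_mcm noeth loc hCM k), q, x0.
have [n [W WP]] := finite_length_detect compl (fl Z); rewrite ZF in WP.
exists n.+1, (fun i => oapp W (regular_mcm hCM) (unlift ord0 i)) => M iM.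
have [[x xn0]|F0] := pselect (exists x : F M, x <> 0).
  by have [i iP] := WP M x iM xn0; exists (lift ord0 i); rewrite liftK.
exists ord0; rewrite unlift_none; apply: (lifts_id_free noeth loc (fin_gen_mcm M) iM).
apply: XP => [r rm|f Q p pS]; last first.
  have [_ _ ker] := pr; have /ker[h hE] : fmap F (f : HomR M X) x0 = 0.
    by apply: contrapT => n0; apply: F0; exists (fmap F (f : HomR M X) x0).
  have [g gE] := row_projective q pS; exists (g \o h) => x /=.
  by rewrite gE; have := congr1 (fun t : HomR M X => t x) hE.
have [l [s sS]] := free_cover (fin_gen_mcm M).
have [G [y0 prG]] := stable_cokernel_exists (Y := row_mcm noeth loc hCM l) (pi := s) sS.
have [V VG] : exists V : A, functor_of V = G.
  by apply: stable_objP; exists M, (row_mcm noeth loc hCM l), s, y0.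
have [t tP] := finite_length_scalar (fl V) rm; rewrite VG in tP.
have [_ _ kerG] := prG; exists t => L Q f p pS.
have /kerG[h hE] := tP M y0.
have [g gE] := row_projective (f \o s) pS; exists (g \o h) => y /=.
rewrite gE /= -linearZ; congr (f _).
by have := congr1 (fun t : HomR M M => t y) hE.
Qed.

End SimpleFunctors.

(** * Length *)

Section Length.
Variables (R : comNzRingType) (m : {pred R}).
Hypotheses (noeth : noetherian_ring R) (loc : local_ring m).
Implicit Types M N A B C : lmodType R.

Notation mulm := (@mulm R m _).
Notation mpow := (@mpow R m _).

(** There are submodules U = W_0 < W_1 < ... < W_n contained in V, that is, V/U has
length at least [n]. *)
Fixpoint chain M n (U V : M -> Prop) : Prop :=
  if n is k.+1 then exists W : M -> Prop,
    [/\ submod W, forall x, U x -> W x, ~ forall x, W x -> U x & chain k W V]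
  else forall x, U x -> V x.

Lemma chain_start M n (U U' V : M -> Prop) :
  (forall x, U' x -> U x) -> chain n U V -> chain n U' V.
Proof.
case: n => [|n] /= U'U; first by move=> UV x /U'U/UV.
move=> [W [sW UW nWU WV]]; exists W; split=> // [x /U'U/UW//|WU'].
by apply: nWU => x /WU'/U'U.
Qed.

Lemma chain_end M n (U V V' : M -> Prop) :
  (forall x, V x -> V' x) -> chain n U V -> chain n U V'.
Proof.
move=> VV'; elim: n U => [|n IH] U /=; first by move=> UV x /UV/VV'.
by move=> [W [sW UW nWU /IH WV]]; exists W.
Qed.

Lemma chain_sub M n (U V : M -> Prop) : chain n U V -> forall x, U x -> V x.
Proof. by elim: n U => [|n IH] U //= [W [_ UW _ /IH WV]] x /UW/WV. Qed.

Lemma chain_le M n k (U V : M -> Prop) : (k <= n)%N -> chain n U V -> chain k U V.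
Proof.
move=> kn; rewrite -(subnK kn); elim: (n - k)%N => //= j IH [W [_ UW _ WV]].
exact/IH/(chain_start UW WV).
Qed.

Lemma chain_cat M a b (U W V : M -> Prop) :
  chain a U W -> chain b W V -> chain (a + b) U V.
Proof.
elim: a U => [|a IH] U /=; first exact: chain_start.
by move=> [X [sX UX nXU /IH h]] WV; exists X; split=> //; apply: h.
Qed.

Lemma chain1 M (U V : M -> Prop) : submod V -> (forall x, U x -> V x) ->
  ~ (forall x, V x -> U x) -> chain 1 U V.
Proof. by move=> sV UV nVU; exists V; split=> /=. Qed.

(** A chain from X to V is seen, by the modular law, by its traces on W and by its
images modulo W. *)
Lemma chain_split M n (X W V : M -> Prop) : submod X -> submod W -> submod V ->
  (forall x, W x -> V x) -> chain n X V -> exists p q, [/\ (n <= p + q)%N,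
    chain p (fun x => X x /\ W x) W & chain q (addS X W) V].
Proof.
move=> sX sW sV WV; elim: n X sX => [|n IH] X sX /=.
  move=> XV; exists 0%N, 0%N; split=> //=; first by move=> x [].
  exact: addS_sub.
move=> [X1 [sX1 XX1 nX1X /(IH _ sX1) [p [q [npq pc qc]]]]].
have XW : forall x, addS X W x -> addS X1 W x.
  by move=> _ [u [v [/XX1 Xu Wv ->]]]; exists u, v.
have [h|h] := pselect (forall x, X1 x /\ W x -> X x /\ W x).
  exists p, q.+1; split; first by rewrite addnS.
    by apply: chain_start pc => x [/XX1].
  exists (addS X1 W); split=> //; first exact: addS_submod.
  move=> XW'; apply: nX1X => x X1x.
  have [u [v [Xu Wv xE]]] : addS X W x by apply: XW'; apply: addSl.
  have [|Xv _] := h v; last by rewrite xE; apply: submodD.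
  by split=> //; rewrite -(addKr u v) -xE; apply: submodD => //; apply: submodN => //; apply: XX1.
exists p.+1, q; split; first by rewrite addSn.
  exists (fun x => X1 x /\ W x); split=> //; first exact: capS_submod.
  by move=> x [/XX1].
by apply: chain_start qc.
Qed.

(** By [chain_split] a long chain has a long trace on W or a long image modulo W. *)
Lemma chain_bound_add M a b (U W V : M -> Prop) : submod U -> submod W -> submod V ->
  (forall x, U x -> W x) -> (forall x, W x -> V x) ->
  ~ chain a.+1 U W -> ~ chain b.+1 W V -> ~ chain (a + b).+1 U V.
Proof.
move=> sU sW sV UW WV na nb /(chain_split sU sW sV WV) [p [q [npq pc qc]]].
have pa : (p <= a)%N.
  rewrite leqNgt; apply/negP => ap; apply: na; apply: chain_le ap _.
  by apply: chain_start pc => x Ux; split=> //; apply: UW.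
have qb : (q <= b)%N.
  rewrite leqNgt; apply/negP => bq; apply: nb; apply: chain_le bq _.
  by apply: chain_start qc => x Wx; apply: addSr.
by move: npq; lia.
Qed.

Lemma chain_simple M (U : M -> Prop) y : submod U ->
  (forall a, a \in m -> U (a *: y)) -> ~ chain 2 U (addS U (in_span [:: y])).
Proof.
move=> sU my [W [sW UW nWU [X [sX WX nXW XV]]]]; apply: nXW => x /XV.
apply: addS_sub => // {x} x.
suff Wy : W y.
  by apply: in_span_min => // w; rewrite inE => /eqP->.
move: nWU => /existsNP[w /not_implyP [Ww nUw]].
have [u [_ [Uu /in_span_cons[c [v [/in_span_nil-> ->]]] wE]]] := XV _ (WX _ Ww).
have [|t tE] := @unitNm R m noeth loc c.
  apply/negP => cm; apply: nUw; rewrite wE addr0.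
  by apply: submodD => //; apply: my.
rewrite -[y]scale1r -tE -scalerA; apply: submodZ => //.
rewrite addr0 in wE; rewrite -(addKr u (c *: y)) -wE.
by apply: submodD => //; apply: submodN => //; apply: UW.
Qed.

(** For V maximal of finite length over U, an element of H outside V and killed by m
modulo V would give a larger such submodule, with one more simple factor. *)
Lemma finite_chain M (U H : M -> Prop) : fin_gen M -> submod U -> submod H ->
  (forall x, U x -> H x) ->
  (forall x z, x \in m -> H z -> exists t, U (x ^+ t *: z)) -> exists N : nat, ~ chain N U H.
Proof.
move=> fgM sU sH UH nil.
pose P V := [/\ submod V, forall x, U x -> V x, forall x, V x -> H x & exists N : nat, ~ chain N U V].
have [||V [[sV UV VH [N nN]] Vmax]] := @noetherian_maximal _ noeth M P U fgM.
- by move=> V [].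
- by split=> //; exists 1%N => -[W [_ _ nWU WU]]; apply: nWU.
suff HV x : H x -> V x.
  exists N => h; apply: nN; apply: chain_end h; exact: HV.
move=> Hx; apply: contrapT => nVx.
have [|y [Hy nVy my]] := @socle_exists R m noeth M V H x sV sH _ Hx nVx.
  by move=> a z am Hz; have [t /UV] := nil a z am Hz; exists t.
have sy := in_span_submod [:: y].
have sW : submod (addS V (in_span [:: y])) by apply: addS_submod.
apply: nVy; apply: (Vmax (addS V (in_span [:: y]))); last first.
- by apply: addSr => //; apply/in_span_mem/mem_head.
- by move=> z Vz; apply: addSl.
split=> //.
- by move=> z /UV Vz; apply: addSl.
- apply: addS_sub => //; apply: in_span_min => // z.
  by rewrite inE => /eqP->.
exists (N + 1).+1; apply: (chain_bound_add sU sV sW UV) => [z Vz|/chain_le h|].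
- exact: addSl.
- by apply: nN; apply: h.
- exact: chain_simple.
Qed.

(** (U + im f)/U and M/f^-1(U) are isomorphic. *)
Lemma chain_image M N n (f : {linear M -> N}) (U : N -> Prop) : submod U ->
  chain n (fun x => U (f x)) (fun=> True) <-> chain n U (addS U (imS f)).
Proof.
elim: n U => [|n IH] U sU /=.
  by split=> // _ x Ux; apply: addSl => //; apply: imS_submod.
split=> -[W [sW UW nWU WV]].
  pose W1 := addS U (fun y => exists2 x, f x = y & W x).
  have sfW : submod (fun y => exists2 x, f x = y & W x).
    split; first by exists 0; [exact: raddf0|exact: submod0].
    move=> a _ _ [x <- Wx] [y <- Wy]; exists (a *: x + y); first exact: linearP.
    exact: sW.2.
  have sW1 : submod W1 by apply: addS_submod.
  have W1E x : W1 (f x) <-> W x.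
    split=> [[u [_ [Uu [w <- Ww] e]]]|Wx]; last by apply: addSr => //; exists x.
    rewrite -(subrK w x); apply: submodD => //; apply: UW.
    by rewrite linearB e addrK.
  exists W1; split=> //.
  - by move=> y Uy; apply: addSl.
  - by move=> W1U; apply: nWU => x /W1E/W1U.
  apply: chain_end (_ : chain n W1 (addS W1 (imS f))).
    apply: addS_sub; first by apply: addS_submod => //; apply: imS_submod.
      move=> _ [u [_ [Uu [x <- _] ->]]]; exists u, (f x); split=> //; by exists x.
    by move=> y fy; apply: addSr.
  by apply/IH => //; apply: chain_start WV => x /W1E.
have WUf := chain_sub WV.
exists (fun x => W (f x)); split.
- exact: preim_submod.
- by move=> x /UW.
- move=> WU; apply: nWU => w Ww; have [u [_ [Uu [x <-] wE]]] := WUf _ Ww.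
  rewrite wE; apply: submodD => //; apply: WU.
  rewrite -(addKr u (f x)) -wE; apply: submodD => //.
  by apply: submodN => //; apply: UW.
apply/IH => //; apply: chain_end WV => y [u [v [Uu fv ->]]].
by exists u, v; split=> //; apply: UW.
Qed.

Lemma chain_preim M N n (f : {linear M -> N}) (U : N -> Prop) : submod U -> surjective f ->
  chain n (fun x => U (f x)) (fun=> True) <-> chain n U (fun=> True).
Proof.
move=> sU fS; rewrite chain_image //; split; apply: chain_end => // y _.
by apply: addSr => //; apply: fS.
Qed.

Definition has_len M n (U V : M -> Prop) : Prop := chain n U V /\ ~ chain n.+1 U V.

Lemma has_len_exists M (N : nat) (U V : M -> Prop) : (forall x, U x -> V x) ->
  ~ chain N U V -> exists n, has_len n U V.
Proof.
move=> UV; elim: N => [//|N IH] nN.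
by have [h|/IH//] := pselect (chain N U V); exists N.
Qed.

Lemma has_len_uniq M n n' (U V : M -> Prop) : has_len n U V -> has_len n' U V -> n = n'.
Proof.
move=> [c nc] [c' nc']; have [h|h|//] := ltngtP n n'.
  by case: nc; apply: chain_le h c'.
by case: nc'; apply: chain_le h c.
Qed.

Lemma has_len_add M a b (U W V : M -> Prop) : submod U -> submod W -> submod V ->
  has_len a U W -> has_len b W V -> has_len (a + b) U V.
Proof.
move=> sU sW sV [ac nac] [bc nbc]; split; first exact: chain_cat ac bc.
by apply: chain_bound_add nac nbc => //; apply: chain_sub; [exact: ac|exact: bc].
Qed.

Lemma has_len_eq M a (U W V : M -> Prop) : submod W -> (forall x, U x -> W x) ->
  has_len a U V -> has_len a W V -> forall x, W x -> U x.
Proof.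
move=> sW UW [_ nac] [ac _]; apply: contrapT => nWU; apply: nac.
by rewrite -[a.+1]add1n; apply: chain_cat ac; apply: chain1.
Qed.

Lemma chain_ext_bound A B C a c (f : {linear A -> B}) (g : {linear B -> C})
    (U : A -> Prop) (V : B -> Prop) (W : C -> Prop) : short_exact f g ->
  submod U -> submod V -> submod W -> (forall x, U x -> V (f x)) ->
  (forall y, W (g y) <-> addS V (imS f) y) ->
  ~ chain a.+1 U (fun=> True) -> ~ chain c.+1 W (fun=> True) ->
  ~ chain (a + c).+1 V (fun=> True).
Proof.
move=> [_ gS _] sU sV sW UV WE na nc; have sf := imS_submod f.
have sVf : submod (addS V (imS f)) by apply: addS_submod.
apply: (chain_bound_add (W := addS V (imS f))) => // [x Vx||].
- exact: addSl.
- move=> /(chain_image _ f sV) h; apply: na; apply: chain_start h => x; exact: UV.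
move=> h; apply: nc; apply/(chain_preim _ sW gS); apply: chain_start h => y.
by move=> /WE.
Qed.

(** * Miyata's theorem *)

Lemma mpow_surj M N (g : {linear M -> N}) n z : surjective g ->
  mpow n z -> exists2 y, mpow n y & g y = z.
Proof.
move=> gS; elim: n z => [|n IH] z; first by move=> _; have [y] := gS z; exists y.
apply: (@mulm_min _ _ _ _ (fun z => exists2 y, mpow n.+1 y & g y = z)).
  split; first by exists 0; [exact: submod0 (mpow_submod _ _ _)|exact: raddf0].
  move=> a _ _ [y my <-] [y' my' <-]; exists (a *: y + y'); last exact: linearP.
  exact: (mpow_submod _ _ _).2.
move=> a w am /IH[y my <-]; exists (a *: y); last exact: linearZ.
exact: mulm_mem.
Qed.

Lemma fin_gen_ffun M q : fin_gen M -> fin_gen {ffun 'I_q -> M}.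
Proof.
elim: q => [|q IH] fgM.
  exists [::] => w; apply/in_span_nil/ffunP; case; by case.
have [|f fE] := @linear_pack R (M * {ffun 'I_q -> M})%type {ffun 'I_q.+1 -> M}
  (fun t => [ffun i => oapp t.2 t.1 (unlift ord0 i)]).
  move=> c x y; apply/ffunP => i; rewrite !ffunE.
  by case: unlift => [j|] //=; rewrite !ffunE.
apply: (fin_gen_surj (f := f)) (fin_gen_prod fgM (IH fgM)) => w.
exists (w ord0, [ffun j => w (lift ord0 j)]); rewrite fE; apply/ffunP => i.
by rewrite ffunE; case: unliftP => [j|] -> //=; rewrite ffunE.
Qed.

Lemma ffun_map M N q (f : {linear M -> N}) :
  exists F : {linear {ffun 'I_q -> M} -> {ffun 'I_q -> N}}, forall w i, F w i = f (w i).
Proof.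
have [|F FE] := @linear_pack R {ffun 'I_q -> M} {ffun 'I_q -> N} (fun w => [ffun i => f (w i)]).
  by move=> c x y; apply/ffunP => i; rewrite !ffunE linearP.
by exists F => w i; rewrite FE ffunE.
Qed.

Section Presentation.
Variables (p q : nat) (D : 'I_q -> 'I_p -> R).

(** The image of [D] on M^p: if D is the relation matrix of a module C, then M^q
modulo this image is the tensor product of M with the transpose of C. *)
Definition imD M (z : {ffun 'I_q -> M}) : Prop :=
  exists w : {ffun 'I_p -> M}, forall j, z j = \sum_i D j i *: w i.

Lemma imD_submod M : submod (@imD M).
Proof.
split.
  by exists 0 => j; rewrite ffunE big1 // => i _; rewrite ffunE scaler0.
move=> a x y [w wE] [v vE]; exists (a *: w + v) => j.
rewrite !ffunE wE vE scaler_sumr -big_split; apply: eq_bigr => i _.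
by rewrite !ffunE scalerDr !scalerA mulrC.
Qed.

Lemma imD_linear M N (f : {linear M -> N}) (F : {linear {ffun 'I_q -> M} -> {ffun 'I_q -> N}}) z :
  (forall w i, F w i = f (w i)) -> imD z -> imD (F z).
Proof.
move=> FE [w wE]; exists [ffun i => f (w i)] => j.
rewrite FE wE linear_sum; apply: eq_bigr => i _.
by rewrite linearZ ffunE.
Qed.

Definition imDm n M := addS (@imD M) (@mpow n).

Lemma imDm_submod n M : submod (@imDm n M).
Proof. by apply: addS_submod; [exact: imD_submod|exact: mpow_submod]. Qed.

Lemma imDm_linear n M N (f : {linear M -> N})
    (F : {linear {ffun 'I_q -> M} -> {ffun 'I_q -> N}}) z :
  (forall w i, F w i = f (w i)) -> imDm n z -> imDm n (F z).
Proof.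
move=> FE [u [v [Du mv ->]]]; rewrite linearD; exists (F u), (F v); split=> //.
  exact: imD_linear FE Du.
exact: mpow_linear.
Qed.

Lemma imDm_exact n A B C (f : {linear A -> B}) (g : {linear B -> C})
    (F : {linear {ffun 'I_q -> A} -> {ffun 'I_q -> B}})
    (G : {linear {ffun 'I_q -> B} -> {ffun 'I_q -> C}}) :
  short_exact f g -> (forall w i, F w i = f (w i)) -> (forall w i, G w i = g (w i)) ->
  surjective G /\ forall y, imDm n (G y) <-> addS (imDm n (M := B)) (imS F) y.
Proof.
move=> [fI gS ex] FE GE.
have GS : surjective G.
  move=> z; have [h hE] := choice gS; exists [ffun i => h (z i)].
  by apply/ffunP => i; rewrite GE ffunE hE.
have GF x : G (F x) = 0.
  by apply/ffunP => i; rewrite GE FE ffunE; apply/ex; exists (x i).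
split=> // y; split; last first.
  move=> [u [_ [Su [x <-] ->]]]; rewrite linearD GF addr0.
  exact: imDm_linear GE Su.
move=> [c [_ [[w wE] /(mpow_surj GS)[mu mmu <-] GyE]]].
have [h hE] := choice gS.
pose b : {ffun 'I_q -> B} := [ffun j => \sum_i D j i *: h (w i)].
have Gb : G b = c.
  apply/ffunP => j; rewrite GE ffunE wE linear_sum; apply: eq_bigr => i _.
  by rewrite linearZ hE.
have Db : imD b.
  by exists [ffun i => h (w i)] => j; rewrite ffunE; apply: eq_bigr => i _; rewrite ffunE.
have G0 : G (y - (b + mu)) = 0 by rewrite linearB linearD Gb GyE subrr.
have [a aE] : exists a : {ffun 'I_q -> A}, F a = y - (b + mu).
  have h2 i : imS f ((y - (b + mu)) i).
    by apply/ex; rewrite -GE G0 ffunE.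
  have [k kE] := choice h2; exists [ffun i => k i].
  by apply/ffunP => i; rewrite FE ffunE kE.
exists (b + mu), (F a); split; [by exists b, mu|by exists a|].
by rewrite aE addrC subrK.
Qed.

(** A short exact sequence with the same terms as a split one stays exact after
tensoring with the transpose of C modulo m^n: for both sequences the length of the image
of A is that of B minus that of C, and for the split one it is that of A. By Krull's
intersection theorem it stays exact without reduction modulo m^n. *)
Lemma purity A B C (f f' : {linear A -> B}) (g g' : {linear B -> C}) (r : {linear B -> A}) :
  fin_gen A -> fin_gen B -> fin_gen C -> short_exact f g -> short_exact f' g' -> cancel f' r ->
  forall F : {linear {ffun 'I_q -> A} -> {ffun 'I_q -> B}}, (forall w i, F w i = f (w i)) ->
  forall x, imD (F x) -> imD x.
Proof.
move=> fgA fgB fgC ex ex' f'K F FE x DFx.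
have finS n M : fin_gen M -> exists N : nat, ~ chain N (@imDm n M) (fun=> True).
  move=> fgM; apply: finite_chain => //; [exact: fin_gen_ffun|exact: imDm_submod|].
  move=> a z am _; exists n; apply: addSr; first exact: imD_submod.
  elim: (n) => [//|k IH]; rewrite exprS -scalerA; exact: mulm_mem.
have [G GE] := ffun_map q g; have [F' F'E] := ffun_map q f'; have [G' G'E] := ffun_map q g'.
have [r' r'E] := ffun_map q r.
have len n : exists a b c, [/\ has_len a (fun x => imDm n (F x)) (fun=> True),
    has_len b (fun x => imDm n (F' x)) (fun=> True), has_len c (@imDm n C) (fun=> True) & a = b].
  have [Nc /has_len_exists [//|c cC]] := finS n C fgC.
  have [Na nNa] := finS n A fgA.
  have hF (k : {linear A -> B}) (K : {linear {ffun 'I_q -> A} -> {ffun 'I_q -> B}}) :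
      (forall w i, K w i = k (w i)) -> exists a, has_len a (fun x => imDm n (K x)) (fun=> True).
    move=> KE; apply: (has_len_exists (N := Na)) => // h; apply: nNa.
    by apply: chain_start h => z; apply: imDm_linear.
  have [a aA] := hF f F FE; have [b bA] := hF f' F' F'E; exists a, b, c; split=> //.
  have lenB (h : {linear A -> B}) (k : {linear B -> C})
     (H : {linear {ffun 'I_q -> A} -> {ffun 'I_q -> B}})
     (K : {linear {ffun 'I_q -> B} -> {ffun 'I_q -> C}}) e : short_exact h k ->
     (forall w i, H w i = h (w i)) -> (forall w i, K w i = k (w i)) ->
     has_len e (fun x => imDm n (H x)) (fun=> True) -> has_len (e + c) (@imDm n B) (fun=> True).
    move=> hk HE KE [ec nec]; have [KS Kex] := imDm_exact n hk HE KE.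
    have sB := @imDm_submod n B; have sC := @imDm_submod n C.
    have sBH : submod (addS (@imDm n B) (imS H)) by apply: addS_submod => //; apply: imS_submod.
    apply: (has_len_add (W := addS (@imDm n B) (imS H))) => //.
      by split=> [|h']; [apply/chain_image|apply/nec/chain_image].
    have e' j : chain j (addS (@imDm n B) (imS H)) (fun=> True) <-> chain j (@imDm n C) (fun=> True).
      rewrite -(chain_preim _ sC KS); split; apply: chain_start => y; by rewrite Kex.
    by split=> [|/e']; [apply/e'; case: cC|case: cC].
  apply: (@addIn c); apply: has_len_uniq (lenB f g F G a ex FE GE aA) (lenB _ _ _ _ _ ex' F'E G'E bA).
have key n : imDm n x.
  have [a [b [c [aA bA cC ab]]]] := len n; subst b.
  have bA' : has_len a (@imDm n A) (fun=> True).
    case: bA => h1 h2; split.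
      by apply: chain_start h1 => z; apply: imDm_linear.
    move=> h; apply: h2; apply: chain_start h => z Sz.
    have -> : z = r' (F' z) by apply/ffunP => i; rewrite r'E F'E f'K.
    exact: imDm_linear r'E Sz.
  apply: (has_len_eq _ _ bA' aA) => [|z|].
  - exact/preim_submod/imDm_submod.
  - exact: imDm_linear.
  - by apply: addSl => //; apply: mpow_submod.
have [Q [p0 [p0S p0E]]] := quotient_exists (@imD_submod A).
apply/p0E; apply: (krull_intersection noeth loc) => [|n].
  exact: fin_gen_surj p0S (fin_gen_ffun q fgA).
have [u [v [/p0E Du mv ->]]] := key n.
by rewrite linearD Du add0r; apply: mpow_linear.
Qed.

End Presentation.

(** Miyata's theorem: by purity for the relation matrix D of C, lifts b to B of
generators of C can be corrected by elements of A so that D b = 0; this gives a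
section. *)
Theorem miyata A B C (f f' : {linear A -> B}) (g g' : {linear B -> C}) (r : {linear B -> A}) :
  fin_gen A -> fin_gen B -> fin_gen C -> short_exact f g -> short_exact f' g' -> cancel f' r ->
  exists t : {linear B -> A}, cancel f t.
Proof.
move=> fgA fgB fgC ex ex' f'K; have [fI gS fg] := ex.
have [n [c cS]] := free_cover fgC.
have [t tP] := fg_submodule noeth (fin_gen_row R n) (kerS_submod c).
pose D (j : 'I_(size t)) (i : 'I_n) := t`_j 0 i.
pose e (i : 'I_n) := c (delta_mx 0 i).
have cE v : c v = \sum_i v 0 i *: e i.
  by rewrite [in LHS](row_sum_delta v) linear_sum; apply: eq_bigr => i _; rewrite linearZ.
have [i|b bE] := @choice 'I_n B (fun i y => g y = e i); first exact: gS.
have De j : \sum_i D j i *: e i = 0.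
  by rewrite -cE; apply/tP/in_span_mem/mem_nth.
have [j|x xE] := @choice 'I_(size t) A (fun j z => f z = \sum_i D j i *: b i).
  apply/fg; rewrite linear_sum -[RHS](De j); apply: eq_bigr => i _.
  by rewrite linearZ bE.
have [F FE] := ffun_map (size t) f.
have [|y yE] := purity (D := D) fgA fgB fgC ex ex' f'K FE (x := [ffun j => x j]).
  exists [ffun i => b i] => j; rewrite FE ffunE xE; apply: eq_bigr => i _.
  by rewrite ffunE.
pose b' i := b i - f (y i).
have gb' i : g (b' i) = e i.
  by rewrite linearB bE (iffRL (fg _)) ?subr0 //; exists (y i).
have Db' j : \sum_i D j i *: b' i = 0.
  rewrite (eq_bigr (fun i => D j i *: b i - D j i *: f (y i))); last by move=> i _; rewrite scalerBr.
  rewrite sumrB -xE; have := yE j; rewrite ffunE => ->; rewrite linear_sum.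
  by apply/eqP; rewrite subr_eq0; apply/eqP/eq_bigr => i _; rewrite linearZ.
have [k kE] := row_map b'.
have kker v : c v = 0 -> k v = 0.
  move=> /tP; apply: (@in_span_min R _ t (kerS k)) => [|w /(nthP 0)[j jt <-]]; first exact: kerS_submod.
  by have := Db' (Ordinal jt); rewrite /kerS kE.
have [|||s sE] := @linear_of_rel R C B (fun z y => exists2 v, c v = z & k v = y).
- by move=> z; have [v vE] := cS z; exists (k v), v.
- by move=> a z z' w w' [v <- <-] [v' <- <-]; exists (a *: v + v'); rewrite linearP.
- by move=> w [v /kker kv <-].
have gs z : g (s z) = z.
  have [v <- <-] := iffRL (sE z (s z)) erefl.
  by rewrite kE linear_sum cE; apply: eq_bigr => i _; rewrite linearZ gb'.
have [|||u uE] := @linear_of_rel R B A (fun y x => f x = y - s (g y)).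
- by move=> w; apply/fg; rewrite linearB gs subrr.
- by move=> a w w' z z' e1 e2; rewrite !linearP /= e1 e2 scalerDr [RHS]addrACA.
- by move=> z h; apply: fI; rewrite h !raddf0 ?subr0 ?addr0 ?oppr0.
exists u => z; apply: fI; rewrite (iffRL (uE (f z) (u (f z))) erefl).
have gfz : g (f z) = 0 by apply/fg; exists z.
by rewrite gfz (raddf0 s) subr0.
Qed.

End Length.

(** * Finite representation type *)

Section Isomorphisms.
Variable R : comNzRingType.
Implicit Types L M N : lmodType R.

Lemma mod_iso_pack M N (f : M -> N) :
  (forall c x y, f (c *: x + y) = c *: f x + f y) -> bijective f -> mod_iso M N.
Proof.
move=> lf [g fK gK]; have [h hE] := linear_pack lf.
by exists h; exists g => x; rewrite hE.
Qed.

Lemma mod_iso_refl M : mod_iso M M.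
Proof. by exists idfun; exists idfun. Qed.

Lemma mod_iso_inv M N : mod_iso M N ->
  exists (f : {linear M -> N}) (g : {linear N -> M}), cancel f g /\ cancel g f.
Proof.
move=> [f [g fK gK]]; have [|h hE] := @linear_pack R N M g.
  by move=> c x y; apply: (can_inj fK); rewrite linearP !gK.
by exists f, h; split=> x; rewrite hE.
Qed.

Lemma mod_iso_sym M N : mod_iso M N -> mod_iso N M.
Proof. by move=> /mod_iso_inv[f [g [fK gK]]]; exists g; exists f. Qed.

Lemma mod_iso_trans L M N : mod_iso L M -> mod_iso M N -> mod_iso L N.
Proof. by move=> [f fB] [g gB]; exists (g \o f); apply: bij_comp. Qed.

Lemma mod_iso_prod L M L' M' : mod_iso L L' -> mod_iso M M' ->
  mod_iso (L * M)%type (L' * M')%type.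
Proof.
move=> [f [f' fK f'K]] [g [g' gK g'K]].
apply: (@mod_iso_pack _ _ (fun t => (f t.1, g t.2))).
  by move=> c x y; rewrite !linearP.
exists (fun t => (f' t.1, g' t.2)) => -[x y] /=; first by rewrite fK gK.
by rewrite f'K g'K.
Qed.

Lemma mod_iso_assoc L M N : mod_iso ((L * M) * N)%type (L * (M * N))%type.
Proof.
apply: (@mod_iso_pack _ _ (fun t => (t.1.1, (t.1.2, t.2)))) => //.
by exists (fun t => ((t.1, t.2.1), t.2.2)) => [[[x y] z]|[x [y z]]].
Qed.

Lemma decomposable_iso M : (exists x : M, x <> 0) -> ~ indecomposable M ->
  exists N L : lmodType R,
    [/\ exists x : N, x <> 0, exists x : L, x <> 0 & mod_iso (N * L)%type M].
Proof.
move=> M0 nind; apply: contrapT => h; apply: nind; split=> // N L cN cL sumNL capNL.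
have sub (P : {pred M}) : submod_closed P -> submod (fun x => x \in P).
  by move=> [P0 PP]; split=> // a x y; apply: PP.
have [K [u [uI uE]]] := submodule_exists (sub N cN).
have [K' [u' [u'I u'E]]] := submodule_exists (sub L cL).
have [K0|K0] := pselect (exists x : K, x <> 0); last first.
  left=> x /uE[y <-]; have -> : y = 0 by apply: contrapT => y0; apply: K0; exists y.
  exact: raddf0.
have [K'0|K'0] := pselect (exists x : K', x <> 0); last first.
  right=> x /u'E[y <-]; have -> : y = 0 by apply: contrapT => y0; apply: K'0; exists y.
  exact: raddf0.
exfalso; apply: h; exists K, K'; split=> //.
have [f fE] := copair_map u u'.
exists f; apply: inj_surj_bij => [|z]; last first.
  have [y [w [/uE[x <-] /u'E[x' <-] ->]]] := sumNL z.
  by exists (x, x'); rewrite fE.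
apply: inj_of_ker0 => -[x y] fxy; have : u x + u' y = 0 by exact: etrans (esym (fE (x, y))) fxy.
move=> /eqP; rewrite addr_eq0 => /eqP e.
have ux : u x = 0.
  by apply: capNL; [apply/uE; exists x|apply/u'E; exists (- y); rewrite linearN].
have u'y : u' y = 0 by apply/eqP; rewrite -oppr_eq0 -e ux.
by congr (_, _); [apply: uI|apply: u'I]; rewrite raddf0.
Qed.

End Isomorphisms.

Section FiniteType.
Variables (R : comNzRingType) (m : {pred R}).
Hypotheses (noeth : noetherian_ring R) (loc : local_ring m).
Hypothesis hCM : cohen_macaulay m.
Implicit Types A B C M N L : lmodType R.

(** The minimal number of generators of M, which is the length of M/mM, is at least k. *)
Local Notation top_chain k M := (chain k (@mpow R m M 1) (fun=> True)).

Lemma len_top_finite M : fin_gen M -> exists k, has_len k (@mpow R m M 1) (fun=> True).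
Proof.
move=> fgM; have [||||k kM] := @finite_chain R m noeth loc M (@mpow R m M 1) (fun=> True) fgM => //.
- exact: mpow_submod.
- by move=> x z xm _; exists 1%N; rewrite expr1; apply: mulm_mem.
exact: has_len_exists kM.
Qed.

Lemma mpow1_exact A B C (f : {linear A -> B}) (g : {linear B -> C}) : short_exact f g ->
  forall y, @mpow R m C 1 (g y) <-> addS (@mpow R m B 1) (imS f) y.
Proof.
move=> [fI gS fg] y; split=> [/(mpow_surj gS)[y' my' gy']|].
  have /fg[x xE] : g (y - y') = 0 by rewrite linearB gy' subrr.
  by exists y', (f x); split=> //; [exists x|rewrite xE addrC subrK].
move=> [u [_ [mu [x <-] ->]]]; have gfx : g (f x) = 0 by apply/fg; exists x.
rewrite linearD gfx addr0.
exact: mpow_linear.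
Qed.

Lemma len_top_ext A B C a c (f : {linear A -> B}) (g : {linear B -> C}) : short_exact f g ->
  ~ top_chain a.+1 A -> ~ top_chain c.+1 C ->
  ~ top_chain (a + c).+1 B.
Proof.
move=> ex; apply: (chain_ext_bound ex); try exact: mpow_submod.
- by move=> x; apply: mpow_linear.
- exact: mpow1_exact.
Qed.

Lemma len_top_split A B C a c (f : {linear A -> B}) (g : {linear B -> C}) (r : {linear B -> A}) :
  short_exact f g -> cancel f r ->
  top_chain a A -> top_chain c C ->
  top_chain (a + c) B.
Proof.
move=> ex fK ca cc; have [_ gS _] := ex.
apply: (chain_cat (W := addS (@mpow R m B 1) (imS f))).
  apply/chain_image; first exact: mpow_submod.
  by apply: chain_start ca => x /(mpow_linear r); rewrite fK.
apply: chain_start (_ : chain c (fun y => @mpow R m C 1 (g y)) _).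
  by move=> y h; apply/(mpow1_exact ex).
by apply/chain_preim => //; apply: mpow_submod.
Qed.

Lemma len_top_iso M N k : mod_iso M N -> top_chain k M ->
  top_chain k N.
Proof.
move=> /mod_iso_inv[f [g [fK gK]]] cM.
apply/(chain_preim k (mpow_submod m N 1) (f := f)); first by move=> y; exists (g y).
by apply: chain_start cM => x /(mpow_linear g); rewrite fK.
Qed.

Lemma len_top_pos M : fin_gen M -> (exists x : M, x <> 0) ->
  top_chain 1 M.
Proof.
move=> fgM [x x0]; apply: chain1 => // h; apply: x0.
by apply: (nakayama0 noeth loc fgM) => y; apply: h.
Qed.

Section DirectSums.
Variables (n : nat) (X : 'I_n -> mcm m).

Fixpoint direct_sum (s : seq 'I_n) : lmodType R :=
  if s is i :: s' then (X i * direct_sum s')%type else 'rV[R]_0.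

Lemma direct_sum_mcm s : is_mcm m (direct_sum s).
Proof.
elim: s => [|i s IH] /=; first exact: is_mcm_row.
by apply: is_mcm_prod => //; apply: mcm_is_mcm.
Qed.

Lemma direct_sum_cat s t : mod_iso (direct_sum s * direct_sum t)%type (direct_sum (s ++ t)).
Proof.
elim: s => [|i s IH] /=.
  apply: (@mod_iso_pack _ _ _ snd) => //; exists (fun x => (0, x)) => // -[x y].
  by rewrite /= (thinmx0 x).
apply: mod_iso_trans (mod_iso_assoc _ _ _) _.
by apply: mod_iso_prod => //; apply: mod_iso_refl.
Qed.

Hypothesis Xall : forall M : mcm m, indecomposable M -> exists i, mod_iso M (X i).

(** The number of nonzero summands is at most the length of M/mM, by which the
decomposition terminates. *)
Lemma decomposition k M : is_mcm m M -> ~ top_chain k.+1 M ->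
  exists s, (size s <= k)%N /\ mod_iso M (direct_sum s).
Proof.
elim/ltn_ind: k M => k IH M mM nk.
have [M0|] := pselect (forall x : M, x = 0).
  exists [::]; split=> //=; apply: (@mod_iso_pack _ _ _ (fun=> 0)).
    by move=> c x y; rewrite scaler0 addr0.
  by exists (fun=> 0) => x; [rewrite [RHS]M0|rewrite [RHS]thinmx0].
move=> /existsNP Mn0; have [fgM _] := mM.
have k0 : (0 < k)%N.
  by rewrite lt0n; apply/eqP => k0; apply: nk; rewrite k0; apply: len_top_pos.
have [ind|/(decomposable_iso Mn0) [N [L [N0 L0 iso]]]] := pselect (indecomposable M).
  have [i iP] := Xall (M := Mcm mM) ind; exists [:: i]; split=> //=.
  apply: mod_iso_trans iP _; apply: (@mod_iso_pack _ _ _ (fun x => (x, 0))).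
    by move=> c x y; congr (_, _); rewrite /= scaler0 addr0.
  by exists fst => // -[x y]; rewrite /= (thinmx0 y).
have [f [g [fK gK]]] := mod_iso_inv iso.
have mNL : is_mcm m (N * L)%type by apply: (is_mcm_retract noeth loc hCM fK).
have [i iE] := inl_map N L; have [j jE] := inr_map N L.
have ir : cancel i (fst : {linear (N * L)%type -> N}) by move=> x; rewrite iE.
have js : cancel j (snd : {linear (N * L)%type -> L}) by move=> x; rewrite jE.
have mN : is_mcm m N by apply: (is_mcm_retract noeth loc hCM ir).
have mL : is_mcm m L by apply: (is_mcm_retract noeth loc hCM js).
have [[fgN _] [fgL _]] := (mN, mL).
have [a [ca na]] := len_top_finite fgN; have [b [cb nb]] := len_top_finite fgL.
have cab := len_top_iso iso (len_top_split (short_exact_prod iE) ir ca cb).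
have abk : (a + b <= k)%N.
  by rewrite leqNgt; apply/negP => h; apply: nk; apply: chain_le h cab.
have a0 : (0 < a)%N.
  by rewrite lt0n; apply/eqP => a0; apply: na; rewrite a0; apply: len_top_pos.
have b0 : (0 < b)%N.
  by rewrite lt0n; apply/eqP => b0; apply: nb; rewrite b0; apply: len_top_pos.
have [|s [sa sN]] := IH a _ N mN na; first by lia.
have [|t [tb tL]] := IH b _ L mL nb; first by lia.
exists (s ++ t); split; first by rewrite size_cat; lia.
apply: mod_iso_trans (mod_iso_sym iso) _.
exact: mod_iso_trans (mod_iso_prod sN tL) (direct_sum_cat s t).
Qed.

(** By [decomposition] each P_j is a sum of at most k of the finitely many X_i. *)
Lemma pigeonhole_iso k (P : nat -> mcm m) :
  (forall j, ~ top_chain k.+1 (P j)) ->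
  exists i j, (i < j)%N /\ mod_iso (P i) (P j).
Proof.
move=> nk.
have [j|s sP] := @choice nat {bseq k of 'I_n} (fun j s => mod_iso (P j) (direct_sum s)).
  have [s [sk iso]] := decomposition (mcm_is_mcm (P j)) (nk j).
  by exists (Bseq sk).
pose T := {bseq k of 'I_n}; pose F (j : 'I_(#|{: T}|.+1)) := s j.
have /injectivePn[i [j ij Fij]] : ~~ injectiveb F.
  by apply/negP => /injectiveP/leq_card; rewrite card_ord ltnn.
have iso (a b : 'I_(#|{: T}|.+1)) : F a = F b -> mod_iso (P a) (P b).
  by move=> e; apply: mod_iso_trans (sP a) _; rewrite -[s a]/(F a) e; apply: mod_iso_sym.
have [h|h|/ord_inj e] := ltngtP (i : nat) j.
- by exists i, j; split=> //; apply: iso.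
- by exists j, i; split=> //; apply: iso.
- by rewrite e eqxx in ij.
Qed.

End DirectSums.

(** A surjection and its base change have the same kernel. *)
Lemma pullback_extension A B C (P Z : lmodType R) (f : {linear A -> C}) (g : {linear B -> C})
    (p : {linear P -> A}) (q : {linear P -> B}) (k : {linear Z -> B}) :
  is_pullback f g p q -> short_exact k g ->
  exists2 u : {linear Z -> P}, short_exact u p & forall z, q (u z) = k z.
Proof.
move=> pb [kI gS kg]; have [pq ex uniq] := pb.
have [|z0 z0E] := @linear_pack R Z A (fun=> 0); first by move=> *; rewrite scaler0 addr0.
have [|u uE] := pullback_lift (a := z0) (b := k) pb.
  by move=> z; rewrite z0E raddf0; apply/esym/kg; exists z.
exists u => [|z]; last by have [] := uE z.
split; [|exact: pullback_surj pb gS|].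
  by move=> x y e; apply: kI; have [_ <-] := uE x; have [_ <-] := uE y; rewrite e.
move=> t; split=> [pt0|[z <-]]; last by have [-> _] := uE z.
have /kg[z zE] : g (q t) = 0 by rewrite -pq pt0 raddf0.
by exists z; apply: uniq; have [e1 e2] := uE z; rewrite ?e1 ?e2 ?pt0.
Qed.

(** Huneke and Leuschke: the pullbacks P_j of Y -> X along the maps r^j h are
extensions of M by Z = ker pi with boundedly many generators, so P_i and P_j are
isomorphic for some i < j. The pushout sequence 0 -> Z -> Z + P_i -> P_j -> 0 then
splits by Miyata's theorem; as its first map is multiplication by an element of m on
the summand Z, the inclusion of Z in P_i splits too, and r^i h lifts to Y. *)
Theorem power_lifts (X Y M : mcm m) (pi : HomR Y X) (h : HomR M X) r :
  finite_cm_type m -> surjective pi -> r \in m ->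
  exists i (h' : HomR M Y), forall x, r ^+ i *: h x = pi (h' x).
Proof.
move=> [n [W Wall]] piS rm.
have [j|P PP] := @choice nat (mcm m) (fun j P => exists (p : HomR P M) (q : HomR P Y),
    is_pullback (r ^+ j \*: h : HomR M X) pi p q).
  exact: (pullback_exists noeth loc hCM).
have [Z [k exk]] := kernel_exists piS; have [kI _ kpi] := exk.
have [fgY _] := mcm_is_mcm Y; have fgZ := fin_gen_inj noeth kI fgY.
have [fgM _] := mcm_is_mcm M.
have [a [_ na]] := len_top_finite fgZ; have [c [_ nc]] := len_top_finite fgM.
have [j|i [j [ij [phi [phi' phiK phi'K]]]]] := @pigeonhole_iso n W Wall (a + c) P.
  have [p [q pb]] := PP j; have [u exu _] := pullback_extension pb exk.
  exact: len_top_ext exu na nc.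
have [p [q pbi]] := PP i; have [p' [q' pbj]] := PP j.
have [u exu uq] := pullback_extension pbi exk; have [u' exu' u'q'] := pullback_extension pbj exk.
have [pq _ uniq] := pbi; have [p'q' _ uniq'] := pbj.
have [uI pS up] := exu; have [u'I p'S u'p'] := exu'.
have pu z : p (u z) = 0 by apply/up; exists z.
have p'u' z : p' (u' z) = 0 by apply/u'p'; exists z.
set s := r ^+ (j - i).
have sm : s \in m.
  by rewrite /s; case: (j - i)%N (subn_gt0 i j) => [|l _]; [rewrite ij|rewrite exprS; apply: (mMr loc)].
have [|b bE] := pullback_lift (a := p) (b := s \*: q) pbj.
  move=> t; have /= e := pq t.
  by rewrite /= linearZ /= -e scalerA -exprD subnK // ltnW.
have [|f fE] := @linear_pack R Z (Z * P i)%type (fun z => (s *: z, - u z)).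
  move=> d x y; congr (_, _) => /=; last by rewrite linearP opprD scalerN.
  by rewrite scalerDr !scalerA mulrC.
have [g gE] := copair_map u' b.
have exfg : short_exact f g.
  split=> [x y|t|[z t]].
  - by rewrite !fE => -[_ /oppr_inj]; apply: uI.
  - have [w wE] := pS (p' t).
    have /u'p'[z zE] : p' (t - b w) = 0 by rewrite linearB (bE w).1 wE subrr.
    by exists (z, w); rewrite gE /= zE subrK.
  rewrite gE /=; split=> [e|[y]]; last first.
    rewrite fE => -[<- <-]; apply: uniq'.
      by rewrite linearD (bE _).1 linearN pu oppr0 addr0 p'u' raddf0.
    by rewrite linearD (bE _).2 u'q' /= linearN uq linearZ raddf0 scalerN subrr.
  have pt0 : p t = 0.
    by have := congr1 p' e; rewrite linearD p'u' add0r (bE t).1 raddf0.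
  have /up[z1 z1E] := pt0; exists (- z1); rewrite fE !linearN opprK z1E.
  congr (_, _); apply/eqP; rewrite eq_sym -addr_eq0; apply/eqP/kI.
  have := congr1 q' e; rewrite linearD (bE t).2 u'q' /= -z1E uq => e'.
  by rewrite linearD linearZ e' !raddf0.
have [f' f'E] := inl_map Z (P i).
have [|g' g'E] := @linear_pack R (Z * P i)%type (P j) (fun t => phi t.2).
  by move=> d x y; rewrite linearP.
have exf'g' : short_exact f' g'.
  split=> [x y|t|[z t]].
  - by rewrite !f'E => -[].
  - by exists (0, phi' t); rewrite g'E /= phi'K.
  rewrite g'E /=; split=> [e|[y]]; last by rewrite f'E => -[_ <-]; apply: raddf0.
  exists z; rewrite f'E; congr (_, _); apply: (can_inj phiK).
  by rewrite e raddf0.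
have [|r' r'E] := @linear_pack R (Z * P i)%type Z fst; first by move=> *.
have fr : cancel f' r' by move=> z; rewrite r'E f'E.
have [fgPi _] := mcm_is_mcm (P i); have [fgPj _] := mcm_is_mcm (P j).
have [t tK] := miyata noeth loc fgZ (fin_gen_prod fgZ fgPi) fgPj exfg exf'g' fr.
have [|l lE] := @linear_pack R (P i) Z (fun w => t (0, - w)).
  move=> d x y; rewrite -linearP; congr (t _); congr (_, _); rewrite /= ?scaler0 ?addr0 //.
  by rewrite opprD scalerN.
(* The composite of u and l is 1 - s t_1, for t_1 the restriction of t to Z. *)
have luB : bijective (l \o u).
  apply: (surjective_bijective noeth fgZ); apply: (surjective_mod_m noeth loc fgZ) => x.
  exists x; rewrite -[X in X - _]tK fE /= lE -linearB.
  rewrite (_ : _ - _ = s *: ((x, 0) : (Z * P i)%type)); last first.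
    by congr (_, _); rewrite /= ?subr0 // subrr scaler0.
  by rewrite linearZ; apply: mulm_mem.
have [e eK Ke] := luB; have Ke' z : l (u (e z)) = z := Ke z.
have [|||h' h'E] := @linear_of_rel R M Y (fun x y => exists2 w, p w = x & y = q (w - u (e (l w)))).
- by move=> x; have [w <-] := pS x; exists (q (w - u (e (l w)))), w.
- move=> d x x' y y' [w <- ->] [w' <- ->]; exists (d *: w + w'); first exact: linearP.
  rewrite -linearP; congr (q _); rewrite scalerBr addrACA -opprD; congr (_ - _).
  rewrite -linearP; congr (u _); apply: (can_inj eK).
  by rewrite /= Ke' !linearP !Ke'.
- move=> y [w /up[z <-] ->]; have /= -> := eK z.
  by rewrite subrr raddf0.
exists i, h' => x.
have [w <- ->] := iffRL (h'E x (h' x)) erefl.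
by rewrite -pq /= linearB pu subr0.
Qed.

End FiniteType.

(** * The sum of the indecomposable modules as a generator *)
Section Generator.
Variables (R : comNzRingType) (m : {pred R}).
Hypotheses (noeth : noetherian_ring R) (loc : local_ring m).
Hypothesis hCM : cohen_macaulay m.
Implicit Types (M N : mcm m).

Section Determined.
Variables (F : add_functor m) (G G' : forall M, F M -> Prop).
Hypotheses (sG : subfunctor G) (sG' : subfunctor G').

Definition contained M : Prop := forall x : F M, G' x -> G x.

Lemma contained_retract M N (a : {linear M -> N}) (b : {linear N -> M}) :
  cancel a b -> contained N -> contained M.
Proof.
move=> ab cN x G'x.
have -> : x = fmap F (a : HomR M N) (fmap F (b : HomR N M) x).
  rewrite -fmap_comp -[LHS]fmap_id; congr (fmap F _ x); apply: HomR_ext => y.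
  by rewrite /HomR_comp /= ab.
by apply: sG.2; apply: cN; apply: sG'.2.
Qed.

Lemma contained_prod M N (L : mcm m) (a : {linear M -> L}) (b : {linear L -> M})
    (c : {linear N -> L}) (d : {linear L -> N}) :
  (forall y, y = a (b y) + c (d y)) -> contained M -> contained N -> contained L.
Proof.
move=> e cM cN x G'x; have subL := subgroup_submod (sG.1 L).
have -> : x = fmap F (b : HomR L M) (fmap F (a : HomR M L) x) +
    fmap F (d : HomR L N) (fmap F (c : HomR N L) x).
  rewrite -!fmap_comp -fmap_add -[LHS]fmap_id; congr (fmap F _ x); apply: HomR_ext => y.
  exact: e.
by apply: (submodD subL); apply: sG.2; [apply: cM|apply: cN]; apply: sG'.2.
Qed.

Lemma contained_zero M : (forall x : M, x = 0) -> contained M.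
Proof.
move=> M0 x _; have -> : x = 0; last exact: (sG.1 M).1.
by rewrite -[LHS]fmap_id fmap0.
Qed.

End Determined.

Lemma direct_sum_retract n (W : 'I_n -> mcm m) s i : i \in s ->
  exists (a : {linear W i -> direct_sum W s}) (b : {linear direct_sum W s -> W i}), cancel a b.
Proof.
elim: s => //= j s IH; rewrite inE => /orP[/eqP->|/IH [a [b ab]]].
  have [f fE] := inl_map (W j) (direct_sum W s).
  have [|g gE] := @linear_pack R (W j * direct_sum W s)%type (W j) fst; first by move=> *.
  by exists f, g => x; rewrite fE gE.
have [|f fE] := @linear_pack R (W i) (W j * direct_sum W s)%type (fun x => (0, a x)).
  by move=> c x y; congr (_, _); rewrite /= ?linearP // scaler0 addr0.
have [|g gE] := @linear_pack R (W j * direct_sum W s)%type (W i) (fun t => b t.2).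
  by move=> c x y; rewrite linearP.
by exists f, g => x; rewrite fE gE /= ab.
Qed.

(** For B the direct sum of the indecomposable modules, every module is a direct summand
of a power of B, so subfunctors are determined by their values on B. *)
Lemma additive_generator : finite_cm_type m -> exists B : mcm m,
  forall (F : add_functor m) (G G' : forall M, F M -> Prop), subfunctor G -> subfunctor G' ->
    contained G G' B -> forall M, contained G G' M.
Proof.
move=> [n [W Wall]]; pose D s := Mcm (direct_sum_mcm noeth loc hCM W s).
exists (D (enum 'I_n)) => F G G' sG sG' cB M.
have cW i : contained G G' (W i).
  have [|a [b ab]] := @direct_sum_retract n W (enum 'I_n) i; first exact: mem_enum.
  exact: (contained_retract (N := D (enum 'I_n)) sG sG' ab cB).
have cD s : contained G G' (D s).
  elim: s => [|i s IH]; first by apply: contained_zero => // x; apply: thinmx0.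
  pose E : lmodType R := (W i * direct_sum W s)%type.
  have [a aE] := inl_map (W i) (direct_sum W s).
  have [c cE] := inr_map (W i) (direct_sum W s).
  have [|b bE] := @linear_pack R E (W i) fst; first by move=> *.
  have [|d dE] := @linear_pack R E (direct_sum W s) snd; first by move=> *.
  apply: (@contained_prod F G G' sG sG' (W i) (D s) (D (i :: s)) a b c d) => // -[x y].
  by rewrite aE bE cE dE; congr (_, _); rewrite /= (addr0, add0r).
have [k [_ nk]] := len_top_finite noeth loc (fin_gen_mcm M).
have [s [_ /mod_iso_inv[f [g [fK gK]]]]] := decomposition noeth loc hCM Wall (mcm_is_mcm M) nk.
exact: (contained_retract (N := D s) sG sG' fK (cD s)).
Qed.

End Generator.

(** * Composition series of functors *)
Section FiniteLength.
Variables (R : comNzRingType) (m : {pred R}).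
Hypotheses (noeth : noetherian_ring R) (loc : local_ring m).
Hypothesis hCM : cohen_macaulay m.
Local Notation A := (stable_mod_category hCM).

Section Functor.
Variables (F : add_functor m) (X Y B : mcm m) (pi : HomR Y X) (x0 : F X).
Hypothesis pr : presented pi x0.
Variables (p : nat) (c : 'I_p -> B).
Hypothesis cgen : forall h k : HomR B X, (forall i, h (c i) = k (c i)) -> h = k.

(** The elements of F(B) are the classes of homomorphisms from B to X, and these are
recorded by their values on generators of B; so subfunctors of F give submodules
of X^p. *)
Definition values (G : F B -> Prop) (v : {ffun 'I_p -> X}) : Prop :=
  exists2 h : HomR B X, forall i, h (c i) = v i & G (fmap F h x0).

Lemma values_sub (G G' : F B -> Prop) : (forall v, values G' v -> values G v) ->
  forall x, G' x -> G x.
Proof.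
have [_ gen _] := pr; move=> sub x; have [h ->] := gen _ x => G'x.
have [|k kE] := sub [ffun i => h (c i)]; first by exists h => // i; rewrite ffunE.
by rewrite (@cgen k h) // => i; rewrite kE ffunE.
Qed.

Lemma values_mono (G G' : F B -> Prop) : (forall x, G' x -> G x) ->
  forall v, values G' v -> values G v.
Proof. by move=> sub v [h hE G'h]; exists h => //; apply: sub. Qed.

Lemma values_submod (G : forall M, F M -> Prop) : subfunctor G -> submod (values (@G B)).
Proof.
move=> sG; have sB := subgroup_submod (sG.1 B); split.
  exists 0 => [i|]; first by rewrite ffunE.
  by rewrite fmap0 //; apply: submod0 sB.
move=> a v w [h hE Gh] [k kE Gk]; exists (HomR_comp h (scalar_end B a) + k) => [i|].
  by rewrite !ffunE -hE -kE /HomR_comp /= linearZ.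
by rewrite fmap_add; apply: (submodD sB) => //; rewrite fmap_comp; apply: sG.2.
Qed.

Lemma zero_subfunctor : subfunctor (fun M (x : F M) => x = 0).
Proof.
split=> [M|M N f x ->]; last exact: raddf0.
by split=> // x y -> ->; rewrite subrr.
Qed.

(** F(B) has finite length as an R-module, because by [power_lifts] each element of m
acts on it nilpotently. *)
Lemma values_finite_chain : finite_cm_type m ->
  exists N : nat, ~ chain N (values (fun x => x = 0)) (values (fun=> True)).
Proof.
move=> ft; have [piS _ ker] := pr.
have sT : subfunctor (fun M (x : F M) => True) by [].
apply: (finite_chain noeth loc); last first.
- move=> r v rm [h hE _].
  have [i [h' h'E]] := power_lifts noeth loc hCM h ft piS rm.
  exists i, (HomR_comp h (scalar_end B (r ^+ i))) => [j|].
    by rewrite !ffunE -hE /HomR_comp /= linearZ.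
  apply/ker; exists h'; apply: HomR_ext => x.
  by rewrite /HomR_comp /= linearZ; apply: h'E.
- exact: values_mono.
- exact: (values_submod sT).
- exact: (values_submod zero_subfunctor).
- by apply: fin_gen_ffun => //; apply: fin_gen_mcm.
Qed.

End Functor.

Definition image (W Z : A) (w : hom W Z) M (x : functor_of Z M) : Prop :=
  exists y, nt_of w M y = x.

Lemma image_subfunctor (W Z : A) (w : hom W Z) : subfunctor (@image W Z w).
Proof.
split=> [M|M N f _ [y <-]]; last by exists (fmap (functor_of W) f y); rewrite nt_natural.
split; first by exists 0; rewrite raddf0.
by move=> _ _ [x <-] [y <-]; exists (x - y); rewrite raddfB.
Qed.

(** A composition series consists of successive maximal proper subobjects. They exist by
the ascending chain condition in X^p, and the bound on chains makes the series finite. *)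
Lemma finite_type_finite_length (Z : A) : finite_cm_type m -> finite_length Z.
Proof.
move=> ft; have [B Bgen] := additive_generator noeth loc hCM ft.
have [X [Y [pi [x0 pr]]]] := functor_of_stable Z.
have [p [q qS]] := free_cover (fin_gen_mcm B).
pose c (i : 'I_p) : B := q (delta_mx 0 i).
have cgen (h k : HomR B X) : (forall i, h (c i) = k (c i)) -> h = k.
  move=> hk; apply: HomR_ext => b; have [v <-] := qS b.
  rewrite (row_sum_delta v) !linear_sum; apply: eq_bigr => i _.
  by rewrite !linearZ hk.
have fgX : fin_gen {ffun 'I_p -> X} by apply: fin_gen_ffun => //; apply: fin_gen_mcm.
pose V (W : A) (w : hom W Z) := values x0 c (@image W Z w B).
have sV W (w : hom W Z) : submod (V W w).
  exact: (values_submod x0 c (image_subfunctor w)).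
have VI W W' (w : hom W Z) (w' : hom W' Z) : (forall v, V W' w' v -> V W w v) ->
    forall M x, image w' x -> image (M := M) w x.
  move=> VV; apply: (Bgen _ _ _ (image_subfunctor w) (image_subfunctor w')).
  exact: (values_sub pr cgen VV).
have [N nN] := values_finite_chain pr c ft.
suff main k (W : A) (w : hom W Z) : (forall M, injective (nt_of w M)) ->
    ~ chain k.+1 (values x0 c (fun x => x = 0)) (V W w) -> finite_length W.
  apply: (main N Z (idm Z)) => [M x y|h]; first by rewrite !nt_of_id.
  apply: nN; apply: chain_le (leqnSn N) _; apply: chain_end h => v.
  exact: values_mono.
elim: k W w => [|k IH] W w wI nk.
  apply: finite_length_zero; apply/is_zeroP => M y; apply: (wI M); rewrite raddf0.
  have sub := Bgen _ _ _ (zero_subfunctor _) (image_subfunctor w).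
  apply: (sub _ M); last by exists y.
  apply: (values_sub pr cgen); apply: contrapT => h; apply: nk.
  apply: (chain1 (sV W w) _ h) => v.
  by apply: values_mono => x ->; exists 0; apply: raddf0.
have [/is_zeroP W0|nW0] := pselect (is_zero W).
  by apply: finite_length_zero; apply/is_zeroP.
pose proper W' (w' : hom W' W) := (forall M, injective (nt_of w' M)) /\
  ~ forall M (y : functor_of W M), image w' y.
have [Z0 /is_zeroP Z00] := zero_obj_exists hCM.
have [z zE] := zero_nat_trans (functor_of Z0) (functor_of W).
have [||V' [[W' [w' [[w'I w'nS] ->]]] Vmax]] := @noetherian_maximal _ noeth _
  (fun U => exists W' (w' : hom W' W), proper W' w' /\ U = V W' (compm w w'))
  (V Z0 (compm w (hom_of z))) fgX.
- by move=> U [W' [w' [_ ->]]].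
- exists Z0, (hom_of z); split=> //; split=> [M x y _|h]; first by rewrite (Z00 M x) (Z00 M y).
  by apply/nW0/is_zeroP => M y; have [x <-] := h M y; rewrite nt_of_hom_of zE.
have [S [e [eS eE]]] := cokernel_obj_exists noeth loc w'.
have ww'I M : injective (nt_of (compm w w') M).
  by move=> x y; rewrite !nt_of_comp => /wI/w'I.
apply: (@finite_length_ext _ W' W S w' e).
- by apply: pt_kernel => // M x; rewrite eE.
- exact: pt_cokernel.
- split=> [/is_zeroP S0|T u uM].
    by apply: w'nS => M y; apply/eE; apply: S0.
  have uI := mono_pt noeth loc uM.
  have [Q [f [fS fE]]] := cokernel_obj_exists noeth loc u.
  have [W2 [w2 [w2I w2E]]] := kernel_obj_exists noeth loc (compm f e).
  have [w2S|w2nS] := pselect (forall M (y : functor_of W M), image w2 y).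
    right; apply: pt_iso => M; apply: inj_surj_bij => // y.
    have [x <-] := eS M y; apply/fE.
    by rewrite -nt_of_comp; apply/w2E/w2S.
  left; apply/is_zeroP => M t; apply: (uI M); rewrite raddf0.
  have [y yE] := eS M (nt_of u M t).
  have /w2E[y2 y2E] : nt_of (compm f e) M y = 0.
    by rewrite nt_of_comp yE; apply/fE; exists t.
  have sub : forall v, V W2 (compm w w2) v -> V W' (compm w w') v.
    apply: Vmax; first by exists W2, w2.
    apply: values_mono => x [x' <-]; rewrite nt_of_comp.
    have /w2E[x2 x2E] : nt_of (compm f e) B (nt_of w' B x') = 0.
      by rewrite nt_of_comp (iffRL (eE _ _)) ?raddf0 //; exists x'.
    by exists x2; rewrite nt_of_comp x2E.
  have [|x] := VI _ _ _ _ sub M (nt_of w M y).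
    by exists y2; rewrite nt_of_comp y2E.
  rewrite nt_of_comp => /wI xE.
  by rewrite -yE; apply/eE; exists x.
apply: (IH W' (compm w w') ww'I) => h; apply: nk.
rewrite -addn1; apply: chain_cat h _; apply: chain1 => //.
  by apply: values_mono => x [y <-]; exists (nt_of w' B y); rewrite nt_of_comp.
move=> sub; apply: w'nS => M y.
have [|x] := VI _ _ _ _ sub M (nt_of w M y); first by exists y.
by rewrite nt_of_comp => /wI <-; exists x.
Qed.

End FiniteLength.

(** * The theorem *)
Theorem theorem1p1 (R : comNzRingType) (m : {pred R})
    (hnoeth : noetherian_ring R) (hloc : local_ring m)
    (hcompl : adically_complete m) (hCM : cohen_macaulay m) :
  finite_cm_type m <-> KGdim (stable_mod_category hCM) = Some 0%N.
Proof.
rewrite KGdim_zero; split=> [ft Z|h].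
  exact/(stable_finite_length hnoeth hloc)/finite_type_finite_length.
apply: (finite_length_finite_type hnoeth hloc (hCM := hCM) hcompl) => Z.
exact/(stable_finite_length hnoeth hloc).
Qed.
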